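(* Let $c>0$ and let $u_{KG}$ be the solution of the Klein-Gordon equation on $\mathbb{R}$, $$[\partial_{tt}-c^2\partial_{xx}+c^4]\,u_{KG}(t)=0\quad(t\geqslant0),\qquad u_{KG}(0)=u_0,\quad \partial_tu_{KG}(0)=v_0,$$ with $u_0,v_0\in\mathcal{S}'(\mathbb{R})$ such that $\mathcal{F}^{-1}a_+(u_0,v_0)$ and $\mathcal{F}^{-1}a_-(u_0,v_0)$ both satisfy Condition (C3$_{\mu,\alpha,r}$), where $\mu\in(0,1]$, $\alpha-\mu>3$ and $0\leqslant r\leqslant c$ (notation in the context). Then there exist constants $c^{(1)},c^{(2)},c_c^{(1)},c_c^{(2)}$ depending only on $u_0,v_0$ and $f_{KG}$ (in particular independent of $(t,x)$) such that $$\forall\,(t,x)\in\mathfrak{C}_{f_{KG}}(-\infty,+\infty)\qquad |u_{KG}(t,x)|\leqslant c^{(1)}\,t^{-\frac\mu2}+c^{(2)}\,t^{-\frac12},$$ $$\forall\,(t,x)\in\mathfrak{C}_{f_{KG}}(-\infty,+\infty)^c\qquad |u_{KG}(t,x)|\leqslant c_c^{(1)}\,t^{-\mu}+c_c^{(2)}\,t^{-1},$$ where $\mathfrak{C}_{f_{KG}}(-\infty,+\infty)=\{(t,x)\in(0,+\infty)\times\mathbb{R} : -c<\frac{x}{t}<c\}$ and $\mathfrak{C}_{f_{KG}}(-\infty,+\infty)^c$ is its complement in $(0,+\infty)\times\mathbb{R}$.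
   Context: Fourier transform: $\mathcal{F}u(p)=\int_{\mathbb{R}}u(x)e^{-ixp}\,dx$, extended to tempered distributions $\mathcal{S}'(\mathbb{R})$. Put $f_{KG}(p)=\sqrt{c^4+c^2p^2}$ and $$a_\pm(u_0,v_0):=\frac12\left(\mathcal{F}u_0\pm\frac{i}{f_{KG}}\,\mathcal{F}v_0\right).$$ The solution, belonging to $\mathcal{C}^2(\mathbb{R}_+,\mathcal{S}'(\mathbb{R}))$, is $$u_{KG}(t)=\mathcal{F}^{-1}\big(e^{-itf_{KG}}a_+(u_0,v_0)\big)+\mathcal{F}^{-1}\big(e^{itf_{KG}}a_-(u_0,v_0)\big);$$ under the hypotheses $a_\pm(u_0,v_0)\in L^1(\mathbb{R})$ and this defines a complex-valued function of $(t,x)$, with $\mathcal{F}^{-1}g(x)=\frac1{2\pi}\int_{\mathbb{R}}g(p)e^{ixp}\,dp$. Condition (C3$_{\mu,\alpha,r}$) for a tempered distribution $w$ ($\mu\in(0,1]$, $\alpha>\mu$, $r\geqslant0$): there exists a bounded differentiable function $\tilde u:\mathbb{R}\to\mathbb{C}$, with $\tilde u(0)\neq0$ if $\mu\neq1$, such that $\mathcal{F}w(p)=|p|^{\mu-1}\,\tilde u(p)$ for all $p\in\mathbb{R}\setminus\{0\}$; there is $M\geqslant0$ such that $|\tilde u(p)|\leqslant M(1+p^2)^{-\alpha/2}$ for all $p\in\mathbb{R}$; and $\tilde u'\in L^1_{loc}(\mathbb{R})$ and there is $M'\geqslant0$ such that $\|\tilde u'\|_{L^1(n,n+1)}\leqslant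 M'|n|^{-\alpha}$ for all $n\in\mathbb{Z}$ with $|n|\geqslant r$ (if $r=0$, the condition for $n=0$ is regarded as void). *)

(* Defs.v *)
From HB Require Import structures.
From mathcomp Require Import all_boot all_order all_algebra.
From mathcomp Require Import complex.
From mathcomp Require Import all_classical all_reals all_analysis.

Set Implicit Arguments.
Unset Strict Implicit.
Unset Printing Implicit Defensive.

Import Order.TTheory GRing.Theory Num.Theory.
Import numFieldNormedType.Exports.

Local Open Scope classical_set_scope.
Local Open Scope complex_scope.
Local Open Scope ring_scope.

(* Analysis of complex-valued functions is done on real and imaginary parts;
   the modulus of [R[i]] itself, [`|z|], is not used because it lies in [R[i]]
   rather than in [R]. *)

Notation cabs := ComplexField.Normc.normc.

Section ComplexValued.
Context {R : realType}.
Implicit Types f : R -> R[i].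

Definition ccvg {T : Type} (F : set_system T) (f : T -> R[i]) (l : R[i]) :
    Prop :=
  (complex.Re (f x) @[x --> F] --> complex.Re l) /\
  (complex.Im (f x) @[x --> F] --> complex.Im l).

Definition cderivable f : Prop :=
  forall x : R, derivable (fun y => complex.Re (f y)) x 1 /\
                derivable (fun y => complex.Im (f y)) x 1.

Definition cderive f : R -> R[i] :=
  fun x => derive1 (fun y => complex.Re (f y)) x +i*
           derive1 (fun y => complex.Im (f y)) x.

Definition cderiven (n : nat) f : R -> R[i] := iter n cderive f.

Definition cintegrable f : Prop :=
  (@lebesgue_measure R).-integrable setT (fun x => (complex.Re (f x))%:E) /\
  (@lebesgue_measure R).-integrable setT (fun x => (complex.Im (f x))%:E).

Definition cintegral f : R[i] :=
  (\int[@lebesgue_measure R]_(x in setT) complex.Re (f x)) +i*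
  (\int[@lebesgue_measure R]_(x in setT) complex.Im (f x)).

Definition clocally_integrable f : Prop :=
  locally_integrable setT (fun x => complex.Re (f x)) /\
  locally_integrable setT (fun x => complex.Im (f x)).

(* exp(i * theta) *)
Definition expi (theta : R) : R[i] := cos theta +i* sin theta.

Definition fourier f : R -> R[i] :=
  fun p => cintegral (fun x => f x * expi (- (x * p))).

Definition fourierV f : R -> R[i] :=
  fun x => ((2 * pi)^-1)%:C * cintegral (fun p => f p * expi (x * p)).

End ComplexValued.

Section Distributions.
Context {R : realType}.

Definition schwartz (phi : R -> R[i]) : Prop :=
  (forall n, cderivable (cderiven n phi)) /\
  (forall k n, exists M : R,
     forall x, `|x| ^+ k * cabs (cderiven n phi x) <= M).

Definition schwartz_seminorm (k n : nat) (phi : R -> R[i]) : R :=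
  sup [set `|x| ^+ k * cabs (cderiven n phi x) | x in [set: R]].

(* Functionals are total on [R -> R[i]], but only their values on Schwartz
   functions are meaningful: no definition below looks at other values. *)
Definition functional : Type := (R -> R[i]) -> R[i].

Implicit Type w : functional.

Definition tempered w : Prop :=
  (forall (a : R[i]) (phi psi : R -> R[i]), schwartz phi -> schwartz psi ->
     w (fun x => a * phi x + psi x) = a * w phi + w psi) /\
  (exists (N : nat) (C : R), forall phi, schwartz phi ->
     cabs (w phi) <=
       C * \sum_(k < N.+1) \sum_(n < N.+1) schwartz_seminorm k n phi).

(* [w] is the regular distribution given by the function [g]. *)
Definition regular w (g : R -> R[i]) : Prop :=
  forall phi, schwartz phi ->
    cintegrable (fun x => g x * phi x) /\
    w phi = cintegral (fun x => g x * phi x).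

Definition dfourier w : functional := fun phi => w (fourier phi).

Definition dfourierV w : functional := fun phi => w (fourierV phi).

Definition dmul (g : R -> R[i]) w : functional :=
  fun phi => w (fun x => g x * phi x).

Definition dderive w : functional := fun phi => - w (cderive phi).

(* [du] is the derivative on [0, +oo[ of the curve [u] in S'(R), one-sided at
   0.  Limits in S'(R) are weak-* limits; as S(R) is a Montel space, the C^2
   curves are the same for the strong topology. *)
Definition dist_curve_derive (u du : R -> functional) : Prop :=
  forall phi, schwartz phi -> forall t : R, 0 <= t ->
    ccvg (within [set s : R | 0 <= s] t^')
         (fun s => ((s - t)^-1)%:C * (u s phi - u t phi)) (du t phi).

Definition dist_curve_continuous (u : R -> functional) : Prop :=
  forall phi, schwartz phi -> forall t : R, 0 <= t ->
    ccvg (within [set s : R | 0 <= s] (nbhs t)) (fun s => u s phi) (u t phi).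

Definition tempered_curve (u : R -> functional) : Prop :=
  forall t : R, 0 <= t -> tempered (u t).

End Distributions.

Arguments functional R : clear implicits.

Section ConditionC3.
Context {R : realType}.

(* The equality F w(p) = |p|^(mu-1) ut(p) for p <> 0 says that the tempered
   distribution F w is the regular one given by the right-hand side: in
   particular F w has no part concentrated at 0. *)
Definition condC3 (mu alpha r : R) (w : functional R) : Prop :=
  exists ut : R -> R[i],
    [/\ cderivable ut,
        exists B : R, forall p, cabs (ut p) <= B,
        mu != 1 -> ut 0 != 0 &
        regular (dfourier w) (fun p => (`|p| `^ (mu - 1))%:C * ut p)] /\
    (exists2 M : R, 0 <= M &
       forall p, cabs (ut p) <= M * (1 + p ^+ 2) `^ (- (alpha / 2))) /\
    clocally_integrable (cderive ut) /\
    (exists2 M' : R, 0 <= M' &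
       forall n : int, n != 0 -> r <= `|n%:~R| ->
         (\int[@lebesgue_measure R]_(p in `[n%:~R, (n + 1)%:~R])
            (cabs (cderive ut p))%:E
          <= (M' * `|n%:~R| `^ (- alpha))%:E)%E).

End ConditionC3.

Section KleinGordon.
Context {R : realType}.
Variable c : R.

Definition fKG (p : R) : R := Num.sqrt (c ^+ 4 + c ^+ 2 * p ^+ 2).

Definition a_plus (u0 v0 : functional R) : functional R := fun phi =>
  2^-1 * (dfourier u0 phi + dmul (fun p => 'i%C / (fKG p)%:C) (dfourier v0) phi).

Definition a_minus (u0 v0 : functional R) : functional R := fun phi =>
  2^-1 * (dfourier u0 phi - dmul (fun p => 'i%C / (fKG p)%:C) (dfourier v0) phi).

(* [u] is a solution in C^2([0, +oo[, S'(R)) of the Cauchy problem. *)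
Definition KG_solution (u0 v0 : functional R) (u : R -> functional R) : Prop :=
  exists du ddu : R -> functional R,
    [/\ tempered_curve u, tempered_curve du & tempered_curve ddu] /\
    [/\ dist_curve_derive u du, dist_curve_derive du ddu &
        dist_curve_continuous ddu] /\
    (forall t : R, 0 <= t -> forall phi, schwartz phi ->
       ddu t phi - (c ^+ 2)%:C * dderive (dderive (u t)) phi
         + (c ^+ 4)%:C * u t phi = 0) /\
    (forall phi, schwartz phi -> u 0 phi = u0 phi /\ du 0 phi = v0 phi).

(* The value u_KG(t, x), for [ap], [am] the functions a_+, a_- in L^1(R). *)
Definition uKG (ap am : R -> R[i]) (t x : R) : R[i] :=
  fourierV (fun p => expi (- (t * fKG p)) * ap p) x +
  fourierV (fun p => expi (t * fKG p) * am p) x.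

Definition KG_cone : set (R * R) :=
  [set tx | 0 < tx.1 /\ - c < tx.2 / tx.1 < c].

Definition KG_cone_compl : set (R * R) :=
  [set tx | 0 < tx.1] `\` KG_cone.

End KleinGordon.

(* Main.v *)
Require Import Defs.
From HB Require Import structures.
From mathcomp Require Import all_boot all_order all_algebra.
From mathcomp Require Import complex ring lra zify.
From mathcomp Require Import all_classical all_reals all_analysis.
From mathcomp Require Import measurable_realfun.

Set Implicit Arguments.
Unset Strict Implicit.
Unset Printing Implicit Defensive.

Import Order.TTheory GRing.Theory Num.Theory.
Import numFieldNormedType.Exports.

Local Open Scope classical_set_scope.
Local Open Scope complex_scope.
Local Open Scope ring_scope.

(** The solution is a sum of two oscillatory integrals with the phases
    [x p - t f(p)] and [x p + t f(p)], where [f = fKG c], and with amplitudes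
    [|p|^(mu - 1) ut(p)]. Three arguments are combined.

    Decay. The group velocity [f'] increases from [- c] to [c]. On [|p| <= P] its
    derivative is at least a multiple of [P^-4], so the second test of van der
    Corput gives a gain [t^(-1/2)]; when [|x| >= c t] the phase is not stationary
    and the first test gives [t^-1]. Both come with a constant of order [P^2],
    because [f] is asymptotically linear ([KG_osc_class],
    [KG_osc_class_outside]). If [kappa] denotes the gain, the frequencies below
    [kappa] contribute [kappa^mu] by integrability of the singularity alone; on
    the others the amplitude has bounded variation and Abel summation
    ([abel_bound]) transfers the gain to the integral, cell by cell. The sum over
    the cells converges as [alpha > 3], and the result is a bound by a multiple of
    [kappa^mu + kappa] ([osc_estimate], [uKG_le]). The derivative of [ut] is only
    locally integrable; that it still bounds the variation of [ut] is
    [le_integral_derivative].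

    Identification. A solution is only known as a curve of distributions, and
    has to be shown equal to the two waves. On the Fourier side both solve
    [W'' = - f^2 W] with the same data, so it remains to see that a solution with
    zero data vanishes. Testing with the resolvents [(f^2 + y^2)^-1 psi], which
    stay bounded in S(R), one finds that the exponential moments
    [int_0^T exp(y (T - s)) w(s) ds] of a value [w] of the solution grow only
    polynomially in [y]; this forces [w = 0] ([resolvent_family_eq0],
    [exp_moments_integral_eq0]).
    It rests on Fourier inversion for Schwartz
    functions, proved here with Gaussian kernels ([ft_inversion]).

    Uniformity. The constants are chosen before [mu], [alpha] and [r]. This is
    possible because the distribution determines [mu]: two exponents would give
    two different rates of growth at the origin, which Gaussian tests
    distinguish ([condC3_exponent]). The constants are then those of one
    admissible triple, if there is any. *)

(** * Calculus of complex-valued functions *)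

Section ComplexCalculus.
Context {R : realType}.
Notation Re := complex.Re.
Notation Im := complex.Im.
Implicit Types (z w : R[i]) (f g : R -> R[i]).

Lemma cReD z w : Re (z + w) = Re z + Re w. Proof. by case: z; case: w. Qed.
Lemma cImD z w : Im (z + w) = Im z + Im w. Proof. by case: z; case: w. Qed.
Lemma cReN z : Re (- z) = - Re z. Proof. by case: z. Qed.
Lemma cImN z : Im (- z) = - Im z. Proof. by case: z. Qed.
Lemma cReM z w : Re (z * w) = Re z * Re w - Im z * Im w.
Proof. by case: z; case: w. Qed.
Lemma cImM z w : Im (z * w) = Re z * Im w + Im z * Re w.
Proof. by case: z; case: w. Qed.

Lemma complex_ext z w : Re z = Re w -> Im z = Im w -> z = w.
Proof. by case: z => a b; case: w => a' b' /= -> ->. Qed.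

Lemma cabs_ge0 z : 0 <= cabs z.
Proof. by case: z => a b; exact: sqrtr_ge0. Qed.

Lemma Re_le_cabs z : `|Re z| <= cabs z.
Proof.
case: z => a b /=; rewrite -sqrtr_sqr ler_sqrt ?addr_ge0 ?sqr_ge0//.
by rewrite lerDl sqr_ge0.
Qed.

Lemma Im_le_cabs z : `|Im z| <= cabs z.
Proof.
case: z => a b /=; rewrite -sqrtr_sqr ler_sqrt ?addr_ge0 ?sqr_ge0//.
by rewrite lerDr sqr_ge0.
Qed.

Lemma cabs_le_ReIm z : cabs z <= `|Re z| + `|Im z|.
Proof.
case: z => a b /=; rewrite -[X in _ <= X]ger0_norm ?addr_ge0// -sqrtr_sqr.
rewrite ler_sqrt ?sqr_ge0// sqrrD.
rewrite !real_normK ?num_real// lerD2r lerDl.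
by rewrite mulrn_wge0// mulr_ge0.
Qed.

Lemma cabsM z w : cabs (z * w) = cabs z * cabs w.
Proof. exact: ComplexField.Normc.normcM. Qed.

Lemma cabsD z w : cabs (z + w) <= cabs z + cabs w.
Proof. exact: le_normcD. Qed.

Lemma cabsN z : cabs (- z) = cabs z.
Proof. exact: normcN. Qed.

Lemma cabs_eq0 z : cabs z = 0 -> z = 0.
Proof. exact: ComplexField.Normc.eq0_normc. Qed.

Lemma cabs_real (x : R) : cabs x%:C = `|x|.
Proof. by rewrite /= expr0n /= addr0 sqrtr_sqr. Qed.

Lemma cabs_i : cabs ('i%C : R[i]) = 1.
Proof. by rewrite /= expr0n /= add0r expr1n sqrtr1. Qed.

Lemma cabs_expi (x : R) : cabs (expi x) = 1.
Proof. by rewrite /= cos2Dsin2 sqrtr1. Qed.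

Lemma expiD (x y : R) : expi (x + y) = expi x * expi y.
Proof.
apply: complex_ext; rewrite ?cReM ?cImM /= ?cosD ?sinD; ring.
Qed.

Lemma expi0 : expi (0 : R) = 1.
Proof. by rewrite /expi cos0 sin0. Qed.

Definition cis_derive f (x : R) (l : R[i]) : Prop :=
  is_derive x 1 (fun y => Re (f y)) (Re l) /\
  is_derive x 1 (fun y => Im (f y)) (Im l).

Lemma cis_deriveE f g : (forall x, cis_derive f x (g x)) ->
  cderivable f /\ cderive f = g.
Proof.
move=> fg; split.
  by move=> x; have [[d1 _] [d2 _]] := fg x; split; [exact: d1|exact: d2].
apply/funext => x; have [f1 f2] := fg x.
apply: complex_ext; rewrite /cderive /= derive1E.
  by rewrite derive_val.
by rewrite derive_val.
Qed.

Lemma cderivable_is_derive f : cderivable f ->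
  forall x, cis_derive f x (cderive f x).
Proof.
move=> df x; have [d1 d2] := df x.
by split; apply: DeriveDef; [exact: d1|rewrite /cderive /= derive1E|
  exact: d2|rewrite /cderive /= derive1E].
Qed.

Lemma cis_derive_real (h : R -> R) (x l : R) : is_derive x 1 h l ->
  cis_derive (fun y => (h y)%:C) x l%:C.
Proof. by move=> hl; split => //=; exact: is_derive_cst. Qed.

Lemma cis_derive_eq f x l l' : l = l' -> cis_derive f x l -> cis_derive f x l'.
Proof. by move=> ->. Qed.

Lemma cis_deriveD f g x l m : cis_derive f x l -> cis_derive g x m ->
  cis_derive (fun y => f y + g y) x (l + m).
Proof.
move=> [f1 f2] [g1 g2]; split.
  under eq_fun do rewrite cReD; rewrite cReD; exact: is_deriveD.
under eq_fun do rewrite cImD; rewrite cImD; exact: is_deriveD.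
Qed.

Lemma cis_deriveM f g x l m : cis_derive f x l -> cis_derive g x m ->
  cis_derive (fun y => f y * g y) x (l * g x + f x * m).
Proof.
move=> [f1 f2] [g1 g2]; split.
  under eq_fun do rewrite cReM.
  apply: is_derive_eq.
  rewrite !(cReD, cReM) /GRing.scale /=; ring.
under eq_fun do rewrite cImM.
apply: is_derive_eq.
rewrite !(cImD, cImM) /GRing.scale /=; ring.
Qed.

Lemma cis_derive_cst z x : cis_derive (fun _ => z) x 0.
Proof. by split; exact: is_derive_cst. Qed.

Lemma cis_deriveZ f z x l : cis_derive f x l ->
  cis_derive (fun y => z * f y) x (z * l).
Proof.
move=> fl; have := cis_deriveM (cis_derive_cst z x) fl.
by rewrite mul0r add0r.
Qed.

Lemma is_derive_scale (a x : R) : is_derive x 1 (fun t => t * a) a.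
Proof.
apply: is_derive_eq; rewrite /GRing.scale /= ; ring.
Qed.

Lemma cis_derive_expi (a t : R) :
  cis_derive (fun s => expi (s * a)) t ('i%C * a%:C * expi (t * a)).
Proof.
have da := is_derive_scale a t.
by split; rewrite /=; apply: is_derive_eq; rewrite /GRing.scale /=; ring.
Qed.

Notation mu := (@lebesgue_measure R).

Definition cmeas {d} {T : measurableType d} (f : T -> R[i]) :=
  measurable_fun setT (fun x => Re (f x)) /\
  measurable_fun setT (fun x => Im (f x)).

Lemma cmeas_integrable f : cintegrable f -> cmeas f.
Proof.
by move=> [/integrableP[f1 _] /integrableP[f2 _]]; split; apply/measurable_EFinP.
Qed.

Lemma cmeasM d (T : measurableType d) (f g : T -> R[i]) : cmeas f -> cmeas g -> cmeas (fun x => f x * g x).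
Proof.
move=> [f1 f2] [g1 g2]; split.
  under eq_fun do rewrite cReM.
  by apply: measurable_funB; exact: measurable_funM.
under eq_fun do rewrite cImM.
by apply: measurable_funD; exact: measurable_funM.
Qed.

Lemma cmeasD d (T : measurableType d) (f g : T -> R[i]) : cmeas f -> cmeas g -> cmeas (fun x => f x + g x).
Proof.
move=> [f1 f2] [g1 g2]; split.
  under eq_fun do rewrite cReD.
  exact: measurable_funD.
under eq_fun do rewrite cImD.
exact: measurable_funD.
Qed.

Lemma cmeas_real d (T : measurableType d) (h : T -> R) : measurable_fun setT h -> cmeas (fun x => (h x)%:C).
Proof. by move=> mh; split => //=; exact: measurable_cst. Qed.

Lemma cmeas_cst d (T : measurableType d) z : cmeas (fun _ : T => z).
Proof. by split; exact: measurable_cst. Qed.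

Lemma cmeas_expi d (T : measurableType d) (h : T -> R) : measurable_fun setT h -> cmeas (fun x => expi (h x)).
Proof.
move=> mh; split; rewrite /=.
  exact: (measurableT_comp (continuous_measurable_fun (@continuous_cos R))).
exact: (measurableT_comp (continuous_measurable_fun (@continuous_sin R))).
Qed.

Lemma cderivable_continuous f : cderivable f ->
  continuous (fun x => Re (f x)) /\ continuous (fun x => Im (f x)).
Proof.
move=> df; split=> x; apply: differentiable_continuous; apply/derivable1_diffP.
  exact: (df x).1.
exact: (df x).2.
Qed.

Lemma cmeas_derivable f : cderivable f -> cmeas f.
Proof.
by move=> /cderivable_continuous[f1 f2]; split; exact: continuous_measurable_fun.
Qed.

Lemma cmeas_cabs d (T : measurableType d) (f : T -> R[i]) : cmeas f -> measurable_fun setT (fun x => cabs (f x)).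
Proof.
move=> [f1 f2].
have -> : (fun x => cabs (f x)) =
    (fun x => Num.sqrt ((Re (f x)) ^+ 2 + (Im (f x)) ^+ 2)).
  by apply/funext => x; case: (f x).
apply: measurableT_comp; first exact: (continuous_measurable_fun (@sqrt_continuous R)).
by apply: measurable_funD; exact: measurable_funX.
Qed.

Lemma cintegrable_le f (g : R -> R) : cmeas f -> mu.-integrable setT (EFin \o g) ->
  (forall x, cabs (f x) <= g x) -> cintegrable f.
Proof.
move=> [f1 f2] ig fg.
have g0 x : 0 <= g x := le_trans (cabs_ge0 _) (fg x).
split; apply: (le_integrable _ _ _ ig) => //=; try exact/measurable_EFinP.
- by move=> y _; rewrite lee_fin (ger0_norm (g0 y)); rewrite (le_trans (Re_le_cabs _)).
- by move=> y _; rewrite lee_fin (ger0_norm (g0 y)); rewrite (le_trans (Im_le_cabs _)).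
Qed.

Lemma integrable_cabs f : cintegrable f ->
  mu.-integrable setT (fun x => (cabs (f x))%:E).
Proof.
move=> cf; have [f1 f2] := cf.
apply: (@le_integrable _ _ _ mu setT _ _
  (fun x => (`|Re (f x)| + `|Im (f x)|)%:E)) => //=.
- by apply/measurable_EFinP; apply: cmeas_cabs; exact: cmeas_integrable.
- move=> x _; rewrite lee_fin (ger0_norm (cabs_ge0 _)) ger0_norm ?addr_ge0//.
  exact: cabs_le_ReIm.
- under eq_fun do rewrite EFinD.
  by apply: integrableD => //; [exact: (integrable_norm f1)|exact: (integrable_norm f2)].
Qed.

Lemma cintegrableM_bounded f g (M : R) : cintegrable f -> cmeas g ->
  (forall x, cabs (g x) <= M) -> cintegrable (fun x => f x * g x).
Proof.
move=> cf mg gM; apply: (@cintegrable_le _ (fun x => M * cabs (f x))).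
- by apply: cmeasM => //; exact: cmeas_integrable.
- under [_ \o _]eq_fun do rewrite /= EFinM.
  by apply: integrableZl => //; exact: integrable_cabs.
- by move=> x; rewrite cabsM mulrC ler_wpM2r ?cabs_ge0.
Qed.

Lemma cintegrableZ f z : cintegrable f -> cintegrable (fun x => z * f x).
Proof.
move=> cf; under eq_fun do rewrite mulrC.
by apply: (cintegrableM_bounded (M := cabs z) cf) => //; exact: cmeas_cst.
Qed.

Lemma cintegrableD f g : cintegrable f -> cintegrable g ->
  cintegrable (fun x => f x + g x).
Proof.
move=> [f1 f2] [g1 g2]; split.
  under eq_fun do rewrite cReD EFinD; exact: integrableD.
under eq_fun do rewrite cImD EFinD; exact: integrableD.
Qed.

Lemma cintegralD f g : cintegrable f -> cintegrable g ->
  cintegral (fun x => f x + g x) = cintegral f + cintegral g.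
Proof.
move=> [f1 f2] [g1 g2]; apply: complex_ext.
  rewrite cReD /cintegral /= -RintegralD//; apply: eq_Rintegral => x _; exact: cReD.
rewrite cImD /cintegral /= -RintegralD//; apply: eq_Rintegral => x _; exact: cImD.
Qed.

Lemma cintegralZ f z : cintegrable f ->
  cintegral (fun x => z * f x) = z * cintegral f.
Proof.
move=> [f1 f2]; apply: complex_ext.
  rewrite cReM /cintegral /= -!RintegralZl// -RintegralB//.
  - by apply: eq_Rintegral => x _; rewrite cReM.
  - by under [_ \o _]eq_fun do rewrite /= EFinM; apply: integrableZl.
  - by under [_ \o _]eq_fun do rewrite /= EFinM; apply: integrableZl.
rewrite cImM /cintegral /= -!RintegralZl// -RintegralD//.
- by apply: eq_Rintegral => x _; rewrite cImM.
- by under [_ \o _]eq_fun do rewrite /= EFinM; apply: integrableZl.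
- by under [_ \o _]eq_fun do rewrite /= EFinM; apply: integrableZl.
Qed.

Lemma cintegralB f g : cintegrable f -> cintegrable g ->
  cintegral (fun x => f x - g x) = cintegral f - cintegral g.
Proof.
move=> cf cg; rewrite -mulN1r -cintegralZ// -cintegralD//; last exact: cintegrableZ.
by congr cintegral; apply/funext => x; rewrite mulN1r.
Qed.

Lemma eq_cintegral f g : f =1 g -> cintegral f = cintegral g.
Proof. by move=> /funext ->. Qed.

(** The factor 2 is the price of bounding the real and the imaginary part
    separately. *)
Lemma cabs_cintegral_le f (g : R -> R) : cintegrable f ->
  mu.-integrable setT (EFin \o g) -> (forall x, cabs (f x) <= g x) ->
  cabs (cintegral f) <= 2 * \int[mu]_(x in setT) g x.
Proof.
move=> [f1 f2] ig fg; rewrite (le_trans (cabs_le_ReIm _))// mulr_natl mulr2n.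
apply: lerD; rewrite /cintegral /=; apply: (le_trans (le_normr_Rintegral _ _)) => //;
  apply: le_Rintegral => //=; try exact: integrable_norm.
- by move=> x _; rewrite (le_trans (Re_le_cabs _)).
- by move=> x _; rewrite (le_trans (Im_le_cabs _)).
Qed.

End ComplexCalculus.

(** * Bounded families of Schwartz functions *)

Section SchwartzFamilies.
Context {R : realType}.
Notation Re := complex.Re.
Notation Im := complex.Im.

Lemma is_derive_eqr (f : R -> R) (x l l' : R) : l = l' ->
  is_derive x 1 f l -> is_derive x 1 f l'.
Proof. by move=> ->. Qed.

Lemma is_derive_pow (f : R -> R) (n : nat) (x df : R) : is_derive x 1 f df ->
  is_derive x 1 (fun y => f y ^+ n) (n%:R * f x ^+ n.-1 * df).
Proof.
move=> fd; have -> : (fun y => f y ^+ n) = f ^+ n by rewrite exprfctE.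
exact: is_deriveX.
Qed.

(** The families that are bounded in S(R): each seminorm is bounded uniformly in
    the index. They serve to bound a tempered distribution along the
    resolvents of one test function, uniformly in the spectral parameter. *)
Definition sfam {I : Type} (phi : I -> R -> R[i]) : Prop :=
  (forall i n, cderivable (cderiven n (phi i))) /\
  (forall k n, exists M : R,
     forall i x, `|x| ^+ k * cabs (cderiven n (phi i) x) <= M).

Lemma schwartz_sfam phi : schwartz phi <-> sfam (fun _ : unit => phi).
Proof.
split=> [[d b]|[d b]]; split.
- by move=> _; exact: d.
- by move=> k n; have [M hM] := b k n; exists M => _.
- exact: d tt.
- by move=> k n; have [M hM] := b k n; exists M => x; exact: (hM tt).
Qed.

Section Family.
Context {I : Type}.
Implicit Types (phi psi : I -> R -> R[i]).

Lemma sfam_schwartz phi : sfam phi -> forall i, schwartz (phi i).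
Proof.
move=> [d b] i; split; first exact: d.
by move=> k n; have [M hM] := b k n; exists M => x; exact: (hM i).
Qed.

Definition rapid phi : Prop := forall k, exists M : R,
  forall i x, `|x| ^+ k * cabs (phi i x) <= M.

(** If every member of a class of rapidly decreasing families has its derivative
    in the class, then all derivatives of a member are rapidly decreasing,
    being members themselves. Finding such a class replaces formulas for the
    higher derivatives. *)
Lemma sfam_coind (C : (I -> R -> R[i]) -> Prop) :
  (forall phi, C phi -> exists2 psi, C psi &
     forall i x, cis_derive (phi i) x (psi i x)) ->
  (forall phi, C phi -> rapid phi) ->
  forall phi, C phi -> sfam phi.
Proof.
move=> Cd Cr phi Cphi.
have H n : exists2 psi, C psi & forall i, cderiven n (phi i) = psi i.
  elim: n => [|n [psi Cpsi E]]; first by exists phi.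
  have [psi' Cpsi' d] := Cd _ Cpsi; exists psi' => // i.
  by rewrite /cderiven iterS -/(cderiven n (phi i)) E; have [] := cis_deriveE (d i).
split=> [i n|k n].
  have [psi Cpsi ->] := H n; have [psi' _ d] := Cd _ Cpsi.
  by have [] := cis_deriveE (d i).
have [psi Cpsi E] := H n; have [M hM] := Cr _ Cpsi k.
by exists M => i x; rewrite E.
Qed.

Lemma cderivenSr n (f : R -> R[i]) : cderiven n (cderive f) = cderiven n.+1 f.
Proof. by rewrite /cderiven iterSr. Qed.

Lemma sfam_derive phi : sfam phi -> sfam (fun i => cderive (phi i)).
Proof.
move=> [d b]; split=> [i n|k n].
  by rewrite cderivenSr; exact: d.
have [M hM] := b k n.+1; exists M => i x.
by rewrite cderivenSr; exact: hM.
Qed.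

Lemma sfam_is_derive phi : sfam phi ->
  forall i x, cis_derive (phi i) x (cderive (phi i) x).
Proof. by move=> [d _] i; apply: cderivable_is_derive; exact: (d i 0%N). Qed.

Lemma sfam_rapid phi : sfam phi -> rapid phi.
Proof. by move=> [_ b] k; exact: (b k 0%N). Qed.

Section Multiplier.
Variables (h : I -> R -> R) (H kappa : R) (m : nat).
Hypothesis hH : forall i x, `|h i x| <= H.
Hypothesis dh : forall i (x : R), is_derive x 1 (h i) (kappa * x * h i x ^+ m).

(** The differential equation of [h] turns the derivative of [x^a h^b psi] into
    a combination of functions of the same form, so this span is a class to
    which [sfam_coind] applies. *)
Inductive hspan : (I -> R -> R[i]) -> Prop :=
| hspan_base a b psi : sfam psi ->
    hspan (fun i x => (x ^+ a * h i x ^+ b)%:C * psi i x)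
| hspan_scale z phi : hspan phi -> hspan (fun i x => z * phi i x)
| hspan_add phi psi : hspan phi -> hspan psi ->
    hspan (fun i x => phi i x + psi i x).

Lemma hspan_rapid phi : hspan phi -> rapid phi.
Proof.
elim=> {phi} [a b psi spsi|z phi _ IH|phi psi _ IH1 _ IH2] k.
- have [M hM] := sfam_rapid spsi (k + a)%N; exists (M * H ^+ b) => i x.
  rewrite cabsM cabs_real normrM !normrX mulrA.
  rewrite (_ : _ * _ = (`|x| ^+ (k + a) * cabs (psi i x)) * `|h i x| ^+ b); last first.
    by rewrite exprD; ring.
  apply: ler_pM => //; first by rewrite mulr_ge0 ?cabs_ge0// exprn_ge0.
  by rewrite lerXn2r ?nnegrE// (le_trans _ (hH i x)).
- have [M hM] := IH k; exists (cabs z * M) => i x.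
  by rewrite cabsM mulrCA ler_wpM2l ?cabs_ge0.
- have [M hM] := IH1 k; have [N hN] := IH2 k; exists (M + N) => i x.
  apply: le_trans (lerD (hM i x) (hN i x)); rewrite -mulrDr ler_wpM2l ?exprn_ge0//.
  exact: cabsD.
Qed.

Lemma hspan_derive phi : hspan phi -> exists2 psi, hspan psi &
  forall i x, cis_derive (phi i) x (psi i x).
Proof.
elim=> {phi} [a b psi spsi|z phi _ [psi Hpsi d]|phi psi _ [phi' H1 d1] _ [psi' H2 d2]].
- exists (fun i x => (a%:R * ((x ^+ a.-1 * h i x ^+ b)%:C * psi i x) +
    (b%:R * kappa)%:C * ((x ^+ a.+1 * h i x ^+ (b.-1 + m))%:C * psi i x)) +
     (x ^+ a * h i x ^+ b)%:C * cderive (psi i) x).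
    apply: hspan_add; [apply: hspan_add; apply: hspan_scale; exact: hspan_base|].
    by apply: hspan_base; exact: sfam_derive.
  move=> i x.
  have dx : is_derive x 1 (fun y => y ^+ a * h i y ^+ b)
     (a%:R * (x ^+ a.-1 * h i x ^+ b) +
      b%:R * kappa * (x ^+ a.+1 * h i x ^+ (b.-1 + m))).
    have := is_deriveM (is_derive_pow a (is_derive_id x 1)) (is_derive_pow b (dh i x)).
    apply: is_derive_eqr; rewrite /GRing.scale /= exprS exprD; ring.
  apply: cis_derive_eq (cis_deriveM (cis_derive_real dx) (sfam_is_derive spsi i x)).
  congr (_ + _); rewrite rmorphD /= !rmorphM /= !rmorph_nat; ring.
- exists (fun i x => z * psi i x); first exact: hspan_scale.
  by move=> i x; exact: cis_deriveZ.
- exists (fun i x => phi' i x + psi' i x); first exact: hspan_add.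
  by move=> i x; exact: cis_deriveD.
Qed.

Lemma hspan_sfam phi : hspan phi -> sfam phi.
Proof. by apply: sfam_coind phi; [exact: hspan_derive|exact: hspan_rapid]. Qed.

Lemma sfamM psi : sfam psi -> sfam (fun i x => (h i x)%:C * psi i x).
Proof.
move=> spsi.
have -> : (fun i x => (h i x)%:C * psi i x) =
    (fun i x => (x ^+ 0 * h i x ^+ 1)%:C * psi i x).
  by apply/funext => i; apply/funext => x; rewrite expr0 mul1r expr1.
by apply: hspan_sfam; exact: hspan_base.
Qed.

End Multiplier.

(* Powers of x, scalars and sums are the case h = 1 of the same class. *)
Let one : I -> R -> R := fun _ _ => 1.

Let one_le1 i x : `|one i x| <= 1.
Proof. by rewrite normr1. Qed.

Let one_derive i (x : R) : is_derive x 1 (one i) (0 * x * one i x ^+ 0).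
Proof. by rewrite mul0r mul0r; exact: is_derive_cst. Qed.

Lemma sfamX a psi : sfam psi -> sfam (fun i x => (x ^+ a)%:C * psi i x).
Proof.
move=> spsi.
have -> : (fun i x => (x ^+ a)%:C * psi i x) =
    (fun i x => (x ^+ a * one i x ^+ 0)%:C * psi i x).
  by apply/funext => i; apply/funext => x; rewrite expr0 mulr1.
apply: (hspan_sfam one_le1 one_derive).
exact: (@hspan_base one).
Qed.

Lemma sfamZ z psi : sfam psi -> sfam (fun i x => z * psi i x).
Proof.
move=> spsi; apply: (hspan_sfam one_le1 one_derive).
apply: hspan_scale.
have -> : psi = (fun i x => (x ^+ 0 * one i x ^+ 0)%:C * psi i x).
  by apply/funext => i; apply/funext => x; rewrite !expr0 mulr1 mul1r.
exact: (@hspan_base one).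
Qed.

Lemma sfamD phi psi : sfam phi -> sfam psi -> sfam (fun i x => phi i x + psi i x).
Proof.
move=> sphi spsi; apply: (hspan_sfam one_le1 one_derive).
have E (g : I -> R -> R[i]) : g = (fun i x => (x ^+ 0 * one i x ^+ 0)%:C * g i x).
  by apply/funext => i; apply/funext => x; rewrite !expr0 mulr1 mul1r.
by apply: hspan_add; [rewrite (E phi)|rewrite (E psi)]; exact: (@hspan_base one).
Qed.

Lemma rapid_le phi : rapid phi -> exists M : R,
  forall i x, cabs (phi i x) <= M * (1 + x ^+ 2)^-1.
Proof.
move=> rp; have [M0 h0] := rp 0%N; have [M2 h2] := rp 2.
exists (M0 + M2) => i x.
have p : 0 < 1 + x ^+ 2 by rewrite ltr_pwDl// sqr_ge0.
rewrite -ler_pdivrMr ?invr_gt0// invrK mulrDr mulr1.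
apply: lerD; first by have := h0 i x; rewrite expr0 mul1r.
by have := h2 i x; rewrite real_normK ?num_real// mulrC.
Qed.

End Family.

Lemma schwartz_is_derive (phi : R -> R[i]) : schwartz phi ->
  forall x, cis_derive phi x (cderive phi x).
Proof. by move=> /schwartz_sfam /sfam_is_derive /(_ tt). Qed.

Lemma schwartz_derive (phi : R -> R[i]) : schwartz phi -> schwartz (cderive phi).
Proof. by move=> /schwartz_sfam /sfam_derive /schwartz_sfam. Qed.

Lemma schwartzD (phi psi : R -> R[i]) : schwartz phi -> schwartz psi ->
  schwartz (fun x => phi x + psi x).
Proof. by move=> /schwartz_sfam h1 /schwartz_sfam h2; apply/schwartz_sfam; exact: sfamD h1 h2. Qed.

Lemma schwartzZ z (phi : R -> R[i]) : schwartz phi -> schwartz (fun x => z * phi x).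
Proof. by move=> /schwartz_sfam h1; apply/schwartz_sfam; exact: sfamZ h1. Qed.

Lemma schwartzX a (phi : R -> R[i]) : schwartz phi -> schwartz (fun x => (x ^+ a)%:C * phi x).
Proof. by move=> /schwartz_sfam h1; apply/schwartz_sfam; exact: sfamX h1. Qed.

(** A continuous linear form is bounded on the bounded subsets of S(R). *)
Lemma tempered_sfam_bounded {I : Type} (w : functional R) (phi : I -> R -> R[i]) :
  tempered w -> sfam phi -> exists M : R, forall i, cabs (w (phi i)) <= M.
Proof.
move=> [_ [N [C hC]]] sphi.
have [_ bphi] := sphi.
pose MM k n := sval (cid (bphi k n)).
have hMM k n : forall i x, `|x| ^+ k * cabs (cderiven n (phi i) x) <= MM k n.
  exact: svalP (cid (bphi k n)).
exists (`|C| * \sum_(k < N.+1) \sum_(n < N.+1) `|MM k n|) => i.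
apply: le_trans (hC _ (sfam_schwartz sphi i)) _.
have Sle (k n : nat) : 0 <= schwartz_seminorm k n (phi i) <= `|MM k n|.
  apply/andP; split.
    apply: le_trans (_ : `|0 : R| ^+ k * cabs (cderiven n (phi i) 0) <= _).
      by rewrite mulr_ge0 ?cabs_ge0 ?exprn_ge0.
    apply: ub_le_sup; last by exists (0 : R).
    by exists (MM k n) => _ [x _ <-]; exact: hMM.
  apply: ge_sup; first by exists (`|0 : R| ^+ k * cabs (cderiven n (phi i) 0)); exists (0 : R).
  by move=> _ [x _ <-]; exact: le_trans (hMM _ _ _ _) (ler_norm _).
have S0 : 0 <= \sum_(k < N.+1) \sum_(n < N.+1) schwartz_seminorm k n (phi i).
  by apply: sumr_ge0 => k _; apply: sumr_ge0 => n _; have /andP[] := Sle k n.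
apply: le_trans (ler_wpM2r S0 (ler_norm C)) _.
apply: ler_wpM2l => //; apply: ler_sum => k _; apply: ler_sum => n _.
by have /andP[] := Sle k n.
Qed.

End SchwartzFamilies.

(** * The Fourier transform of Schwartz functions *)

Section FourierSchwartz.
Context {R : realType}.
Notation Re := complex.Re.
Notation Im := complex.Im.
Notation mu := (@lebesgue_measure R).

Lemma cvg_Rintegral_segment (f : R -> R) : mu.-integrable setT (EFin \o f) ->
  \int[mu]_(x in `[- n%:R, n%:R]) f x @[n --> \oo] --> \int[mu]_x f x.
Proof.
move=> intf; have /integrableP[mf _] := intf.
pose g n x := ((f \_ `[- n%:R, n%:R]) x)%:E.
have [//||//|//||_ _ +] := @dominated_convergence _ _ _ mu setT measurableT g
  (EFin \o f) (fun x => `|f x|%:E).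
- move=> n; apply/measurable_EFinP; apply: (measurable_restrictT f _).1 => //.
  by apply: measurable_funTS; exact/measurable_EFinP.
- exact: mf.
- apply: aeW => x _; apply: cvg_near_cst; near=> n.
  rewrite /g patchE mem_set//= in_itv /= -ler_norml.
  by near: n; exact: nbhs_infty_ger.
- exact: integrable_norm.
- apply: aeW => x n _; rewrite /g patchE; case: ifP => _ //.
  by rewrite lee_fin normr0.
move=> h.
have -> : (fun n => \int[mu]_(x in `[- n%:R, n%:R]) f x) =
   (fun n => fine (\int[mu]_x g n x)).
  by apply/funext => n; rewrite Rintegral_mkcond.
apply: (fine_cvg (a := \int[mu]_x f x)); rewrite /Rintegral fineK//.
exact: (integrable_fin_num _ intf).
Unshelve. all: by end_near. Qed.

Lemma cvg_le_harmonic_eq0 (u : R ^nat) (l K : R) : u @ \oo --> l ->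
  (forall n, `|u n| <= K / n.+1%:R) -> l = 0.
Proof.
move=> ul uK; have : u @ \oo --> (0 : R).
  apply/cvgr0Pnorm_le => e e0.
  near=> n; rewrite (le_trans (uK n))// ler_pdivrMr ?ltr0n// mulrC -ler_pdivrMr//.
  rewrite (@le_trans _ _ n%:R) ?ler_nat//; near: n; exact: nbhs_infty_ger.
by move=> u0; exact: (cvg_unique (@Rhausdorff R) ul u0).
Unshelve. all: by end_near. Qed.

Lemma integrable_inv_oneDsqr (M : R) :
  mu.-integrable setT (EFin \o (fun x => M * (1 + x ^+ 2)^-1)).
Proof.
have c : continuous (fun x : R => (1 + x ^+ 2)^-1) := @continuous_oneDsqrV R.
under [EFin \o _]eq_fun do rewrite /= EFinM.
apply: integrableZl => //; apply/integrableP; split.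
  by apply/measurable_EFinP; exact: continuous_measurable_fun.
have p (x : R) : 0 <= (1 + x ^+ 2)^-1 by rewrite invr_ge0 addr_ge0 ?sqr_ge0.
under eq_integral => x _ do rewrite gee0_abs ?lee_fin ?p//.
rewrite ge0_symfun_integralT//; last by move=> x; rewrite /= sqrrN.
by rewrite -set_itvcy integral0y_oneDsqr -EFinM ltry.
Qed.

Lemma rapid_cintegrable {I} (phi : I -> R -> R[i]) : rapid phi ->
  (forall i, cmeas (phi i)) -> forall i, cintegrable (phi i).
Proof.
move=> rp mp i; have [M hM] := rapid_le rp.
exact: cintegrable_le (mp i) (integrable_inv_oneDsqr M) (hM i).
Qed.

Lemma sfam_cintegrable {I} (phi : I -> R -> R[i]) : sfam phi ->
  forall i, cintegrable (phi i).
Proof.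
move=> sp i; apply: rapid_cintegrable; first exact: sfam_rapid.
by move=> j; apply: cmeas_derivable; exact: (sp.1 j 0%N).
Qed.

Lemma schwartz_cintegrable (phi : R -> R[i]) : schwartz phi -> cintegrable phi.
Proof. by move=> /schwartz_sfam /sfam_cintegrable /(_ tt). Qed.

(** One statement for two uses: with [h] linear it differentiates a Fourier
    transform in the frequency, with [h] the dispersion relation it
    differentiates a wave in time. *)
Lemma cis_derive_oscillatory (b : R -> R[i]) (h : R -> R) :
  measurable_fun setT h -> cintegrable b ->
  cintegrable (fun x => (h x)%:C * b x) -> forall t,
  cis_derive (fun t => cintegral (fun x => b x * expi (t * h x))) t
    (cintegral (fun x => 'i%C * (h x)%:C * b x * expi (t * h x))).
Proof.
move=> mh ib ihb t.
pose f s x := b x * expi (s * h x).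
pose df s x := 'i%C * (h x)%:C * b x * expi (s * h x).
have dfE s x : cis_derive (f^~ x) s (df s x).
  apply: cis_derive_eq (cis_deriveZ (b x) (cis_derive_expi (h x) s)).
  by rewrite /df; ring.
have mexp s : cmeas (fun x => expi (s * h x)).
  by apply: cmeas_expi; apply: measurable_funM => //; exact: measurable_cst.
have intf s : cintegrable (f s).
  by apply: (cintegrableM_bounded (M := 1) ib) => // x; rewrite cabs_expi.
have tt : `]t - 1, t + 1[%classic t by rewrite /= in_itv /=; apply/andP; split; lra.
have G0 x : 0 <= cabs ((h x)%:C * b x) by exact: cabs_ge0.
have cdf s x : cabs (df s x) <= cabs ((h x)%:C * b x).
  by rewrite /df cabsM cabs_expi mulr1 -mulrA cabsM cabs_i mul1r.
have iG := integrable_cabs ihb.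
have d1 (s x : R) := dfE s x.
split.
  have dR (s x : R) : is_derive s 1 (fun y => Re (f y x)) (Re (df s x)) by case: (dfE s x).
  have ub s x : `]t - 1, t + 1[%classic s -> setT x ->
      `|partial1of2 (fun s x => Re (f s x)) s x| <= cabs ((h x)%:C * b x).
    move=> _ _; rewrite partial1of2E (@derive_val _ _ _ _ _ _ _ (dR s x)).
    exact: le_trans (Re_le_cabs _) (cdf s x).
  have dd s x : `]t - 1, t + 1[%classic s -> setT x ->
      derivable (fun y => Re (f y x)) s 1 by move=> _ _; case: (dR s x).
  have ii s : `]t - 1, t + 1[%classic s -> mu.-integrable setT (EFin \o (fun x => Re (f s x))).
    by move=> _; case: (intf s).
  have D := derivable_under_integral measurableT tt ii dd G0 iG ub.
  have E := differentiation_under_integral measurableT tt ii dd G0 iG ub.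
  apply: DeriveDef => //; rewrite -derive1E [LHS]E.
  apply: eq_Rintegral => x _.
  by rewrite partial1of2E (@derive_val _ _ _ _ _ _ _ (dR t x)).
have dR (s x : R) : is_derive s 1 (fun y => Im (f y x)) (Im (df s x)) by case: (dfE s x).
have ub s x : `]t - 1, t + 1[%classic s -> setT x ->
    `|partial1of2 (fun s x => Im (f s x)) s x| <= cabs ((h x)%:C * b x).
  move=> _ _; rewrite partial1of2E (@derive_val _ _ _ _ _ _ _ (dR s x)).
  exact: le_trans (Im_le_cabs _) (cdf s x).
have dd s x : `]t - 1, t + 1[%classic s -> setT x ->
    derivable (fun y => Im (f y x)) s 1 by move=> _ _; case: (dR s x).
have ii s : `]t - 1, t + 1[%classic s -> mu.-integrable setT (EFin \o (fun x => Im (f s x))).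
  by move=> _; case: (intf s).
have D := derivable_under_integral measurableT tt ii dd G0 iG ub.
have E := differentiation_under_integral measurableT tt ii dd G0 iG ub.
apply: DeriveDef => //; rewrite -derive1E [LHS]E.
apply: eq_Rintegral => x _.
by rewrite partial1of2E (@derive_val _ _ _ _ _ _ _ (dR t x)).
Qed.

(** The boundary terms of the primitive on [-n, n] are of order n^-2. *)
Lemma integral_derive_eq0 (F f : R -> R) (M : R) :
  (forall x : R, is_derive x 1 F (f x)) -> continuous f ->
  mu.-integrable setT (EFin \o f) -> (forall x, `|F x| <= M * (1 + x ^+ 2)^-1) ->
  \int[mu]_x f x = 0.
Proof.
move=> dF cf intf FM.
apply: (cvg_le_harmonic_eq0 (K := `|M| * 2) (cvg_Rintegral_segment intf)) => n.
have M0 : 0 <= M.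
  have := FM 0; rewrite expr0n addr0 invr1 mulr1; exact: le_trans.
case: n => [|n].
  rewrite oppr0 set_itv1 Rintegral_set1 normr0.
  by rewrite divr_ge0// mulr_ge0.
have cF : continuous F.
  by move=> x; apply: differentiable_continuous; apply/derivable1_diffP; case: (dF x).
have nn : - n.+1%:R < n.+1%:R :> R by rewrite -subr_gt0 opprK -natrD ltr0n.
rewrite /Rintegral (@continuous_FTC2 _ f F)//=.
- rewrite (ger0_norm M0) (le_trans (ler_normB _ _))//.
  apply: le_trans (lerD (FM _) (FM _)) _; rewrite sqrrN -mulrDr -mulrA ler_wpM2l//.
  suff h : (1 + n.+1%:R ^+ 2)^-1 <= n.+2%:R^-1 :> R.
    by rewrite mulr_natl mulr2n; exact: lerD.
  rewrite lef_pV2 ?posrE ?ltr0n//.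
  rewrite -natrX nat1r ler_nat; nia.
- exact: continuous_subspaceT.
- split.
  + by move=> x _; case: (dF x).
  + by apply: cvg_at_right_filter; exact: cF.
  + by apply: cvg_at_left_filter; exact: cF.
- by move=> x _; rewrite derive1E (@derive_val _ _ _ _ _ _ _ (dF x)).
Qed.

(** Both transforms at once: the sign [s] is -1 for [fourier], and 1 for
    [fourierV] up to the factor [(2 * pi)^-1]. *)
Definition ft (s : R) (f : R -> R[i]) (p : R) : R[i] :=
  cintegral (fun x => f x * expi (p * (s * x))).

Lemma fourierE (f : R -> R[i]) p : fourier f p = ft (-1) f p.
Proof. by apply: eq_cintegral => x; congr (_ * expi _); ring. Qed.

Lemma fourierVE (f : R -> R[i]) x : fourierV f x = ((2 * pi)^-1)%:C * ft 1 f x.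
Proof. by congr (_ * _); apply: eq_cintegral => p; congr (_ * expi _); ring. Qed.

Lemma cmeas_kernel (s p : R) : cmeas (fun x => expi (p * (s * x))).
Proof.
apply: cmeas_expi; apply: measurable_funM; first exact: measurable_cst.
by apply: measurable_funM => //; exact: measurable_cst.
Qed.

Lemma cintegrable_kernel (f : R -> R[i]) (s p : R) : cintegrable f ->
  cintegrable (fun x => f x * expi (p * (s * x))).
Proof.
move=> cf; apply: (cintegrableM_bounded (M := 1) cf); first exact: cmeas_kernel.
by move=> x; rewrite cabs_expi.
Qed.

Lemma ft_derivative (phi : R -> R[i]) s p : schwartz phi ->
  cis_derive (ft s phi) p (ft s (fun x => 'i%C * s%:C * (x%:C * phi x)) p).
Proof.
move=> sp; have ip := schwartz_cintegrable sp.
have iX := schwartz_cintegrable (schwartzX 1 sp).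
have mh : measurable_fun setT (fun x : R => s * x).
  by apply: measurable_funM => //; exact: measurable_cst.
have ih : cintegrable (fun x => (s * x)%:C * phi x).
  rewrite (_ : (fun x => _) = fun x => s%:C * ((x ^+ 1)%:C * phi x)); last first.
    by apply/funext => x; rewrite expr1 mulrA -rmorphM.
  exact: cintegrableZ.
apply: cis_derive_eq (cis_derive_oscillatory mh ip ih p).
by apply: eq_cintegral => x; rewrite rmorphM /=; ring.
Qed.

(** Integration by parts: the derivative of [phi] times the kernel has integral
    zero. *)
Lemma ft_of_derivative (phi : R -> R[i]) s p : schwartz phi ->
  ft s (cderive phi) p = - ('i%C * (p * s)%:C) * ft s phi p.
Proof.
move=> sp; have ip := schwartz_cintegrable sp.
have idp := schwartz_cintegrable (schwartz_derive sp).
pose F x := phi x * expi (p * (s * x)).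
pose f x := cderive phi x * expi (p * (s * x)) +
            'i%C * (p * s)%:C * (phi x * expi (p * (s * x))).
have dF x : cis_derive F x (f x).
  have E : (fun x => expi (p * (s * x))) = (fun x : R => expi (x * (p * s))).
    by apply/funext => y; congr expi; ring.
  rewrite /F /f.
  have := cis_deriveM (schwartz_is_derive sp x) (cis_derive_expi (p * s) x).
  have -> : (fun y => phi y * expi (y * (p * s))) = (fun y => phi y * expi (p * (s * y))).
    by apply/funext => y; congr (_ * expi _); ring.
  by apply: cis_derive_eq; rewrite (_ : x * (p * s) = p * (s * x)); ring.
have [d1 d1E] := cis_deriveE dF.
have i1 := cintegrable_kernel s p idp; have i2 := cintegrable_kernel s p ip.
have intf : cintegrable f by apply: cintegrableD => //; exact: cintegrableZ.
have cf : continuous (fun x => Re (f x)) /\ continuous (fun x => Im (f x)).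
  apply: cderivable_continuous.
  have dK x : cis_derive (fun x => expi (p * (s * x))) x ('i%C * (p*s)%:C * expi (x * (p * s))).
    have -> : (fun x => expi (p * (s * x))) = (fun x : R => expi (x * (p * s))).
      by apply/funext => y; congr expi; ring.
    exact: cis_derive_expi.
  have d2 x := cis_deriveM (schwartz_is_derive (schwartz_derive sp) x) (dK x).
  have d3 x := cis_deriveZ ('i%C * (p * s)%:C) (dF x).
  by have [] := cis_deriveE (fun x => cis_deriveD (d2 x) (d3 x)).
have /schwartz_sfam/sfam_rapid/rapid_le[M hM] := sp.
have f0 : cintegral f = 0.
  have hF x : cabs (F x) <= M * (1 + x ^+ 2)^-1.
    by rewrite cabsM cabs_expi mulr1; exact: (hM tt).
  apply: complex_ext; rewrite /cintegral /=.
    apply: (integral_derive_eq0 (F := fun x => Re (F x)) (M := M)).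
    - by move=> x; case: (dF x).
    - by case: cf.
    - by case: intf.
    - by move=> x; rewrite (le_trans (Re_le_cabs _)).
  apply: (integral_derive_eq0 (F := fun x => Im (F x)) (M := M)).
  - by move=> x; case: (dF x).
  - by case: cf.
  - by case: intf.
  - by move=> x; rewrite (le_trans (Im_le_cabs _)).
move: f0; rewrite cintegralD//; last exact: cintegrableZ.
rewrite cintegralZ// -/(ft s _ p) -/(ft s phi p) => /eqP.
by rewrite addr_eq0 => /eqP ->; rewrite mulNr.
Qed.

Lemma ft_bounded {I} (phi : I -> R -> R[i]) s : sfam phi ->
  exists M, forall i p, cabs (ft s (phi i) p) <= M.
Proof.
move=> sp; have [M hM] := rapid_le (sfam_rapid sp).
exists (2 * \int[mu]_x (M * (1 + x ^+ 2)^-1)) => i p.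
apply: cabs_cintegral_le.
- by apply: cintegrable_kernel; exact: sfam_cintegrable.
- exact: integrable_inv_oneDsqr.
- by move=> x; rewrite cabsM cabs_expi mulr1.
Qed.

(** Differentiating a transform multiplies the original by x, and multiplying it
    by p differentiates the original; the transforms of bounded families are
    thus a class to which [sfam_coind] applies. *)
Lemma ft_sfam {I} (phi : I -> R -> R[i]) s : s ^+ 2 = 1 -> sfam phi ->
  sfam (fun i => ft s (phi i)).
Proof.
move=> s1 sp.
apply: (sfam_coind (C := fun psi => exists2 phi, sfam phi & psi = fun i => ft s (phi i))).
- move=> _ [psi spsi ->].
  exists (fun i => ft s (fun x => 'i%C * s%:C * (x%:C * psi i x))).
    by eexists; last reflexivity; exact: sfamZ (sfamX 1 spsi).
  by move=> i x; apply: ft_derivative; exact: (sfam_schwartz spsi).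
- move=> _ [psi spsi ->] k.
  elim: k psi spsi => [|k IH] psi spsi.
    have [M hM] := ft_bounded s spsi; exists M => i x.
    by rewrite expr0 mul1r.
  have [M hM] := IH _ (sfam_derive spsi); exists M => i p.
  apply: le_trans (hM i p).
  rewrite ft_of_derivative; last exact: (sfam_schwartz spsi).
  rewrite cabsM cabsN cabsM cabs_i mul1r cabs_real normrM exprSr.
  have -> : `|s| = 1.
    by apply/eqP; rewrite -(@pexpr_eq1 _ _ 2)// real_normK ?num_real// s1.
  by rewrite mulr1 mulrA.
- by exists phi.
Qed.

Lemma ft_schwartz (phi : R -> R[i]) s : s ^+ 2 = 1 -> schwartz phi ->
  schwartz (ft s phi).
Proof. by move=> s1 /schwartz_sfam sp; apply/schwartz_sfam; exact: ft_sfam s1 sp. Qed.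

End FourierSchwartz.

(** * Fourier inversion *)

Section Inversion.
Context {R : realType}.
Notation Re := complex.Re.
Notation Im := complex.Im.
Notation mu := (@lebesgue_measure R).

Lemma integrable_prodM (f g : R -> R) :
  mu.-integrable setT (EFin \o f) -> mu.-integrable setT (EFin \o g) ->
  (mu \x mu)%E.-integrable setT (fun z : R * R => (f z.1 * g z.2)%:E).
Proof.
move=> /[dup] fi /integrableP[mf _] /[dup] gi /integrableP[mg _].
have mfg : measurable_fun [set: R * R] (fun z : R * R => (f z.1 * g z.2)%:E).
  apply/measurable_EFinP; apply: measurable_funM.
    by apply: (measurableT_comp (f := f)) => //; exact/measurable_EFinP.
  by apply: (measurableT_comp (f := g)) => //; exact/measurable_EFinP.
apply/integrable12ltyP => //=.
have E x : (\int[mu]_y `|(f x * g y)%:E| = `|f x|%:E * \int[mu]_y `|g y|%:E)%E.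
  rewrite -ge0_integralZl//.
    by apply: eq_integral => y _; rewrite /= normrM EFinM.
  exact: (measurable_int mu (integrable_norm gi)).
under eq_integral do rewrite E.
have [ng ngE] : exists ng, (\int[mu]_y `|g y|%:E)%E = ng%:E.
  have := integrable_fin_num measurableT (integrable_norm gi).
  by move=> /fineK <-; eexists.
rewrite ngE.
exact: (integrable_lty measurableT (integrableZr measurableT ng (integrable_norm fi))).
Qed.

(** The product bound makes both iterated integrals absolutely convergent. *)
Lemma cfubini (F : R * R -> R[i]) (a b : R -> R) : cmeas F ->
  mu.-integrable setT (EFin \o a) -> mu.-integrable setT (EFin \o b) ->
  (forall x y, cabs (F (x, y)) <= a x * b y) ->
  cintegral (fun x => cintegral (fun y => F (x, y))) =
  cintegral (fun y => cintegral (fun x => F (x, y))).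
Proof.
move=> [mR mI] ia ib Fab; have iab := integrable_prodM ia ib.
have hR : (mu \x mu)%E.-integrable setT (fun z : R * R => (Re (F z))%:E).
  apply: (le_integrable _ _ _ iab) => //; first exact/measurable_EFinP.
  move=> [x y] _; rewrite lee_fin /=; apply: le_trans (ler_norm _).
  exact: le_trans (Re_le_cabs _) (Fab x y).
have hI : (mu \x mu)%E.-integrable setT (fun z : R * R => (Im (F z))%:E).
  apply: (le_integrable _ _ _ iab) => //; first exact/measurable_EFinP.
  move=> [x y] _; rewrite lee_fin /=; apply: le_trans (ler_norm _).
  exact: le_trans (Im_le_cabs _) (Fab x y).
have kR := Fubini hR; have kI := Fubini hI.
have mF1 x : cmeas (fun y => F (x, y)).
  by split; [apply: (measurableT_comp (f := fun z => Re (F z)))|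
    apply: (measurableT_comp (f := fun z => Im (F z)))] => //;
    exact: measurable_pair1.
have mF2 y : cmeas (fun x => F (x, y)).
  by split; [apply: (measurableT_comp (f := fun z => Re (F z)))|
    apply: (measurableT_comp (f := fun z => Im (F z)))] => //;
    exact: measurable_pair2.
have i1 x : cintegrable (fun y => F (x, y)).
  apply: (cintegrable_le (g := fun y => a x * b y)) => //.
  by under [_ \o _]eq_fun do rewrite /= EFinM; exact: integrableZl.
have i2 y : cintegrable (fun x => F (x, y)).
  apply: (cintegrable_le (g := fun x => a x * b y)) => //.
  by under [_ \o _]eq_fun do rewrite /= EFinM; exact: integrableZr.
have fR1 x := integrable_fin_num measurableT (i1 x).1.
have fR2 y := integrable_fin_num measurableT (i2 y).1.
have fI1 x := integrable_fin_num measurableT (i1 x).2.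
have fI2 y := integrable_fin_num measurableT (i2 y).2.
apply: complex_ext; rewrite /cintegral /= /Rintegral; congr fine.
  under eq_integral => x _ do rewrite (fineK (fR1 x)).
  by under [RHS]eq_integral => y _ do rewrite (fineK (fR2 y)).
under eq_integral => x _ do rewrite (fineK (fI1 x)).
by under [RHS]eq_integral => y _ do rewrite (fineK (fI2 y)).
Qed.

Lemma ft_adjoint s (a b : R -> R[i]) : cintegrable a -> cintegrable b ->
  cintegral (fun p => ft s a p * b p) = cintegral (fun x => a x * ft s b x).
Proof.
move=> ia ib.
pose F (z : R * R) := a z.1 * b z.2 * expi (z.2 * (s * z.1)).
have mF : cmeas F.
  apply: cmeasM; first apply: cmeasM.
  - by have [m1 m2] := cmeas_integrable ia; split;
      [apply: (measurableT_comp (f := fun x => Re (a x)))|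
       apply: (measurableT_comp (f := fun x => Im (a x)))].
  - by have [m1 m2] := cmeas_integrable ib; split;
      [apply: (measurableT_comp (f := fun x => Re (b x)))|
       apply: (measurableT_comp (f := fun x => Im (b x)))].
  - apply: cmeas_expi; apply: measurable_funM => //.
    by apply: measurable_funM => //; exact: measurable_cst.
have Fle x y : cabs (F (x, y)) <= cabs (a x) * cabs (b y).
  by rewrite /F /= !cabsM cabs_expi mulr1.
have := cfubini mF (integrable_cabs ia) (integrable_cabs ib) Fle.
rewrite /F /= => E; rewrite [RHS](_ : _ = cintegral (fun x => cintegral (fun y => F (x, y)))); last first.
  apply: eq_cintegral => x; rewrite -cintegralZ; last exact: cintegrable_kernel.
  by apply: eq_cintegral => y; rewrite /F /= -mulrA; congr (_ * (_ * expi _)); ring.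
rewrite E; apply: eq_cintegral => y.
rewrite mulrC -cintegralZ; last exact: cintegrable_kernel.
by apply: eq_cintegral => x; ring.
Qed.

Lemma ft_continuous s (b : R -> R[i]) : cintegrable b ->
  continuous (fun p => Re (ft s b p)) /\ continuous (fun p => Im (ft s b p)).
Proof.
move=> ib.
have cK x : continuous (fun p : R => Re (expi (p * (s * x))) : R) /\
            continuous (fun p : R => Im (expi (p * (s * x))) : R).
  apply: cderivable_continuous; exact: (cis_deriveE (cis_derive_expi (s * x))).1.
have cR x : continuous (fun p : R => Re (b x * expi (p * (s * x)))).
  have -> : (fun p : R => Re (b x * expi (p * (s * x)))) =
    (fun p => Re (b x) * Re (expi (p * (s * x))) - Im (b x) * Im (expi (p * (s * x)))).
    by apply/funext => p; exact: cReM.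
  have [c1 c2] := cK x; move=> p.
  by apply: cvgB; [apply: cvgM; [exact: cvg_cst|exact: c1]|
                   apply: cvgM; [exact: cvg_cst|exact: c2]].
have cI x : continuous (fun p : R => Im (b x * expi (p * (s * x)))).
  have -> : (fun p : R => Im (b x * expi (p * (s * x)))) =
    (fun p => Re (b x) * Im (expi (p * (s * x))) + Im (b x) * Re (expi (p * (s * x)))).
    by apply/funext => p; exact: cImM.
  have [c1 c2] := cK x; move=> p.
  by apply: cvgD; [apply: cvgM; [exact: cvg_cst|exact: c2]|
                   apply: cvgM; [exact: cvg_cst|exact: c1]].
have ik p := cintegrable_kernel s p ib.
have ub x p : cabs (b x * expi (p * (s * x))) <= cabs (b x).
  by rewrite cabsM cabs_expi mulr1.
split=> p.
  apply: (@continuity_under_integral _ _ _ mu (fun p x => Re (b x * expi (p * (s * x))))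
    setT measurableT (p - 1) (p + 1) _ _ (fun x => cabs (b x))).
  - by move=> q _; case: (ik q).
  - by apply: aeW => x _ q _; exact: cR.
  - exact: integrable_cabs.
  - by move=> q _; apply: aeW => x _; exact: le_trans (Re_le_cabs _) (ub x q).
  - by rewrite inE /= in_itv /=; apply/andP; split; lra.
apply: (@continuity_under_integral _ _ _ mu (fun p x => Im (b x * expi (p * (s * x))))
  setT measurableT (p - 1) (p + 1) _ _ (fun x => cabs (b x))).
- by move=> q _; case: (ik q).
- by apply: aeW => x _ q _; exact: cI.
- exact: integrable_cabs.
- by move=> q _; apply: aeW => x _; exact: le_trans (Im_le_cabs _) (ub x q).
- by rewrite inE /= in_itv /=; apply/andP; split; lra.
Qed.

Lemma cmeas_ft s (b : R -> R[i]) : cintegrable b -> cmeas (ft s b).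
Proof.
by move=> /(ft_continuous s)[c1 c2]; split; exact: continuous_measurable_fun.
Qed.

Definition gaussian (e x : R) : R := expR (- (e * x ^+ 2)).

Lemma gaussian_gt0 e x : 0 < gaussian e x. Proof. exact: expR_gt0. Qed.

Lemma gaussian_le1 e x : 0 < e -> gaussian e x <= 1.
Proof. by move=> e0; rewrite -expR0 ler_expR oppr_le0 mulr_ge0 ?sqr_ge0 ?ltW. Qed.

Lemma gaussian_derive (e x : R) :
  is_derive x 1 (gaussian e) (- (e *+ 2) * x * gaussian e x).
Proof.
have d1 : is_derive x 1 (fun x : R => - (e * x ^+ 2)) (- (e *+ 2) * x).
  have := is_derive_pow 2 (is_derive_id x 1).
  move=> /(is_deriveZ e) /is_deriveN.
  by apply: is_derive_eqr; rewrite /GRing.scale /=; ring.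
have := @is_derive1_comp _ expR (fun x => - (e * x ^+ 2)) _ _ _ (is_derive_expR _) d1.
by apply: is_derive_eqr; rewrite /gaussian mulrC.
Qed.

Lemma gaussian_integral e (m : R) : 0 < e ->
  mu.-integrable setT (EFin \o (fun x => gaussian e (x - m))) /\
  \int[mu]_x gaussian e (x - m) = Num.sqrt (pi / e).
Proof.
move=> e0; pose sg : R := Num.sqrt (e *+ 2)^-1.
have e20 : 0 < (e *+ 2)^-1 by rewrite invr_gt0 mulrn_wgt0.
have sg0 : sg != 0 by rewrite gt_eqF// sqrtr_gt0.
have sg2 : sg ^+ 2 = (e *+ 2)^-1 by rewrite sqr_sqrtr// ltW.
have sg2' : sg ^+ 2 *+ 2 = e^-1.
  by rewrite sg2 -mulr_natr -[e *+ 2]mulr_natr invfM -mulrA mulVf// mulr1.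
pose K := Num.sqrt (pi / e).
have K0 : 0 < K by rewrite sqrtr_gt0 divr_gt0 ?pi_gt0.
have E x : gaussian e (x - m) = K * normal_pdf m sg x.
  rewrite normal_pdfE// /normal_peak /normal_fun.
  rewrite -mulrnAl sg2' [e^-1 * pi]mulrC -/K mulrA divff ?gt_eqF// mul1r.
  by rewrite /gaussian invrK mulNr mulrC.
have := integrable_normal_pdf m sg; have := integral_normal_pdf m sg.
move=> I1 I2.
have -> : (fun x => gaussian e (x - m)) = (fun x => K * normal_pdf m sg x).
  by apply/funext => x; exact: E.
split; first by under [_ \o _]eq_fun do rewrite /= EFinM; exact: integrableZl.
by rewrite RintegralZl// /Rintegral I1 /= mulr1.
Qed.

Lemma exprn_gaussian_le e n : 0 < e -> exists M : R,
  forall x : R, `|x| ^+ n * gaussian e x <= M.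
Proof.
move=> e0; exists (1 + n.+1`!%:R / e ^+ n.+1) => x.
have g0 := gaussian_gt0 e x.
have := expR_ge1Dxn n (mulr_ge0 (ltW e0) (sqr_ge0 x)).
have gE : expR (e * x ^+ 2) * gaussian e x = 1.
  by rewrite /gaussian -expRD subrr expR0.
move=> /(ler_wpM2r (ltW g0)); rewrite gE mulrDl mul1r => h.
have h2 : (e * x ^+ 2) ^+ n.+1 / n.+1`!%:R * gaussian e x <= 1.
  by apply: le_trans h; rewrite lerDr ltW.
have h3 : (x ^+ 2) ^+ n.+1 * gaussian e x <= n.+1`!%:R / e ^+ n.+1.
  rewrite ler_pdivlMr ?exprn_gt0//.
  move: h2; rewrite exprMn -!mulrA [_^-1 * _]mulrC !mulrA ler_pdivrMr ?ltr0n ?fact_gt0//.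
  by rewrite mul1r; apply: le_trans; rewrite le_eqVlt; apply/orP; left; apply/eqP; ring.
apply: le_trans (lerD (gaussian_le1 x e0) h3).
rewrite -[X in _ <= X + _]mul1r -mulrDl ler_wpM2r ?(ltW g0)//.
rewrite -[X in _ <= _ + X ^+ _](real_normK (num_real x)) -exprM.
have [x1|x1] := leP `|x| 1.
  by rewrite (le_trans (exprn_ile1 _ (normr_ge0 x) x1))// lerDl.
by rewrite ler_wpDl// ler_weXn2l ?ltW//; lia.
Qed.

(** The polynomial multiples of a Gaussian are stable under differentiation. *)
Lemma gaussian_schwartz e : 0 < e -> schwartz (fun x => (gaussian e x)%:C).
Proof.
move=> e0; apply/schwartz_sfam.
apply: (sfam_coind (C := fun phi : unit -> R -> R[i] =>
  exists p : {poly R}, phi = fun _ x => (p.[x] * gaussian e x)%:C)).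
- move=> _ [p ->].
  exists (fun _ x => ((p^`() + (- (e *+ 2))%:P * 'X * p).[x] * gaussian e x)%:C).
    by eexists.
  move=> _ x; apply: cis_derive_real.
  have := is_deriveM (is_derive_poly p x) (gaussian_derive e x).
  apply: is_derive_eqr; rewrite hornerD !hornerM hornerC hornerX /GRing.scale /=.
  set c := - (e *+ 2); ring.
- move=> _ [p ->] k.
  have [B hB] : {B : nat -> R | forall n x, `|x| ^+ n * gaussian e x <= B n}.
    by exists (fun n => sval (cid (exprn_gaussian_le n e0))) => n x; exact: (svalP (cid (exprn_gaussian_le n e0)) x).
  exists (\sum_(i < size p) `|p`_i| * B (k + i)%N) => _ x.
  rewrite cabs_real normrM (gtr0_norm (gaussian_gt0 _ _)) mulrA.
  rewrite horner_coef.
  apply: le_trans (_ : `|x| ^+ k * (\sum_(i < size p) `|p`_i| * `|x| ^+ i) * gaussian e x <= _).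
    apply: ler_wpM2r; first exact/ltW/gaussian_gt0.
    apply: ler_wpM2l; first exact: exprn_ge0.
    apply: le_trans (ler_norm_sum _ _ _) _.
    by apply: ler_sum => i _; rewrite normrM normrX.
  rewrite mulr_sumr mulr_suml; apply: ler_sum => i _.
  rewrite mulrCA -mulrA -exprD.
  by apply: ler_wpM2l => //; exact: hB.
- by exists 1%:P; apply/funext => _; apply/funext => x; rewrite hornerC mul1r.
Qed.

Lemma cabs_1B (x : R) : cabs (1 - x%:C) = `|1 - x|.
Proof. by rewrite -cabs_real rmorphB. Qed.

Lemma cis_derive_0_cst (f : R -> R[i]) x y :
  (forall z, cis_derive f z 0) -> f x = f y.
Proof.
move=> f0; apply: complex_ext.
  by apply: (is_derive_0_is_cst (f := fun x => Re (f x))) => z; case: (f0 z).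
by apply: (is_derive_0_is_cst (f := fun x => Im (f x))) => z; case: (f0 z).
Qed.

Lemma cintegral_real (h : R -> R) : cintegral (fun x => (h x)%:C) = (\int[mu]_x h x)%:C.
Proof. by apply: complex_ext => //=; rewrite Rintegral_cst// mul0r. Qed.

(** The transform satisfies the differential equation of the Gaussian on the
    right, by [ft_derivative] and [ft_of_derivative]: its quotient by that
    Gaussian has derivative zero, and the value at 0 is the Gaussian
    integral. *)
Lemma ft_gaussian s e p : s ^+ 2 = 1 -> 0 < e ->
  ft s (fun x => (gaussian e x)%:C) p =
  (Num.sqrt (pi / e) * gaussian ((e *+ 4)^-1) p)%:C.
Proof.
move=> s1 e0; set g := fun x => _.
have sg : schwartz g := gaussian_schwartz e0.
have e1 : e != 0 by rewrite gt_eqF.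
have dg : cderive g = fun x => (- (e *+ 2))%:C * (x%:C * g x).
  have [] := @cis_deriveE _ g (fun x => (- (e *+ 2))%:C * (x%:C * g x)) => // x.
  rewrite /g -!rmorphM mulrA; apply: cis_derive_real; exact: gaussian_derive.
have iX : cintegrable (fun x => x%:C * g x) := schwartz_cintegrable (schwartzX 1 sg).
have fX q : ft s (fun x => x%:C * g x) q =
    ((e *+ 2)^-1 * (q * s))%:C * 'i%C * ft s g q.
  have := ft_of_derivative s q sg; rewrite dg /ft.
  have -> : (fun x => (- (e *+ 2))%:C * (x%:C * g x) * expi (q * (s * x))) =
            (fun x => (- (e *+ 2))%:C * (x%:C * g x * expi (q * (s * x)))).
    by apply/funext => x; ring.
  rewrite cintegralZ; last exact: cintegrable_kernel.
  move=> h; have e2 : (- (e *+ 2))%:C != 0 :> R[i].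
    by rewrite fmorph_eq0 oppr_eq0 mulrn_eq0 /=.
  apply: (mulfI e2); rewrite h -!/(ft s _ q) !mulrA -rmorphM /=.
  have -> : - (e *+ 2) * ((e *+ 2)^-1 * q * s) = - (q * s) by field.
  by rewrite rmorphN; ring.
have dF q : cis_derive (fun q => (expR ((e *+ 4)^-1 * q ^+ 2))%:C * ft s g q) q 0.
  have dE : is_derive q 1 (fun q => expR ((e *+ 4)^-1 * q ^+ 2))
      (expR ((e *+ 4)^-1 * q ^+ 2) * ((e *+ 2)^-1 * q)).
    have d1 : is_derive q 1 (fun q : R => (e *+ 4)^-1 * q ^+ 2) ((e *+ 2)^-1 * q).
      have := is_deriveZ (e *+ 4)^-1 (is_derive_pow 2 (is_derive_id q 1)).
      by apply: is_derive_eqr; rewrite /GRing.scale /=; field.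
    exact: (@is_derive1_comp _ expR (fun q => (e *+ 4)^-1 * q ^+ 2) _ _ _ (is_derive_expR _) d1).
  have := cis_deriveM (cis_derive_real dE) (ft_derivative s q sg).
  apply: cis_derive_eq; rewrite /ft.
  have -> : (fun x => 'i%C * s%:C * (x%:C * g x) * expi (q * (s * x))) =
            (fun x => 'i%C * s%:C * (x%:C * g x * expi (q * (s * x)))).
    by apply/funext => x; ring.
  rewrite cintegralZ; last exact: cintegrable_kernel.
  have := fX q; rewrite /ft => ->.
  rewrite [X in _ + X](_ : _ = (expR ((e *+ 4)^-1 * q ^+ 2))%:C *
     (('i%C * 'i%C) * ((s ^+ 2 * ((e *+ 2)^-1 * q))%:C * ft s g q))); last first.
    rewrite /ft expr2 !rmorphM /=; set J := cintegral _; ring.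
  rewrite -expr2 complex.sqr_i s1 /ft mul1r !rmorphM /=; set J := cintegral _; ring.
(* the product of the transform with the inverse Gaussian is constant *)
have := cis_derive_0_cst p 0 dF.
have g0 : ft s g 0 = (Num.sqrt (pi / e))%:C.
  have [_] := gaussian_integral 0 e0.
  under eq_Rintegral do rewrite subr0.
  move=> <-; rewrite -cintegral_real; apply: eq_cintegral => x.
  by rewrite mul0r expi0 mulr1.
rewrite expr0n mulr0 expR0 mul1r g0 => h.
rewrite mulrC rmorphM /= -h mulrA -rmorphM /= -expRD addrC subrr expR0.
by rewrite mul1r.
Qed.

Lemma is_derive_lipschitz (f df : R -> R) (M x y : R) :
  (forall x : R, is_derive x 1 f (df x)) -> (forall x, `|df x| <= M) ->
  `|f y - f x| <= M * `|y - x|.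
Proof.
move=> fd fM.
wlog xy : x y / x <= y => [H|].
  by have [/H//|/ltW/H] := leP x y; rewrite distrC [`|x - y|]distrC.
have cf : continuous f.
  by move=> z; apply: differentiable_continuous; apply/derivable1_diffP; case: (fd z).
have [c _ ->] := @MVT_segment _ f df x y xy (fun z _ => fd z) (continuous_subspaceT cf).
by rewrite normrM ler_wpM2r.
Qed.

Lemma schwartz_lipschitz (phi : R -> R[i]) : schwartz phi -> exists L : R,
  0 <= L /\ forall x y, cabs (phi y - phi x) <= L * `|y - x|.
Proof.
move=> sp; have dp := schwartz_is_derive sp.
have /schwartz_derive/schwartz_sfam/sfam_rapid/(_ 0%N)[M hM] := sp.
have {}hM x : cabs (cderive phi x) <= M by have := hM tt x; rewrite expr0 mul1r.
have M0 : 0 <= M := le_trans (cabs_ge0 _) (hM 0).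
exists (M + M); split; first exact: addr_ge0.
move=> x y; apply: le_trans (cabs_le_ReIm _) _; rewrite cReD cImD cReN cImN mulrDl.
apply: lerD.
  apply: (@is_derive_lipschitz (fun x => Re (phi x)) (fun x => Re (cderive phi x))).
    by move=> z; case: (dp z).
  by move=> z; exact: le_trans (Re_le_cabs _) (hM z).
apply: (@is_derive_lipschitz (fun x => Im (phi x)) (fun x => Im (cderive phi x))).
  by move=> z; case: (dp z).
by move=> z; exact: le_trans (Im_le_cabs _) (hM z).
Qed.

(** Half of the Gaussian absorbs the factor |z|. *)
Lemma norm_gaussian_le (e z : R) : 0 < e ->
  `|z| * gaussian (e *+ 4)^-1 z <= Num.sqrt (e *+ 8) * gaussian (e *+ 8)^-1 z.
Proof.
move=> e0; have e8 : 0 < e *+ 8 by rewrite mulrn_wgt0.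
have e1 : e != 0 by rewrite gt_eqF.
have -> : gaussian (e *+ 4)^-1 z = gaussian (e *+ 8)^-1 z * gaussian (e *+ 8)^-1 z.
  by rewrite /gaussian -expRD; congr expR; field.
rewrite mulrA ler_wpM2r ?(ltW (gaussian_gt0 _ _))//.
set q := Num.sqrt _; have q0 : 0 < q by rewrite sqrtr_gt0.
have q2 : q ^+ 2 = e *+ 8 by rewrite sqr_sqrtr// ltW.
rewrite /gaussian expRN -q2 ler_pdivrMr ?expR_gt0// -ler_pdivrMl//.
apply: le_trans (expR_ge1Dx _).
have -> : (q ^+ 2)^-1 * z ^+ 2 = (q^-1 * `|z|) ^+ 2.
  by rewrite exprMn exprVn real_normK ?num_real.
set w := q^-1 * _; nra.
Qed.

(** Insert a factor [gaussian e] in the outer integral and move the inner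
    transform onto it with [ft_adjoint]: the result is an average of [phi]
    around [x] with a kernel of total mass [2 * pi] and width [sqrt e]. The
    inserted factor costs O(e) because the transform is integrable against
    [p^2], the averaging costs O(sqrt e) because [phi] is Lipschitz. *)
Theorem ft_inversion s (phi : R -> R[i]) x : s ^+ 2 = 1 -> schwartz phi ->
  ft (- s) (ft s phi) x = (2 * pi)%:C * phi x.
Proof.
move=> s1 sp; have ip := schwartz_cintegrable sp.
have sP := ft_schwartz s1 sp; have iP := schwartz_cintegrable sP.
have [L [L0 hL]] := schwartz_lipschitz sp.
have iX2 := schwartz_cintegrable (schwartzX 2 sP).
have i2 := integrable_cabs iX2.
set C1 := 2 * \int[mu]_p cabs ((p ^+ 2)%:C * ft s phi p).
have C10 : 0 <= C1 by rewrite mulr_ge0// Rintegral_ge0// => p _; exact: cabs_ge0.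
pose C2 := 2 * L * (Num.sqrt 8 * Num.sqrt (pi * (pi *+ 8))).
have C20 : 0 <= C2 by rewrite /C2 !mulr_ge0 ?sqrtr_ge0.
have key (e : R) : 0 < e ->
    cabs (ft (- s) (ft s phi) x - (2 * pi)%:C * phi x) <= C1 * e + C2 * Num.sqrt e.
  move=> e0.
  pose g := fun p => (gaussian e p)%:C.
  pose K y := (Num.sqrt (pi / e) * gaussian (e *+ 4)^-1 (y - x))%:C.
  have e40 : 0 < (e *+ 4)^-1 by rewrite invr_gt0 mulrn_wgt0.
  have e80 : 0 < (e *+ 8)^-1 by rewrite invr_gt0 mulrn_wgt0.
  have e1 : e != 0 by rewrite gt_eqF.
  have ig : cintegrable g := schwartz_cintegrable (gaussian_schwartz e0).
  pose b p := g p * expi (x * (- s * p)).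
  have ib : cintegrable b by exact: cintegrable_kernel.
  have bK y : ft s b y = K y.
    rewrite /K -(ft_gaussian (y - x) s1 e0); apply: eq_cintegral => p.
    by rewrite /b -mulrA -expiD; congr (_ * expi _); ring.
  have [iK0 IK0] := gaussian_integral x e40.
  have iK : cintegrable K.
    split; rewrite /K /=; last exact: integrable0.
    by under eq_fun do rewrite EFinM; exact: integrableZl.
  have IK : cintegral K = (2 * pi)%:C.
    rewrite cintegral_real RintegralZl// IK0 -sqrtrM ?divr_ge0 ?pi_ge0 ?ltW//.
    rewrite (_ : pi / e * _ = (2 * pi) ^+ 2); last by rewrite invrK -mulr_natr; field.
    by rewrite sqrtr_sqr ger0_norm// mulr_ge0// pi_ge0.
  have A := ft_adjoint s ip ib.
  have -> : ft (- s) (ft s phi) x - (2 * pi)%:C * phi x =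
     cintegral (fun p => ft s phi p * expi (x * (- s * p)) - ft s phi p * b p) +
     cintegral (fun y => phi y * K y - phi x * K y).
    have iPb : cintegrable (fun p => ft s phi p * b p).
      apply: (cintegrableM_bounded (M := 1) iP); first exact: cmeas_integrable.
      move=> p; rewrite cabsM cabs_expi mulr1 cabs_real ger0_norm ?gaussian_le1//.
      exact/ltW/gaussian_gt0.
    have ipK : cintegrable (fun y => phi y * K y).
      have /schwartz_sfam/sfam_rapid/(_ 0%N)[M hM] := sp.
      rewrite (_ : (fun y => _) = (fun y => K y * phi y)); last first.
        by apply/funext => y; rewrite mulrC.
      apply: (cintegrableM_bounded (M := M) iK); first exact: cmeas_integrable.
      by move=> y; have := hM tt y; rewrite expr0 mul1r.
    rewrite !cintegralB//; [|exact: cintegrableZ|exact: cintegrable_kernel].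
    rewrite cintegralZ// IK A.
    rewrite (_ : cintegral (fun y => phi y * ft s b y) = cintegral (fun y => phi y * K y)); last first.
      by apply: eq_cintegral => y; rewrite bK.
    by rewrite -/(ft (- s) (ft s phi) x); ring.
  apply: le_trans (cabsD _ _) _; apply: lerD.
    rewrite /C1 -mulrA [_ * e]mulrC -RintegralZl//.
    apply: cabs_cintegral_le.
    - rewrite (_ : (fun p => _) = fun p => (ft s phi p * expi (x * (- s * p))) * (1 - g p)); last first.
        by apply/funext => p; rewrite /b; ring.
      apply: (cintegrableM_bounded (M := 1)); first exact: cintegrable_kernel.
        apply: cmeasD; first exact: cmeas_cst.
        rewrite (_ : (fun p => _) = fun p => (-1) * g p); last first.
          by apply/funext => p; rewrite mulN1r.
        by apply: cmeasM; [exact: cmeas_cst|exact: cmeas_integrable].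
      move=> p; rewrite /g cabs_1B ger0_norm ?subr_ge0 ?gaussian_le1//.
      by rewrite lerBlDr lerDl ltW// gaussian_gt0.
    - by under [_ \o _]eq_fun do rewrite /= EFinM; exact: integrableZl.
    - move=> p.
      rewrite (_ : _ - _ = (1 - g p) * (ft s phi p * expi (x * (- s * p)))); last first.
        by rewrite /b; ring.
      rewrite !cabsM cabs_expi mulr1 mulrA ler_wpM2r ?cabs_ge0//.
      rewrite /g cabs_1B ger0_norm ?subr_ge0 ?gaussian_le1//.
      rewrite cabs_real ger0_norm ?sqr_ge0//.
      have := expR_ge1Dx (- (e * p ^+ 2)); rewrite /gaussian; lra.
  have [i8 I8] := gaussian_integral x e80.
  pose h y := L * Num.sqrt (pi / e) * Num.sqrt (e *+ 8) * gaussian (e *+ 8)^-1 (y - x).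
  have ih : mu.-integrable setT (EFin \o h).
    by rewrite /h; under [_ \o _]eq_fun do rewrite /= EFinM; exact: integrableZl.
  have -> : C2 * Num.sqrt e = 2 * \int[mu]_y h y.
    have p0 : 0 <= pi :> R := pi_ge0 R.
    have n1 : 0 <= pi / e by rewrite divr_ge0// ltW.
    have n2 : 0 <= e *+ 8 by rewrite mulrn_wge0// ltW.
    have n3 : 0 <= pi * (pi *+ 8) :> R by apply: mulr_ge0 => //; exact: mulrn_wge0.
    have n4 : 0 <= pi / e * (e *+ 8) by exact: mulr_ge0.
    have n5 : 0 <= 8 * (pi * (pi *+ 8)) :> R by exact: mulr_ge0.
    rewrite /h RintegralZl// I8 /C2 -!mulrA; congr (_ * (_ * _)).
    rewrite -(sqrtrM e n3) -(sqrtrM _ (ler0n R 8)) -(sqrtrM _ n2) -(sqrtrM _ n1).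
    by congr Num.sqrt; rewrite invrK; field.
  apply: cabs_cintegral_le => //.
    have E : (fun y => phi y * K y - phi x * K y) = (fun y => K y * (phi y - phi x)).
      by apply/funext => y; ring.
    have /schwartz_sfam/sfam_rapid/(_ 0%N)[M hM] := sp.
    rewrite E; apply: (cintegrableM_bounded (M := M + M) iK).
      apply: cmeasD; first exact: cmeas_integrable.
      exact: cmeas_cst.
    move=> y; apply: le_trans (cabsD _ _) _; rewrite cabsN.
    by apply: lerD; [have := hM tt y|have := hM tt x]; rewrite expr0 mul1r.
  move=> y; rewrite -mulrBl cabsM cabs_real ger0_norm; last first.
    by rewrite mulr_ge0 ?sqrtr_ge0// ltW// gaussian_gt0.
  apply: le_trans (ler_wpM2r _ (hL x y)) _.
    by rewrite mulr_ge0 ?sqrtr_ge0// ltW// gaussian_gt0.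
  rewrite /h -!mulrA ler_wpM2l// mulrCA ler_wpM2l ?sqrtr_ge0//.
  exact: norm_gaussian_le.
apply/eqP; rewrite -subr_eq0; apply/eqP; apply: cabs_eq0.
apply: (@cvg_le_harmonic_eq0 R (fun=> cabs (ft (- s) (ft s phi) x - (2 * pi)%:C * phi x))
  _ (C1 + C2)); first exact: cvg_cst.
move=> n; rewrite ger0_norm ?cabs_ge0//.
apply: le_trans (key (n.+1%:R ^- 2) _) _; first by rewrite invr_gt0 exprn_gt0.
rewrite -exprVn sqrtr_sqr ger0_norm ?invr_ge0// mulrDl lerD2r ler_wpM2l//.
rewrite expr2 ler_piMr ?invr_ge0// invf_le1 ?ltr0n// ler1n//.
Qed.

Lemma fourierVK (phi : R -> R[i]) : schwartz phi -> fourierV (fourier phi) = phi.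
Proof.
move=> sp; apply/funext => x; rewrite fourierVE.
have -> : fourier phi = ft (- 1) phi by apply/funext => p; exact: fourierE.
have := @ft_inversion (- 1) phi x; rewrite opprK => -> //; last by rewrite sqrrN expr1n.
by rewrite mulrA -rmorphM /= mulVf ?mul1r// mulf_neq0// gt_eqF// pi_gt0.
Qed.

Lemma fourierK (phi : R -> R[i]) : schwartz phi -> fourier (fourierV phi) = phi.
Proof.
move=> sp; apply/funext => p; rewrite fourierE.
have i1 : cintegrable (ft 1 phi).
  by apply: schwartz_cintegrable; apply: ft_schwartz; rewrite ?expr1n.
have -> : fourierV phi = fun x => ((2 * pi)^-1)%:C * ft 1 phi x.
  by apply/funext => x; exact: fourierVE.
have -> : ft (-1) (fun x => ((2 * pi)^-1)%:C * ft 1 phi x) p =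
    ((2 * pi)^-1)%:C * ft (-1) (ft 1 phi) p.
  rewrite -cintegralZ; last exact: cintegrable_kernel.
  by apply: eq_cintegral => x; rewrite -mulrA.
rewrite ft_inversion ?expr1n//.
by rewrite mulrA -rmorphM /= mulVf ?mul1r// mulf_neq0// gt_eqF// pi_gt0.
Qed.

Lemma fourier_sfam {I} (phi : I -> R -> R[i]) : sfam phi ->
  sfam (fun i => fourier (phi i)).
Proof.
move=> /(ft_sfam (s := -1)); rewrite sqrrN expr1n => /(_ erefl).
congr sfam; apply/funext => i; apply/funext => p; by rewrite fourierE.
Qed.

Lemma fourier_schwartz (phi : R -> R[i]) : schwartz phi -> schwartz (fourier phi).
Proof. by move=> /schwartz_sfam sp; apply/schwartz_sfam; exact: fourier_sfam sp. Qed.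

Lemma fourierV_schwartz (phi : R -> R[i]) : schwartz phi -> schwartz (fourierV phi).
Proof.
move=> sp; have -> : fourierV phi = fun x => ((2 * pi)^-1)%:C * ft 1 phi x.
  by apply/funext => x; exact: fourierVE.
by apply: schwartzZ; apply: ft_schwartz; rewrite ?expr1n.
Qed.

(** The pairing that identifies the inverse transform of an integrable function
    as a tempered distribution. *)
Lemma fourierV_adjoint (g phi : R -> R[i]) : cintegrable g -> schwartz phi ->
  cintegrable (fun x => fourierV g x * phi x) /\
  cintegral (fun x => fourierV g x * phi x) = cintegral (fun p => g p * fourierV phi p).
Proof.
move=> ig sp; have ip := schwartz_cintegrable sp.
have B p : cabs (ft 1 g p) <= 2 * \int[mu]_x cabs (g x).
  apply: cabs_cintegral_le; [exact: cintegrable_kernel|exact: integrable_cabs|].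
  by move=> x; rewrite cabsM cabs_expi mulr1.
have i1 : cintegrable (fun x => ft 1 g x * phi x).
  rewrite (_ : (fun x => _) = (fun x => phi x * ft 1 g x)); last first.
    by apply/funext => x; rewrite mulrC.
  by apply: (cintegrableM_bounded ip (cmeas_ft 1 ig)) => x; exact: B.
have E : (fun x => fourierV g x * phi x) =
    (fun x => ((2 * pi)^-1)%:C * (ft 1 g x * phi x)).
  by apply/funext => x; rewrite fourierVE mulrA.
rewrite E; split; first exact: cintegrableZ.
rewrite cintegralZ// ft_adjoint// -cintegralZ.
  by apply: eq_cintegral => p; rewrite fourierVE mulrCA.
apply: (cintegrableM_bounded (M := 2 * \int[mu]_x cabs (phi x)) ig).
  exact: cmeas_ft.
move=> x; apply: cabs_cintegral_le; [exact: cintegrable_kernel|exact: integrable_cabs|].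
by move=> y; rewrite cabsM cabs_expi mulr1.
Qed.

End Inversion.

(** * Variation and oscillatory integrals *)

Section Variation.
Context {R : realType}.
Notation mu := (@lebesgue_measure R).
Implicit Types (f g M : R -> R) (a b c x y : R).

(** From local to global growth: the points up to which the bound holds have a
    supremum, the local bound on its left shows that it is one of these
    points, and the local bound on its right that it cannot be less than
    [b]. The neighbourhoods may shrink from point to point. *)
Lemma real_growth f M a b : a <= b ->
  (forall x y, a <= x -> x <= y -> y <= b -> M x <= M y) ->
  (forall x, a <= x <= b -> exists2 d, 0 < d &
     forall y, a <= y <= b -> `|y - x| < d -> `|f y - f x| <= `|M y - M x|) ->
  `|f b - f a| <= M b - M a.
Proof.
move=> ab Mnd loc.
pose S := [set x | a <= x <= b /\ `|f x - f a| <= M x - M a].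
have Sa : S a by rewrite /S /= lexx ab !subrr normr0.
have hS : has_sup S by split; [exists a|exists b => x [/andP[]]].
set s := sup S.
have as_ : a <= s by apply: ub_le_sup => //; case: hS.
have sb : s <= b by apply: ge_sup; [exists a|move=> x [/andP[]]].
have [d d0 hd] : exists2 d, 0 < d &
     forall y, a <= y <= b -> `|y - s| < d -> `|f y - f s| <= `|M y - M s|.
  by apply: loc; rewrite as_ sb.
have Ss : `|f s - f a| <= M s - M a.
  have [x [/andP[ax xb] Px] sx] := sup_adherent d0 hS.
  have xs : x <= s by apply: ub_le_sup; [case: hS|split => //; rewrite ax xb].
  have := hd x; rewrite ax xb => /(_ isT).
  rewrite ler0_norm ?subr_le0// opprB => /(_ _) h.
  have {}h : `|f x - f s| <= `|M x - M s| by apply: h; rewrite -/s in sx; lra.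
  have Mxs : M x - M s <= 0 by rewrite subr_le0; exact: Mnd.
  rewrite distrC (ler0_norm Mxs) in h.
  rewrite (_ : f s - f a = (f s - f x) + (f x - f a)); last by ring.
  by apply: le_trans (ler_normD _ _) _; lra.
have [sb'|bs] := ltP s b; last by rewrite (_ : b = s)//; apply/eqP; rewrite eq_le bs sb.
pose y := Num.min b (s + d / 2).
have sy : s < y by rewrite lt_min sb' ltrDl divr_gt0.
have yb : y <= b by rewrite ge_min lexx.
have yd : y <= s + d / 2 by rewrite ge_min lexx orbT.
have ay : a <= y := le_trans as_ (ltW sy).
suff Sy : S y.
  have : y <= s by apply: ub_le_sup; [exact: hS.2|exact: Sy].
  by rewrite leNgt sy.
split; first by rewrite ay yb.
have := hd y; rewrite ay yb gtr0_norm ?subr_gt0// => /(_ isT) h.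
have {}h : `|f y - f s| <= `|M y - M s| by apply: h; lra.
have Mys : 0 <= M y - M s by rewrite subr_ge0; apply: Mnd => //; exact: ltW.
rewrite (ger0_norm Mys) in h.
rewrite (_ : f y - f a = (f y - f s) + (f s - f a)); last by ring.
by apply: le_trans (ler_normD _ _) _; lra.
Qed.

Lemma continuous_integrable f a b : continuous f ->
  mu.-integrable `[a, b] (EFin \o f).
Proof.
move=> cf; apply: continuous_compact_integrable; first exact: segment_compact.
exact: continuous_subspaceT.
Qed.

Lemma integrable_sub f a b x y : a <= x -> y <= b ->
  mu.-integrable `[a, b] (EFin \o f) -> mu.-integrable `[x, y] (EFin \o f).
Proof.
move=> ax yb; apply: integrableS => //; apply: subset_itv; by rewrite bnd_simp.
Qed.

Lemma Rintegral_split f a c b : a <= c -> c <= b ->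
  mu.-integrable `[a, b] (EFin \o f) ->
  \int[mu]_(x in `[a, b]) f x =
  \int[mu]_(x in `[a, c]) f x + \int[mu]_(x in `[c, b]) f x.
Proof.
move=> ac cb fi.
have := @Rintegral_itvB R f (BLeft a) (BRight b) c fi; rewrite !bnd_simp => /(_ ac cb).
rewrite Rintegral_itv_obnd_cbnd; last first.
  apply: integrableS fi => //; apply: subset_itv; by rewrite bnd_simp.
by move/eqP; rewrite subr_eq addrC => /eqP.
Qed.

Lemma mu_itvcc a b : a <= b -> mu `[a, b]%classic = (b - a)%:E.
Proof.
move=> ab; have := @lebesgue_measure_itv R `[a, b]%R; rewrite /= lte_fin => ->.
have [_|ba] := ltP a b; first by rewrite EFinB.
by rewrite (_ : b = a) ?subrr//; apply/eqP; rewrite eq_le ab ba.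
Qed.

Lemma mu_itvoc a b : a <= b -> mu `]a, b]%classic = (b - a)%:E.
Proof.
move=> ab; have := @lebesgue_measure_itv R `]a, b]%R; rewrite /= lte_fin => ->.
have [_|ba] := ltP a b; first by rewrite EFinB.
by rewrite (_ : b = a) ?subrr//; apply/eqP; rewrite eq_le ab ba.
Qed.

Lemma Rintegral_cst_itv a b (k : R) : a <= b -> \int[mu]_(x in `[a, b]) k = k * (b - a).
Proof.
by move=> ab; rewrite Rintegral_cst//; congr (k * _); rewrite -[RHS]/(fine (b - a)%:E) -(mu_itvcc ab).
Qed.

Lemma Rintegral_norm_le f a b (k : R) : a <= b -> mu.-integrable `[a, b] (EFin \o f) ->
  (forall x, a <= x <= b -> `|f x| <= k) ->
  `|\int[mu]_(x in `[a, b]) f x| <= k * (b - a).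
Proof.
move=> ab fi fk; rewrite -(Rintegral_cst_itv k ab).
apply: (le_trans (le_normr_Rintegral _ fi)) => //.
apply: le_Rintegral => //=.
- exact: integrable_norm.
- by apply: continuous_integrable => x; exact: cvg_cst.
Qed.

(** Fundamental theorem of calculus, as an inequality, for a derivative that
    exists everywhere but is merely integrable. Cover each level set [k e <=
    h < (k + 1) e] by an open set [V k] that is hardly larger, and let [M x]
    be the sum over k of [(k + 1) e] times the measure of [V k] in [a, x].
    Near each point, in the level set k say, [f] grows at most at the rate
    [(k + 1) e] while [M] grows at least at that rate; [real_growth]
    concludes, and [M b] is as close as desired to the integral of [h]. *)
Lemma le_integral_derivative f df (h : R -> R) a b : a <= b ->
  (forall x, a <= x <= b -> is_derive x 1 f (df x)) ->
  (forall x, a <= x <= b -> `|df x| <= h x) ->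
  mu.-integrable `[a, b] (EFin \o h) ->
  `|f b - f a| <= \int[mu]_(x in `[a, b]) h x.
Proof.
move=> ab fd dfh ih.
have h0 x : a <= x <= b -> 0 <= h x by move=> /dfh; apply: le_trans.
have mh : measurable_fun `[a, b] h by case/integrableP: ih => /measurable_EFinP.
apply/ler_addgt0Pr => e0 e0_gt0.
pose e := e0 / (b - a + 1).
have ba0 : 0 < b - a + 1 by rewrite ltr_wpDl// subr_ge0.
have e_gt0 : 0 < e by rewrite divr_gt0.
pose E k := `[a, b]%classic `&` h @^-1` `[k%:R * e, k.+1%:R * e[%classic.
have mE k : measurable (E k) by exact: mh.
have Efin k : (mu (E k) < +oo)%E.
  apply: le_lt_trans (_ : mu `[a, b]%classic < +oo)%E.
    by apply: le_measure; [rewrite inE; exact: mE|rewrite inE|exact: subIsetl].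
  by rewrite (mu_itvcc ab) ltry.
pose ck k := k.+1%:R * e.
have ck0 k : 0 < ck k by rewrite mulr_gt0.
have dk0 k : 0 < e / (2 ^ k.+1)%:R / ck k.
  by rewrite !divr_gt0// ltr0n expn_gt0.
have [V hV] : {V : nat -> set R | forall k, [/\ open (V k), E k `<=` V k &
    (mu (V k `\` E k) < (e / (2 ^ k.+1)%:R / ck k)%:E)%E]}.
  exists (fun k => sval (cid (lebesgue_regularity_outer (mE k) (Efin k) (dk0 k)))) => k.
  exact: (svalP (cid (lebesgue_regularity_outer (mE k) (Efin k) (dk0 k)))).
have mV k : measurable (V k) by have [oV _ _] := hV k; exact: open_measurable.
pose m := mseries (fun k => mscale (NngNum (ltW (ck0 k))) (mrestr mu (mV k))) 0.
have mE_ A : m A = (\sum_(0 <= k <oo) (ck k)%:E * mu (A `&` V k))%E by [].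
have mab : (m `[a, b]%classic <= (\int[mu]_(x in `[a, b]) h x + e0)%:E)%E.
  rewrite mE_.
  apply: (@le_trans _ _ (\sum_(0 <= k <oo) ((ck k)%:E * mu (E k) + (e / (2 ^ k.+1)%:R)%:E))%E).
    apply: lee_nneseries => k _.
      by rewrite mule_ge0// lee_fin ltW.
    have [_ EV VE] := hV k.
    have : (mu (`[a, b]%classic `&` V k) <= mu (E k) + (e / (2 ^ k.+1)%:R / ck k)%:E)%E.
      apply: (@le_trans _ _ (mu (V k))).
        by apply: le_measure; [rewrite inE; exact: (measurableI _ _ (measurable_itv _) (mV k))|rewrite inE; exact: mV|exact: subIsetr].
      rewrite -{1}(setDUK EV).
      apply: le_trans (measureU2 mu (mE k) (measurableD (mV k) (mE k))) _.
      by rewrite leeD2l// ltW.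
    move/(lee_wpmul2l (x := (ck k)%:E)); rewrite lee_fin (ltW (ck0 k)) => /(_ isT).
    move/le_trans; apply; rewrite muleDr ?ge0_adde_def ?inE ?lee_fin ?(ltW (dk0 k))//.
    rewrite leeD2l// -EFinM lee_fin mulrCA divff ?mulr1//.
    by rewrite gt_eqF.
  apply: le_trans (epsilon_trick _ _ (ltW e_gt0)) _.
    by move=> k; rewrite mule_ge0// lee_fin ltW.
  have bE : \bigcup_k E k = `[a, b]%classic.
    apply/seteqP; split=> [x [k _ []//]|x xab].
    have h0x : 0 <= h x / e by rewrite divr_ge0 ?(ltW e_gt0)//; apply: h0; move: xab; rewrite /= in_itv.
    exists (Num.truncn (h x / e)) => //; split => //=.
    have /andP[t1 t2] := truncn_itv h0x.
    by rewrite in_itv /= -ler_pdivlMr// t1 -ltr_pdivrMr.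
  have tE : trivIset setT E.
    apply/trivIsetP => i j _ _ ij; apply/seteqP; split => // x [[_ +] [_ +]] /=.
    rewrite /= !in_itv /= => /andP[i1 i2] /andP[j1 j2].
    have := le_lt_trans i1 j2; have := le_lt_trans j1 i2.
    by rewrite !ltr_pM2r// !ltr_nat !ltnS => h1 h2; move/eqP: ij; apply; lia.
  apply: (@le_trans _ _ (\int[mu]_(x in `[a, b]) (h x + e)%:E + e%:E)%E).
    rewrite leeD2r// -bE ge0_integral_bigcup//=; last 2 first.
    - rewrite bE; apply/measurable_EFinP; apply: measurable_funD => //.
    - move=> x; rewrite bE /= in_itv /= => /h0 ?.
      by rewrite lee_fin addr_ge0// ltW.
    apply: lee_nneseries => k _.
      by rewrite mule_ge0// lee_fin ltW.
    have -> : ((ck k)%:E * mu (E k) = \int[mu]_(x in E k) (ck k)%:E)%E.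
      by rewrite integral_cst//; exact: mE.
    apply: ge0_le_integral => //.
    - exact: mE.
    - by move=> x _; rewrite lee_fin ltW.
    - apply/measurable_EFinP; apply: measurable_funD => //.
      by apply: measurable_funS mh => //; exact: subIsetl.
    - move=> x [_ /=]; rewrite in_itv /= => /andP[k1 _].
      by rewrite lee_fin /ck -natr1 mulrDl mul1r lerD2r.
  under eq_integral do rewrite EFinD.
  have ie : mu.-integrable `[a, b] (EFin \o (fun=> e)).
    by apply: continuous_integrable => x; exact: cvg_cst.
  rewrite integralD//= -(fineK (integrable_fin_num _ ih))//.
  rewrite -(fineK (integrable_fin_num _ ie))// -!/(Rintegral _ _ _).
  rewrite -!EFinD lee_fin Rintegral_cst_itv// -addrA lerD2l.
  rewrite (_ : e * (b - a) + e = e0)//.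
  by rewrite -[X in _ + X]mulr1 -mulrDr /e divfK// gt_eqF.
have mfin A : measurable A -> A `<=` `[a, b]%classic -> (m A < +oo)%E.
  move=> mA AS; apply: le_lt_trans (le_lt_trans mab (ltry _)).
  by apply: le_measure => //; rewrite inE.
pose M x := fine (m `[a, x]%classic).
have MB x y : a <= x -> x <= y -> y <= b ->
    M y = M x + fine (m `]x, y]%classic).
  move=> ax xy yb; rewrite /M.
  have s1 : `[a, x]%classic `<=` `[a, b]%classic.
    by apply: subset_itv; rewrite bnd_simp// (le_trans xy).
  have s2 : `]x, y]%classic `<=` `[a, b]%classic by apply: subset_itv; rewrite bnd_simp.
  rewrite -fineD; last 2 first.
  - by rewrite ge0_fin_numE//; exact: mfin.
  - by rewrite ge0_fin_numE//; exact: mfin.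
  rewrite -measureU//.
    congr (fine (m _)); rewrite -itv_bndbnd_setU ?bnd_simp//.
  apply/seteqP; split => // z [] /=; rewrite !in_itv /= => /andP[_ zx] /andP[xz _].
  by move: (lt_le_trans xz zx); rewrite ltxx.
have Mnd x y : a <= x -> x <= y -> y <= b -> M x <= M y.
  by move=> ax xy yb; rewrite (MB x y)// lerDl fine_ge0.
have Minc x y k : a <= x -> x <= y -> y <= b -> `[x, y]%classic `<=` V k ->
    ck k * (y - x) <= M y - M x.
  move=> ax xy yb xyV; rewrite (MB x y)// [X in _ <= X]addrC addKr.
  have s2 : `]x, y]%classic `<=` `[a, b]%classic by apply: subset_itv; rewrite bnd_simp.
  rewrite -lee_fin fineK; last by rewrite ge0_fin_numE//; exact: mfin.
  rewrite mE_; apply: le_trans (nneseries_lim_ge k.+1 _); last first.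
    by move=> j _ _; rewrite mule_ge0// lee_fin ltW.
  rewrite big_nat_recr//= (setIidl _); last first.
    by apply: subset_trans xyV; apply: subset_itv; rewrite bnd_simp.
  rewrite (mu_itvoc xy) -EFinM leeDr// sume_ge0// => j _.
  by rewrite mule_ge0// lee_fin ltW.
(* M increases at the rate ck k along an interval inside V k *)
have key : `|f b - f a| <= M b - M a.
  apply: real_growth => // x /[dup] xab /andP[ax xb].
  pose k := Num.truncn (h x / e).
  have h0x : 0 <= h x / e by rewrite divr_ge0 ?(ltW e_gt0)// h0.
  have /andP[t1 t2] := truncn_itv h0x.
  have [oV EV _] := hV k.
  have Vx : V k x.
    by apply: EV; split => /=; rewrite in_itv //= -ler_pdivlMr// t1 -ltr_pdivrMr.
  have dk : `|df x| < ck k.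
    by apply: le_lt_trans (dfh _ xab) _; rewrite -ltr_pdivrMr.
  have [d1 /= d1_gt0 hd1] : nbhs x (V k) by exact: open_nbhs_nbhs.
  have := fd x xab; move=> [fdx fdE].
  have : \forall u \near 0^', `|u^-1 *: (f (u + x) - f x)| < ck k.
    have L : u^-1 *: (f (u + x) - f x) @[u --> 0^'] --> df x.
      rewrite -fdE; have := fdx => /derivableP[].
      rewrite /derivable => /cvg_ex[l]; rewrite /derive.
      by under eq_fun do rewrite scaler1; move=> Hl _; rewrite (cvg_lim _ Hl).
    apply: (cvgr_lt _ (cvg_norm L)); exact: dk.
  case => d2 /= d2_gt0 hd2.
  exists (Num.min d1 d2); first by rewrite lt_min d1_gt0 d2_gt0.
  move=> y /andP[ay yb]; rewrite lt_min => /andP[yd1 yd2].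
  have xyV x1 y1 : (x1 = x /\ y1 = y) \/ (x1 = y /\ y1 = x) -> `[x1, y1]%classic `<=` V k.
    move=> xy z /=; rewrite in_itv /= => /andP[z1 z2]; apply: hd1 => /=.
    apply: le_lt_trans yd1; rewrite distrC.
    case: xy => [] [xE yE]; subst x1 y1.
      by rewrite !ger0_norm ?subr_ge0 ?(le_trans z1)// lerD2r.
    rewrite distrC [leRHS]distrC !ger0_norm ?subr_ge0 ?(le_trans z1)//.
    by rewrite lerD2l lerN2.
  have fle : `|f y - f x| <= ck k * `|y - x|.
    have [->|yx] := eqVneq y x; first by rewrite !subrr normr0 mulr0.
    have yx0 : y - x != 0 by rewrite subr_eq0.
    have := hd2 (y - x); rewrite /= sub0r normrN subrK => /(_ yd2 yx0).
    rewrite /GRing.scale /= normrM normfV => /ltW.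
    by rewrite mulrC ler_pdivrMr ?normr_gt0.
  apply: le_trans fle _; have [xy|yx] := leP x y.
    rewrite (ger0_norm (_ : 0 <= y - x)) ?subr_ge0//; apply: le_trans (ler_norm _).
    by apply: Minc => //; apply: xyV; left.
  rewrite distrC (ger0_norm (_ : 0 <= x - y)) ?subr_ge0 ?(ltW yx)// distrC.
  apply: le_trans (ler_norm _).
  by apply: Minc => //; [exact: ltW|apply: xyV; right].
apply: le_trans key _; rewrite -lee_fin; apply: le_trans mab.
rewrite EFinB fineK; last by rewrite ge0_fin_numE//; exact: mfin.
by rewrite leeBlDr// leeDl// lee_fin fine_ge0.
Qed.

End Variation.

Section Oscillation.
Context {R : realType}.
Notation mu := (@lebesgue_measure R).
Implicit Types (f g U M d theta : R -> R) (a b c x y s lam : R).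

(** The total variation of [U] on any interval [x, y] inside [a, b] is at most
    [M y - M x]. Keeping the majorant [M] arbitrary avoids the total
    variation itself, and lets majorants add up under products as in
    [var_leM]. *)
Definition var_le U M a b : Prop :=
  forall x y, a <= x -> x <= y -> y <= b -> `|U y - U x| <= M y - M x.

Lemma var_le_sub U M a b x y : a <= x -> y <= b -> var_le U M a b -> var_le U M x y.
Proof.
move=> ax yb h u v xu uv vy; apply: h => //; [exact: le_trans xu|exact: le_trans yb].
Qed.

Lemma var_le_monotone U a b :
  (forall x y, a <= x -> x <= y -> y <= b -> U x <= U y) -> var_le U U a b.
Proof. by move=> h x y ax xy yb; rewrite ger0_norm// subr_ge0; exact: h. Qed.

Lemma var_le_antitone U a b :
  (forall x y, a <= x -> x <= y -> y <= b -> U y <= U x) ->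
  var_le U (fun x => - U x) a b.
Proof.
move=> h x y ax xy yb; rewrite ler0_norm ?subr_le0; last exact: h.
by rewrite opprB opprK addrC.
Qed.

Lemma var_leM U W M N (A B a b : R) : 0 <= A -> 0 <= B ->
  (forall x, a <= x <= b -> `|U x| <= A) -> (forall x, a <= x <= b -> `|W x| <= B) ->
  var_le U M a b -> var_le W N a b ->
  var_le (fun x => U x * W x) (fun x => A * N x + B * M x) a b.
Proof.
move=> A0 B0 UA WB UM WN x y ax xy yb.
have hy : a <= y <= b by rewrite yb (le_trans ax).
have hx : a <= x <= b by rewrite ax (le_trans xy).
have -> : U y * W y - U x * W x = U y * (W y - W x) + (U y - U x) * W x by ring.
apply: le_trans (ler_normD _ _) _; rewrite !normrM.
have -> : A * N y + B * M y - (A * N x + B * M x) =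
  A * (N y - N x) + (M y - M x) * B by ring.
by apply: lerD; apply: ler_pM => //; [exact: UA|exact: WN|exact: UM|exact: WB].
Qed.

(** Abel summation for an amplitude that is only of bounded variation. With [I]
    the primitive of [g], the function [int U g - U I] increases over a
    short interval by at most [K] times the variation of [U] plus a term of
    second order, so [real_growth] bounds its total increase by [K (M b - M
    a)]; the boundary term is [U b * I b]. *)
Lemma abel_bound U M g a b (K : R) : a <= b ->
  measurable_fun `[a, b] U -> continuous g ->
  var_le U M a b -> (forall x, a <= x <= b -> `|\int[mu]_(z in `[a, x]) g z| <= K) ->
  mu.-integrable `[a, b] (EFin \o (fun x => U x * g x)) /\
  `|\int[mu]_(z in `[a, b]) (U z * g z)| <= K * (`|U b| + (M b - M a)).
Proof.
move=> ab mU cg UM gK.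
have [G gG] : exists G, forall x, a <= x <= b -> `|g x| <= G.
  have cn : {within `[a, b], continuous (fun x => `|g x|)}.
    by apply: continuous_subspaceT => x; apply: cvg_norm; exact: cg.
  have [z _ hz] := EVT_max ab cn; exists `|g z| => x xab.
  by apply: hz; rewrite in_itv.
have G0 : 0 <= G by apply: le_trans (normr_ge0 _) (gG a _); rewrite lexx ab.
have K0 : 0 <= K by apply: le_trans (normr_ge0 _) (gK a _); rewrite lexx ab.
have Mnd x y : a <= x -> x <= y -> y <= b -> M x <= M y.
  by move=> ax xy yb; rewrite -subr_ge0; exact: le_trans (normr_ge0 _) (UM _ _ ax xy yb).
have UB x : a <= x <= b -> `|U x| <= `|U b| + (M b - M a).
  move=> /andP[ax xb]; have := UM _ _ ax xb (lexx b).
  have := ler_normB (U b) (U b - U x); rewrite subKr => h1 h2.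
  have := Mnd _ _ (lexx a) ax xb; lra.
have gi x y : mu.-integrable `[x, y] (EFin \o g) by exact: continuous_integrable.
have Ugi : mu.-integrable `[a, b] (EFin \o (fun x => U x * g x)).
  have ic : mu.-integrable `[a, b] (EFin \o (fun=> (`|U b| + (M b - M a)) * G)).
    by apply: continuous_integrable => x; exact: cvg_cst.
  apply: (le_integrable _ _ _ ic) => //=.
    apply/measurable_EFinP; apply: measurable_funM => //.
    by apply: measurable_funTS; exact: continuous_measurable_fun.
  move=> x; rewrite in_itv /= => xab; rewrite lee_fin normrM.
  by apply: le_trans (ler_norm _); apply: ler_pM => //; [exact: UB|exact: gG].
have Ugi' x y : a <= x -> y <= b -> mu.-integrable `[x, y] (EFin \o (fun x => U x * g x)).
  by move=> ax yb; exact: integrable_sub Ugi.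
split=> //.
pose I x := \int[mu]_(z in `[a, x]) g z.
pose J x := \int[mu]_(z in `[a, x]) (U z * g z).
pose Phi x := J x - U x * I x.
(* the slack e absorbs the term of second order *)
suff key e : 0 < e -> `|Phi b - Phi a| <= (K + e) * M b - (K + e) * M a.
  have Ja : J a = 0 by rewrite /J set_itv1 Rintegral_set1.
  have Ia : I a = 0 by rewrite /I set_itv1 Rintegral_set1.
  have -> : \int[mu]_(z in `[a, b]) (U z * g z) = (Phi b - Phi a) + U b * I b.
    by rewrite /Phi Ja Ia -/(J b); ring.
  apply: le_trans (ler_normD _ _) _; rewrite normrM mulrDr addrC.
  apply: lerD; first by rewrite mulrC ler_wpM2r//; apply: gK; rewrite ab lexx.
  apply/ler_addgt0Pr => e e0.
  pose e' := e / (M b - M a + 1).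
  have M0 : 0 < M b - M a + 1 by rewrite ltr_wpDl// subr_ge0; exact: Mnd.
  apply: le_trans (key e' _) _; first by rewrite divr_gt0.
  rewrite -mulrBr mulrDl lerD2l /e' mulrAC ler_pdivrMr// ler_wpM2l// ?ltW//.
  by rewrite ltrDl.
move=> e0.
apply: (real_growth (f := Phi) (M := fun z => (K + e) * M z)) => //.
  move=> x y ax xy yb; rewrite ler_wpM2l ?addr_ge0 ?(ltW e0)//; exact: Mnd.
have step x y : a <= x -> x <= y -> y <= b -> G * (y - x) <= e ->
    `|Phi y - Phi x| <= (K + e) * (M y - M x).
  move=> ax xy yb Gxy.
  have ay := le_trans ax xy; have xb := le_trans xy yb.
  have JE : J y = J x + \int[mu]_(z in `[x, y]) (U z * g z).
    by apply: Rintegral_split => //; exact: Ugi'.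
  have IE : I y = I x + \int[mu]_(z in `[x, y]) g z.
    by apply: Rintegral_split => //; exact: gi.
  have DE : \int[mu]_(z in `[x, y]) (U z * g z) - U x * \int[mu]_(z in `[x, y]) g z =
      \int[mu]_(z in `[x, y]) ((U z - U x) * g z).
    rewrite -RintegralZl// -RintegralB//; last 2 first.
    - exact: Ugi'.
    - by under [_ \o _]eq_fun do rewrite /= EFinM; exact: integrableZl.
    by apply: eq_Rintegral => z _; rewrite mulrBl.
  have -> : Phi y - Phi x =
      \int[mu]_(z in `[x, y]) ((U z - U x) * g z) - (U y - U x) * I y.
    by rewrite -DE /Phi JE IE; ring.
  apply: le_trans (ler_normB _ _) _.
  rewrite [X in _ <= X]mulrDl [X in X <= _]addrC normrM; apply: lerD.
    rewrite mulrC; apply: ler_pM => //; first by apply: gK; rewrite ay yb.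
    exact: UM.
  apply: le_trans (_ : (M y - M x) * G * (y - x) <= _).
    apply: Rintegral_norm_le => //.
      under [_ \o _]eq_fun do rewrite /= mulrBl EFinB.
      have i2 : mu.-integrable `[x, y] (EFin \o (fun z => U x * g z)).
        by under [_ \o _]eq_fun do rewrite /= EFinM; exact: integrableZl.
      by apply: integrableB => //; exact: (Ugi' x y ax yb).
    move=> z /andP[xz zy]; rewrite normrM; apply: ler_pM => //; last first.
      by apply: gG; rewrite (le_trans ax xz) (le_trans zy yb).
    apply: le_trans (UM _ _ ax xz (le_trans zy yb)) _.
    by rewrite lerD2r; apply: Mnd => //; exact: le_trans xz.
  by rewrite -mulrA mulrC ler_wpM2r// subr_ge0; exact: Mnd.
move=> x /andP[ax xb]; exists (e / (G + 1)); first by rewrite divr_gt0// ltr_wpDl.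
have Gd z : z < e / (G + 1) -> 0 <= z -> G * z <= e.
  move=> ze z0; have G1 : 0 < G + 1 by rewrite ltr_wpDl.
  move: ze; rewrite ltr_pdivlMr// => /ltW; apply: le_trans.
  by rewrite mulrDr mulr1 mulrC lerDl.
move=> y /andP[ay yb] yx; rewrite -mulrBr normrM (ger0_norm (_ : 0 <= K + e)); last first.
  by rewrite addr_ge0// ltW.
have [xy|/ltW xy] := leP x y.
  rewrite ger0_norm ?subr_ge0// in yx.
  rewrite (ger0_norm (_ : 0 <= M y - M x)) ?subr_ge0; last exact: Mnd.
  by apply: step => //; apply: Gd; rewrite ?subr_ge0.
rewrite distrC ger0_norm ?subr_ge0// in yx.
rewrite distrC (distrC (M y)).
rewrite (ger0_norm (_ : 0 <= M x - M y)) ?subr_ge0; last exact: Mnd.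
by apply: step => //; apply: Gd; rewrite ?subr_ge0.
Qed.

Lemma integral_derivative f df a b : a <= b ->
  (forall x : R, is_derive x 1 f (df x)) -> continuous df ->
  \int[mu]_(x in `[a, b]) df x = f b - f a.
Proof.
move=> ab fd cdf; have cf : continuous f.
  by move=> x; apply: differentiable_continuous; apply/derivable1_diffP; case: (fd x).
move: ab; rewrite le_eqVlt => /predU1P[->|ab].
  by rewrite set_itv1 Rintegral_set1 subrr.
rewrite /Rintegral (@continuous_FTC2 _ df f)//=.
- exact: continuous_subspaceT.
- split.
  + by move=> x _; case: (fd x).
  + by apply: cvg_at_right_filter; exact: cf.
  + by apply: cvg_at_left_filter; exact: cf.
- by move=> x _; rewrite derive1E (@derive_val _ _ _ _ _ _ _ (fd x)).
Qed.

Section PhaseTests.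
Variables (theta d : R -> R) (s : R).
Hypothesis dtheta : forall x : R, is_derive x 1 theta (d x).
Hypothesis cd : continuous d.

Let ctheta : continuous theta.
Proof.
by move=> x; apply: differentiable_continuous; apply/derivable1_diffP; case: (dtheta x).
Qed.

Let ccos : continuous (fun x => cos (theta x + s)).
Proof.
move=> x; apply: continuous_comp; last exact: continuous_cos.
by apply: cvgD; [exact: ctheta|exact: cvg_cst].
Qed.

(** Van der Corput's first test: the integrand is [d^-1] times the derivative of
    [sin (theta + s)], and [d^-1] is monotone because [d] is, with values
    and variation bounded by [lam^-1]. *)
Lemma first_derivative_test a b lam : a <= b -> 0 < lam ->
  (forall x y, a <= x -> x <= y -> y <= b -> d y <= d x) ->
  (lam <= d b) || (d a <= - lam) ->
  `|\int[mu]_(x in `[a, b]) cos (theta x + s)| <= 4 / lam.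
Proof.
move=> ab lam0 dnd hlam.
have dlam x : a <= x <= b -> lam <= `|d x|.
  move=> /andP[ax xb]; case/orP: hlam => h.
    by apply: le_trans (ler_norm _); apply: le_trans h _; exact: dnd.
  rewrite -normrN; apply: le_trans (ler_norm _); rewrite lerNr; apply: le_trans h.
  exact: dnd.
have d0 x : a <= x <= b -> d x != 0.
  by move=> /dlam h; rewrite -normr_gt0 (lt_le_trans lam0).
have same x y : a <= x -> x <= y -> y <= b -> (d x)^-1 <= (d y)^-1.
  move=> ax xy yb; have dxy := dnd x y ax xy yb; case/orP: hlam => h.
    have dy0 : 0 < d y by apply: lt_le_trans (lt_le_trans lam0 h) _; apply: dnd => //; exact: le_trans xy.
    by rewrite lef_pV2// posrE// (lt_le_trans dy0).
  have dx0 : d x < 0.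
    apply: le_lt_trans (_ : d a < 0); last by rewrite (le_lt_trans h)// oppr_lt0.
    by apply: dnd => //; exact: le_trans yb.
  have dy0 : d y < 0 := le_lt_trans dxy dx0.
  by rewrite lef_nV2// ?negrE.
have ab' : a <= b <= b by rewrite ab lexx.
have aa' : a <= a <= b by rewrite ab lexx.
have inv_le x : a <= x <= b -> `|(d x)^-1| <= lam^-1.
  move=> xab; rewrite normfV lef_pV2 ?posrE//; first exact: dlam.
  by rewrite normr_gt0 d0.
have M1 : (d b)^-1 - (d a)^-1 <= lam^-1.
  case/orP: hlam => h.
    have da0 : 0 < d a by apply: lt_le_trans (lt_le_trans lam0 h) _; exact: dnd.
    have := inv_le b ab'; rewrite ger0_norm; last by rewrite invr_ge0 ltW// (lt_le_trans lam0).
    have : 0 < (d a)^-1 by rewrite invr_gt0.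
    lra.
  have db0 : d b < 0.
    by apply: le_lt_trans (_ : d a < 0); [exact: dnd|rewrite (le_lt_trans h)// oppr_lt0].
  have := inv_le a aa'; rewrite ltr0_norm; last by rewrite invr_lt0 (le_lt_trans h)// oppr_lt0.
  have : (d b)^-1 < 0 by rewrite invr_lt0.
  lra.
pose g x := d x * cos (theta x + s).
have cg : continuous g by move=> x; apply: cvgM; [exact: cd|exact: ccos].
have gd x : is_derive x 1 (fun x => sin (theta x + s)) (g x).
  have h1 : is_derive x 1 (fun x => theta x + s) (d x).
    have := is_deriveD (dtheta x) (is_derive_cst s x 1).
    by apply: is_derive_eqr; rewrite addr0.
  have := @is_derive1_comp _ sin (fun x => theta x + s) _ _ _ (is_derive_sin _) h1.
  by apply: is_derive_eqr; rewrite mulrC.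
have gK x : a <= x <= b -> `|\int[mu]_(z in `[a, x]) g z| <= 2.
  move=> /andP[ax xb]; rewrite (integral_derivative ax gd cg).
  apply: le_trans (ler_normB _ _) _.
  have s1 (z : R) : `|sin z| <= 1 by rewrite ler_norml sin_geN1 sin_le1.
  by have := s1 (theta x + s); have := s1 (theta a + s); lra.
have mU : measurable_fun `[a, b] (fun x => (d x)^-1).
  apply: subspace_continuous_measurable_fun => //.
  apply: continuous_in_subspaceT => x; rewrite inE /= in_itv /= => xab.
  by apply: cvgV; [exact: d0|exact: cd].
have := (abel_bound ab mU cg (var_le_monotone same) gK).2.
rewrite (_ : \int[mu]_(z in _) _ = \int[mu]_(x in `[a, b]) cos (theta x + s)); last first.
  apply: eq_Rintegral => z; rewrite inE /= in_itv /= => zab.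
  by rewrite /g mulKf// d0.
move/le_trans; apply; have := inv_le b ab'; lra.
Qed.

(** Van der Corput's second test: [d] is strictly decreasing, hence of modulus
    at least [lam * eta] at distance [eta] from its zero. The first test
    applies on both sides of this window, and the window contributes at most
    its length. *)
Lemma second_derivative_test a b lam eta : a <= b -> 0 < lam -> 0 < eta ->
  (forall x y, a <= x -> x <= y -> y <= b -> lam * (y - x) <= d x - d y) ->
  `|\int[mu]_(x in `[a, b]) cos (theta x + s)| <= 8 / (lam * eta) + 2 * eta.
Proof.
move=> ab lam0 eta0 dlam.
have dnd x y : a <= x -> x <= y -> y <= b -> d y <= d x.
  move=> ax xy yb; rewrite -subr_ge0; apply: le_trans (dlam _ _ ax xy yb).
  by rewrite mulr_ge0 ?(ltW lam0)// subr_ge0.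
have le0 : 0 < lam * eta by rewrite mulr_gt0.
(* p0 is the zero of d, or the endpoint nearest to it when d keeps its sign *)
have [p0 [ap0 p0b hl hr]] : exists p0, [/\ a <= p0, p0 <= b,
    a < p0 -> 0 <= d p0 & p0 < b -> d p0 <= 0].
  have [da|da] := leP (d a) 0; first by exists a; split => //; rewrite ltxx.
  have [db|db] := leP 0 (d b); first by exists b; split => //; rewrite ltxx.
  have cd' : {within `[a, b], continuous d} by exact: continuous_subspaceT.
  have [|p] := IVT (v := 0) ab cd'.
    by rewrite ge_min le_max (ltW da) (ltW db) orbT.
  by rewrite in_itv /= => /andP[ap pb] dp; exists p; split => //; rewrite dp.
pose al := Num.max a (p0 - eta); pose be := Num.min b (p0 + eta).
have aal : a <= al by rewrite le_max lexx.
have alp : al <= p0 by rewrite ge_max ap0 lerBlDr lerDl ltW.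
have beb : be <= b by rewrite ge_min lexx.
have pbe : p0 <= be by rewrite le_min p0b lerDl ltW.
have albe := le_trans alp pbe.
have fi x y : mu.-integrable `[x, y] (EFin \o (fun x => cos (theta x + s))).
  exact: continuous_integrable.
rewrite (Rintegral_split aal (le_trans albe beb))// (Rintegral_split albe beb)//.
have cos1 (z : R) : `|cos z| <= 1 by rewrite ler_norml cos_geN1 cos_le1.
have B0 : 0 <= 4 / (lam * eta) by rewrite divr_ge0// ltW.
have I1 : `|\int[mu]_(x in `[a, al]) cos (theta x + s)| <= 4 / (lam * eta).
  have [ala|aal'] := leP al a.
    have -> : al = a by apply/eqP; rewrite eq_le ala aal.
    by rewrite set_itv1 Rintegral_set1 normr0.
  have alE : al = p0 - eta.
    have [h|h] := leP a (p0 - eta); first by rewrite /al (max_idPr h).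
    by move: aal'; rewrite /al (max_idPl (ltW h)) ltxx.
  apply: first_derivative_test => //.
    by move=> x y ax xy yal; apply: dnd => //; apply: le_trans yal (le_trans albe beb).
  apply/orP; left; have := dlam al p0 aal alp p0b; rewrite alE opprB addrC subrK.
  have : a < p0 by apply: lt_le_trans aal' alp.
  by move=> /hl; lra.
have I3 : `|\int[mu]_(x in `[be, b]) cos (theta x + s)| <= 4 / (lam * eta).
  have [bbe|beb'] := leP b be.
    have -> : be = b by apply/eqP; rewrite eq_le bbe beb.
    by rewrite set_itv1 Rintegral_set1 normr0.
  have beE : be = p0 + eta.
    have [h|h] := leP (p0 + eta) b; first by rewrite /be (min_idPr h).
    by move: beb'; rewrite /be (min_idPl (ltW h)) ltxx.
  apply: first_derivative_test => //.
    by move=> x y xbe xy yb; apply: dnd => //; apply: le_trans (le_trans aal albe) xbe.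
  apply/orP; right; have := dlam p0 be ap0 pbe beb; rewrite beE addrC addKr.
  have : p0 < b by apply: le_lt_trans pbe beb'.
  by move=> /hr; lra.
have I2 : `|\int[mu]_(x in `[al, be]) cos (theta x + s)| <= 1 * (be - al).
  by apply: Rintegral_norm_le => // x _; exact: cos1.
have len : be - al <= 2 * eta.
  have : be <= p0 + eta by rewrite ge_min lexx orbT.
  have : p0 - eta <= al by rewrite le_max lexx orbT.
  by lra.
have := ler_normD (\int[mu]_(x in `[a, al]) cos (theta x + s))
  (\int[mu]_(x in `[al, be]) cos (theta x + s) + \int[mu]_(x in `[be, b]) cos (theta x + s)).
have := ler_normD (\int[mu]_(x in `[al, be]) cos (theta x + s))
  (\int[mu]_(x in `[be, b]) cos (theta x + s)).
have -> : 8 / (lam * eta) = 4 / (lam * eta) + 4 / (lam * eta) by lra.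
lra.
Qed.

End PhaseTests.

End Oscillation.

(** * Oscillatory integrals with an amplitude singular at the origin *)

Section SingularAmplitude.
Context {R : realType}.
Notation mu := (@lebesgue_measure R).

(** Oscillating factors that gain [kappa] on bounded frequencies. The polynomial
    loss in [P] is there because the dispersion relation is asymptotically
    linear: its curvature, and the distance of the group velocity to its
    limits, decay at large frequencies. *)
Definition osc_class (kappa C0 : R) (g : R -> R) : Prop :=
  [/\ continuous g, forall x, `|g x| <= 1 &
   forall P a b : R, 0 <= P -> - P <= a -> a <= b -> b <= P ->
     `|\int[mu]_(x in `[a, b]) g x| <= kappa * (C0 * (1 + P ^+ 2))].

Lemma Rintegral_oppr (f : R -> R) (a b : R) : a <= b ->
  {within `[- b, - a], continuous f} ->
  \int[mu]_(x in `[- b, - a]) f x = \int[mu]_(x in `[a, b]) f (- x).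
Proof.
by move=> ab cf; rewrite /Rintegral integration_by_substitution_oppr.
Qed.

Lemma osc_class_oppr kappa C0 g : osc_class kappa C0 g ->
  osc_class kappa C0 (fun x => g (- x)).
Proof.
move=> [cg g1 gK]; split => //.
  by move=> x; apply: continuous_comp; [exact: cvgN|exact: cg].
move=> P a b P0 Pa ab bP; rewrite -(@Rintegral_oppr g)//.
  by apply: gK; rewrite ?lerN2// lerNl.
exact: continuous_subspaceT.
Qed.

(** Size and variation on the unit cells of the half-line; the other half-line
    is reached by reflection. *)
Definition amplitude (A : R -> R) (D alpha : R) : Prop :=
  continuous A /\ forall n : nat,
    (forall p, n%:R <= p <= n.+1%:R -> `|A p| <= D * n.+1%:R `^ (- alpha)) /\
    (exists2 M, var_le A M n%:R n.+1%:R &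
       M n.+1%:R - M n%:R <= D * n.+1%:R `^ (- alpha)).

Lemma powR_continuous (r x : R) : 0 < x -> {for x, continuous (fun y : R => y `^ r)}.
Proof.
move=> x0; have [dx _] := is_derive1_powR r x0.
by apply: differentiable_continuous; apply/derivable1_diffP.
Qed.

(** Telescoping comparison with the primitive of [x^-s]. *)
Lemma zeta_bounded (s : R) : 1 < s -> exists2 Z, 0 <= Z &
  forall N, \sum_(1 <= n < N.+1) (n.+1%:R : R) `^ (- s) <= Z.
Proof.
move=> s1; exists ((s - 1)^-1); first by rewrite invr_ge0 subr_ge0 ltW.
have s10 : 0 < s - 1 by rewrite subr_gt0.
pose h (x : R) := x `^ (1 - s).
have step n : (0 < n)%N -> (n.+1%:R : R) `^ (- s) <= (s - 1)^-1 * (h n%:R - h n.+1%:R).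
  move=> n0; have n0' : 0 < n%:R :> R by rewrite ltr0n.
  have nn : n%:R <= n.+1%:R :> R by rewrite ler_nat.
  have dh (x : R) : x \in `]n%:R, n.+1%:R[ -> is_derive x 1 h ((1 - s) * x `^ (- s)).
    rewrite in_itv /= => /andP[nx _]; have x0 := lt_trans n0' nx.
    have := is_derive1_powR (1 - s) x0; apply: is_derive_eqr.
    by congr (_ * _ `^ _); ring.
  have ch : {within `[n%:R, n.+1%:R], continuous h}.
    apply: continuous_in_subspaceT => x; rewrite inE /= in_itv /= => /andP[nx _].
    exact: (powR_continuous (lt_le_trans n0' nx)).
  have [x] := MVT_segment nn dh ch.
  rewrite in_itv /= => /andP[nx xn].
  have ba : n.+1%:R - n%:R = 1 :> R by rewrite -natr1 addrAC subrr add0r.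
  rewrite ba mulr1 => E.
  have -> : h n%:R - h n.+1%:R = (s - 1) * x `^ (- s) by rewrite -opprB E; ring.
  rewrite mulrA mulVf ?mul1r ?gt_eqF//.
  have x0 := lt_le_trans n0' nx.
  rewrite !powRN lef_pV2 ?posrE ?powR_gt0 ?ltr0n//.
  have s0 : 0 <= s by apply: ltW; apply: lt_trans s1.
  by apply: ge0_ler_powR => //; rewrite nnegrE// ltW.
move=> N; apply: le_trans (_ : (s - 1)^-1 * (h 1 - h N.+1%:R) <= _); last first.
  rewrite -[X in _ <= X]mulr1 ler_wpM2l ?invr_ge0 ?(ltW s10)// /h powR1.
  by rewrite lerBlDr lerDl powR_ge0.
elim: N => [|N IH]; first by rewrite big_nil subrr mulr0.
rewrite big_nat_recr//=; apply: le_trans (lerD IH (step N.+1 isT)) _.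
by rewrite -mulrDr addrA subrK.
Qed.

Section Estimate.
Variables (m alpha C0 : R).
Hypothesis m0 : 0 < m.
Hypothesis m1 : m <= 1.
Hypothesis alpha3 : 3 < alpha.
Hypothesis C00 : 0 <= C0.

Lemma powR_antitone (x y : R) : 0 < x -> x <= y -> y `^ (m - 1) <= x `^ (m - 1).
Proof.
move=> x0 xy; have y0 := lt_le_trans x0 xy.
have -> : m - 1 = - (1 - m) by ring.
rewrite !powRN lef_pV2 ?posrE ?powR_gt0//.
by apply: ge0_ler_powR => //; rewrite ?subr_ge0 ?nnegrE// ltW.
Qed.

(** [abel_bound] for the product of the power and the amplitude on one cell; the
    factor 3 counts the value of the product at the right end and the
    variation of each of its two factors. *)
Lemma osc_piece A D kappa g (n : nat) (a : R) : amplitude A D alpha ->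
  osc_class kappa C0 g -> 0 <= kappa -> 0 < a -> n%:R <= a <= n.+1%:R ->
  `|\int[mu]_(p in `[a, n.+1%:R]) (p `^ (m - 1) * A p * g p)| <=
  kappa * (C0 * (1 + n.+1%:R ^+ 2)) *
    (3 * (a `^ (m - 1) * (D * n.+1%:R `^ (- alpha)))).
Proof.
move=> [cA hA] [cg g1 gK] k0 a0 /andP[na an].
have [AD [M AM MD]] := hA n; set b := n.+1%:R in an AD AM MD *.
set Dn := D * _ in AD MD *.
have b0 : 0 < b by rewrite ltr0n.
have Dn0 : 0 <= Dn.
  by apply: le_trans (normr_ge0 (A b)) (AD b _); rewrite lexx andbT (le_trans na).
set q := a `^ (m - 1); have q0 : 0 < q by exact: powR_gt0.
pose W (p : R) := p `^ (m - 1).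
have Wq p : a <= p <= b -> `|W p| <= q.
  by move=> /andP[ap _]; rewrite ger0_norm ?powR_ge0//; exact: powR_antitone.
have AD' p : a <= p <= b -> `|A p| <= Dn.
  by move=> /andP[ap pb]; apply: AD; rewrite pb (le_trans na).
have vW : var_le W (fun x => - W x) a b.
  apply: var_le_antitone => x y ax xy yb; apply: powR_antitone => //.
  exact: lt_le_trans ax.
have vA : var_le A M a b by apply: var_le_sub AM.
have v := var_leM (ltW q0) Dn0 Wq AD' vW vA.
have mU : measurable_fun `[a, b] (fun p => W p * A p).
  apply: measurable_funM; apply: measurable_funTS; first exact: measurable_powR.
  exact: continuous_measurable_fun.
have K x : a <= x <= b -> `|\int[mu]_(z in `[a, x]) g z| <= kappa * (C0 * (1 + b ^+ 2)).
  move=> /andP[ax xb]; apply: (gK b) => //; lra.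
apply: le_trans (abel_bound an mU cg v K).2 _.
apply: ler_wpM2l.
  by rewrite mulr_ge0// mulr_ge0// addr_ge0// sqr_ge0.
have h1 : `|W b * A b| <= q * Dn.
  by rewrite normrM; apply: ler_pM => //; [apply: Wq|apply: AD']; rewrite an lexx.
have h2 : q * (M b - M a) <= q * Dn.
  rewrite ler_wpM2l ?(ltW q0)//; apply: le_trans MD; rewrite lerD2l lerN2.
  by rewrite -subr_ge0; apply: le_trans (normr_ge0 _) (AM _ _ (lexx _) na an).
have h3 : Dn * (- W b - - W a) <= q * Dn.
  by rewrite mulrC ler_wpM2r// opprK addrC lerBlDr lerDl powR_ge0.
have -> : q * M b + Dn * - W b - (q * M a + Dn * - W a) =
  q * (M b - M a) + Dn * (- W b - - W a) by ring.
lra.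
Qed.

Lemma integral_powR_le (e k : R) : 0 < e -> e <= k ->
  \int[mu]_(p in `[e, k]) p `^ (m - 1) <= k `^ m / m.
Proof.
move=> e0; rewrite le_eqVlt => /predU1P[<-|ek].
  by rewrite set_itv1 Rintegral_set1 divr_ge0 ?powR_ge0// ltW.
have k0 := lt_trans e0 ek.
have dP (x : R) : 0 < x -> is_derive x 1 (fun x => x `^ m / m) (x `^ (m - 1)).
  move=> x0; have := is_deriveM (is_derive1_powR m x0) (is_derive_cst m^-1 x 1).
  apply: is_derive_eqr; rewrite scaler0 add0r /GRing.scale /= mulrA mulVf ?mul1r//.
  by rewrite gt_eqF.
have cP (f : R -> R) (l x : R) : is_derive x 1 f l -> {for x, continuous f}.
  by move=> [df _]; apply: differentiable_continuous; apply/derivable1_diffP.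
rewrite /Rintegral (@continuous_FTC2 _ (fun x => x `^ (m - 1)) (fun x => x `^ m / m))//=.
- by rewrite lerBlDr lerDl divr_ge0 ?powR_ge0// ltW.
- apply: continuous_in_subspaceT => x; rewrite inE /= in_itv /= => /andP[ex _].
  exact: (powR_continuous (lt_le_trans e0 ex)).
- split.
  + by move=> x; rewrite in_itv /= => /andP[ex _]; case: (dP x (lt_trans e0 ex)).
  + by apply: cvg_at_right_filter; exact: cP (dP e e0).
  + by apply: cvg_at_left_filter; exact: cP (dP k k0).
- move=> x; rewrite in_itv /= => /andP[ex _].
  by rewrite derive1E (@derive_val _ _ _ _ _ _ _ (dP x (lt_trans e0 ex))).
Qed.

(** Below [kappa] the oscillation is ignored and the singularity integrates to
    [kappa^m / m]. From [kappa] to 1 the power is at most [kappa^(m - 1)],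
    and the gain [kappa] turns this into [kappa^m]. On the cell [n, n+1] the
    polynomial loss of [osc_class] is of order [n^2] against the decay [n^(-
    alpha)]: the sum converges because [alpha > 3]. *)
Lemma osc_halfline : exists2 C : R, 0 <= C & forall A D kappa g e (N : nat),
  amplitude A D alpha -> osc_class kappa C0 g -> 0 < kappa -> kappa <= 1 ->
  0 < e -> e < kappa ->
  (forall a b : R, 0 < a -> mu.-integrable `[a, b] (EFin \o (fun p => p `^ (m - 1) * A p * g p))) ->
  `|\int[mu]_(p in `[e, N.+1%:R]) (p `^ (m - 1) * A p * g p)| <=
    C * D * (kappa `^ m + kappa).
Proof.
have [Z Z0 hZ] : exists2 Z : R, 0 <= Z & forall N,
    \sum_(1 <= n < N.+1) (n.+1%:R : R) `^ (- (alpha - 2)) <= Z.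
  have a2 : 1 < alpha - 2.
    by rewrite ltrBrDr (_ : 1 + 2 = 3 :> R)// -[1]/(1%:R) -natrD.
  exact: zeta_bounded a2.
exists (m^-1 + 6 * C0 + 6 * C0 * Z).
  by rewrite !addr_ge0 ?invr_ge0 ?mulr_ge0// ltW.
move=> A D kappa g e N amp gC k0 k1 e0 ek iF.
set F := fun p => _ in iF *.
have ek' := ltW ek.
have N1 : 1 <= N.+1%:R :> R by rewrite ler1n.
have [cA hA] := amp; have [cg g1 gK] := gC.
have AD01 p : 0 <= p <= 1 -> `|A p| <= D.
  by move=> p01; have [/(_ p p01)] := hA 0%N; rewrite powR1 mulr1.
have D0 : 0 <= D by apply: le_trans (normr_ge0 (A 0)) (AD01 0 _); rewrite lexx ler01.
have K0 : 0 <= kappa `^ m by exact: powR_ge0.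
rewrite (Rintegral_split ek' (le_trans k1 N1))//; last exact: iF.
rewrite (Rintegral_split k1 N1)//; last exact: iF.
have I1 : `|\int[mu]_(p in `[e, kappa]) F p| <= D * (kappa `^ m / m).
  apply: le_trans (le_normr_Rintegral _ (iF _ _ e0)) _ => //.
  apply: le_trans (_ : \int[mu]_(p in `[e, kappa]) (D * p `^ (m - 1)) <= _); last first.
    rewrite RintegralZl//; first by rewrite ler_wpM2l//; exact: integral_powR_le.
    apply: continuous_compact_integrable; first exact: segment_compact.
    apply: continuous_in_subspaceT => x; rewrite inE /= in_itv /= => /andP[ex _].
    exact: (powR_continuous (lt_le_trans e0 ex)).
  apply: le_Rintegral => //=.
  - by apply: integrable_norm; exact: iF.
  - apply: continuous_compact_integrable; first exact: segment_compact.
    apply: continuous_in_subspaceT => x; rewrite inE /= in_itv /= => /andP[ex _].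
    apply: cvgM; first exact: cvg_cst.
    exact: (powR_continuous (lt_le_trans e0 ex)).
  - move=> x; rewrite in_itv /= => /andP[ex xk]; rewrite /F !normrM.
    have hA1 : `|A x| <= D by apply: AD01; rewrite (ltW (lt_le_trans e0 ex)) (le_trans xk).
    rewrite (ger0_norm (powR_ge0 _ _)) -[X in _ <= X]mulr1 [D * _]mulrC.
    apply: ler_pM => //; first by rewrite mulr_ge0// powR_ge0.
    by rewrite ler_wpM2l// powR_ge0.
have I2 : `|\int[mu]_(p in `[kappa, 1]) F p| <= 6 * C0 * D * kappa `^ m.
  have k01 : 0%:R <= kappa <= 1%:R by rewrite k1 ltW.
  apply: le_trans (osc_piece amp gC (ltW k0) k0 k01) _.
  rewrite expr1n powR1 mulr1 -(mulr_powRB1 (ltW k0) m0).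
  by rewrite le_eqVlt; apply/orP; left; apply/eqP; ring.
have I3 : `|\int[mu]_(p in `[1, N.+1%:R]) F p| <= 6 * C0 * D * kappa * Z.
  apply: le_trans (_ : 6 * C0 * D * kappa *
      \sum_(1 <= n < N.+1) (n.+1%:R : R) `^ (- (alpha - 2)) <= _); last first.
    by rewrite ler_wpM2l// !mulr_ge0// ltW.
  elim: N {N1} => [|N IH].
    by rewrite set_itv1 Rintegral_set1 normr0 big_nil mulr0.
  have N1 : 1 <= N.+1%:R :> R by rewrite ler1n.
  have NN : N.+1%:R <= N.+2%:R :> R by rewrite ler_nat.
  rewrite (Rintegral_split N1 NN); last exact: iF.
  rewrite big_nat_recr//= mulrDr; apply: le_trans (ler_normD _ _) _; apply: lerD => //.
  have N0 : 0 < N.+1%:R :> R by rewrite ltr0n.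
  have NNN (y : R) : y = N.+1%:R -> N.+1%:R <= y <= N.+2%:R.
    by move=> ->; apply/andP; split.
  apply: le_trans (osc_piece amp gC (ltW k0) N0 (NNN _ erefl)) _.
  set X : R := N.+2%:R.
  have X1 : 1 <= X by rewrite ler1n.
  have X0 : 0 < X := lt_le_trans ltr01 X1.
  have -> : X `^ (- (alpha - 2)) = X ^+ 2 * X `^ (- alpha).
    rewrite -powR_mulrn ?(ltW X0)// -powRD; last by apply/implyP => _; rewrite gt_eqF.
    by congr (_ `^ _); ring.
  have h1 : N.+1%:R `^ (m - 1) <= 1 :> R.
    by have := powR_antitone ltr01 N1; rewrite powR1.
  have h2 : 1 + X ^+ 2 <= 2 * X ^+ 2 by have := exprn_ege1 2 X1; lra.
  have Xa := powR_ge0 X (- alpha).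
  apply: le_trans (_ : kappa * (C0 * (2 * X ^+ 2)) * (3 * (1 * (D * X `^ (- alpha)))) <= _).
    apply: ler_pM => //.
    - by rewrite !mulr_ge0 ?(ltW k0)// addr_ge0// sqr_ge0.
    - by rewrite !mulr_ge0 ?powR_ge0.
    - by rewrite !ler_wpM2l ?(ltW k0).
    - by rewrite ler_wpM2l// ler_wpM2r// mulr_ge0.
  by rewrite le_eqVlt; apply/orP; left; apply/eqP; ring.
apply: le_trans (ler_normD _ _) _.
have h := ler_normD (\int[mu]_(p in `[kappa, 1]) F p) (\int[mu]_(p in `[1, N.+1%:R]) F p).
apply: le_trans (lerD I1 (le_trans h (lerD I2 I3))) _.
have mi0 : 0 <= m^-1 by rewrite invr_ge0 ltW.
rewrite -subr_ge0 (_ : _ - _ = D * kappa / m + 6 * C0 * D * kappa +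
   6 * C0 * Z * D * kappa `^ m); last by ring.
by rewrite !addr_ge0 ?mulr_ge0 ?(ltW k0).
Qed.

Lemma integral_near0 (F : R -> R) (eta : R) : mu.-integrable setT (EFin \o F) ->
  0 < eta -> exists2 d : R, 0 < d & forall e, 0 < e -> e < d ->
    `|\int[mu]_(p in `[- e, e]) F p| <= eta.
Proof.
move=> iF eta0; have iF1 : mu.-integrable `[-1, 1] (EFin \o F) by exact: integrableS iF.
have N11 : -1 <= 1 :> R by lra.
have cG := parameterized_integral_continuous N11 iF1.
have N11' : -1 < 1 :> R by lra.
have [/(_ 0 _) c0 _ _] := (continuous_within_itvP _ N11').1 cG.
have {}c0 : {for 0, continuous (fun x : R => \int[mu]_(t in `[-1, x]) F t)}.
  by apply: c0; rewrite in_itv /=; lra.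
have eta2 : 0 < eta / 2 by rewrite divr_gt0.
have /cvgrPdist_lt/(_ _ eta2)[d /= d0 hd] := c0.
exists (Num.min d 1); first by rewrite lt_min d0 ltr01.
move=> e e0; rewrite lt_min => /andP[ed e1].
have h1 := hd e; have h2 := hd (- e).
have E : \int[mu]_(t in `[-1, e]) F t =
   \int[mu]_(t in `[-1, - e]) F t + \int[mu]_(t in `[- e, e]) F t.
  apply: Rintegral_split; [lra|lra|].
  by apply: integrable_sub iF1 => //; lra.
rewrite /ball_ /= sub0r normrN gtr0_norm// in h1.
rewrite /ball_ /= sub0r opprK gtr0_norm// in h2.
move: (h1 ed) (h2 ed); rewrite E; set a := \int[mu]_(t in `[-1, 0]) F t.
set b := \int[mu]_(t in `[-1, - e]) F t; set c := \int[mu]_(t in _) F t.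
move=> ab1 ab2; rewrite (_ : c = (a - b) - (a - (b + c))); last by ring.
by apply: le_trans (ler_normB _ _) _; rewrite (splitr eta) ltW// ltrD.
Qed.

(** The two half-lines are treated separately after removal of an interval
    around the origin, whose contribution vanishes with its length. *)
Lemma osc_estimate : exists2 C : R, 0 <= C & forall A D kappa g,
  amplitude A D alpha -> amplitude (fun p => A (- p)) D alpha ->
  osc_class kappa C0 g -> 0 < kappa -> kappa <= 1 ->
  mu.-integrable setT (EFin \o (fun p => `|p| `^ (m - 1) * A p)) ->
  `|\int[mu]_p (`|p| `^ (m - 1) * A p * g p)| <= C * D * (kappa `^ m + kappa).
Proof.
have [C C_0 hC] := osc_halfline; exists (C + C); first exact: addr_ge0.
move=> A D kappa g amp ampN gC k0 k1 iB.
have [cA _] := amp; have [cg g1 _] := gC.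
set F := fun p => _.
have iF : mu.-integrable setT (EFin \o F).
  apply: (le_integrable _ _ _ iB) => //=.
    apply/measurable_EFinP; apply: measurable_funM; last exact: continuous_measurable_fun.
    by case/integrableP: iB => /measurable_EFinP.
  move=> x _; rewrite lee_fin /F normrM -[X in _ <= X]mulr1.
  by rewrite ler_wpM2l.
have iFab a b : mu.-integrable `[a, b] (EFin \o F) by exact: integrableS iF.
set Bd := (C + C) * D * _.
suff main (N : nat) : `|\int[mu]_(p in `[- N.+1%:R, N.+1%:R]) F p| <= Bd.
  have cv : (fun n : nat => `|\int[mu]_(x in `[- n%:R, n%:R]) F x|) @ \oo -->
      `|\int[mu]_x F x| by apply: cvg_norm; exact: cvg_Rintegral_segment.
  rewrite -(cvg_lim (@Rhausdorff R) cv); apply: limr_le.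
    by apply/cvg_ex; eexists; exact: cv.
  near=> N.
  have N0 : (0 < N)%N by near: N; exact: nbhs_infty_gt.
  by rewrite -(prednK N0); exact: main.
apply/ler_addgt0Pr => eta eta0.
have [d d0 hd] := integral_near0 iF eta0.
pose e := Num.min d kappa / 2.
have mi0 : 0 < Num.min d kappa by rewrite lt_min d0 k0.
have e0 : 0 < e by rewrite divr_gt0.
have emin : e < Num.min d kappa by rewrite /e; lra.
have [ed ek] : e < d /\ e < kappa by move: emin; rewrite lt_min => /andP[].
have N1 : 1 <= N.+1%:R :> R by rewrite ler1n.
have eN : e <= N.+1%:R by lra.
rewrite (@Rintegral_split _ _ (- N.+1%:R) (- e))//; [|lra|lra].
rewrite (@Rintegral_split _ _ (- e) e)//; [|lra].
have Ip : `|\int[mu]_(p in `[e, N.+1%:R]) F p| <= C * D * (kappa `^ m + kappa).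
  have E a p : 0 < a -> a <= p -> F p = p `^ (m - 1) * A p * g p.
    by move=> a0 ap; rewrite /F ger0_norm// ltW// (lt_le_trans a0).
  rewrite (_ : \int[mu]_(p in _) F p =
      \int[mu]_(p in `[e, N.+1%:R]) (p `^ (m - 1) * A p * g p)); last first.
    apply: eq_Rintegral => p; rewrite inE /= in_itv /= => /andP[ep _].
    exact: (E e).
  apply: hC => // a b a0.
  apply: eq_integrable (iFab a b) => // p; rewrite inE /= in_itv /= => /andP[ap _].
  by rewrite (E a).
have In : `|\int[mu]_(p in `[- N.+1%:R, - e]) F p| <= C * D * (kappa `^ m + kappa).
  have cF a b : 0 < a -> {within `[- b, - a], continuous F}.
    move=> a0; apply: continuous_in_subspaceT => x; rewrite inE /= in_itv /= => /andP[_ xa].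
    apply: cvgM; last exact: cg.
    apply: cvgM; last exact: cA.
    have x0 : 0 < `|x| by rewrite normr_gt0 lt_eqF//; lra.
    apply: (@continuous_comp _ _ _ (fun x : R => `|x|) (fun y : R => y `^ (m - 1))).
      exact: norm_continuous.
    exact: powR_continuous.
  rewrite Rintegral_oppr//; last exact: cF.
  have E a p : 0 < a -> a <= p -> F (- p) = p `^ (m - 1) * A (- p) * g (- p).
    by move=> a0 ap; rewrite /F normrN ger0_norm// ltW// (lt_le_trans a0).
  rewrite (_ : \int[mu]_(p in _) F (- p) =
      \int[mu]_(p in `[e, N.+1%:R]) (p `^ (m - 1) * A (- p) * g (- p))); last first.
    apply: eq_Rintegral => p; rewrite inE /= in_itv /= => /andP[ep _].
    exact: (E e).
  apply: (hC (fun p => A (- p)) D kappa (fun p => g (- p))) => //.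
    exact: osc_class_oppr.
  move=> a b a0.
  have : mu.-integrable `[a, b] (EFin \o (fun p => F (- p))).
    apply: continuous_compact_integrable; first exact: segment_compact.
    apply: continuous_in_subspaceT => x; rewrite inE /= in_itv /= => /andP[xa _].
    apply: (@continuous_comp _ _ _ (fun x : R => - x) F); first exact: opp_continuous.
    apply: cvgM; last exact: cg.
    apply: cvgM; last exact: cA.
    have x0 : 0 < `|- x| by rewrite normrN normr_gt0 gt_eqF// (lt_le_trans a0).
    apply: (@continuous_comp _ _ _ (fun x : R => `|x|) (fun y : R => y `^ (m - 1))).
      exact: norm_continuous.
    exact: powR_continuous.
  apply: eq_integrable => // p; rewrite inE /= in_itv /= => /andP[ap _].
  by rewrite (E a).
have I0 := hd e e0 ed.
apply: le_trans (ler_normD _ _) _.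
have h := ler_normD (\int[mu]_(p in `[- e, e]) F p) (\int[mu]_(p in `[e, N.+1%:R]) F p).
apply: le_trans (lerD In (le_trans h (lerD I0 Ip))) _.
by rewrite /Bd le_eqVlt; apply/orP; left; apply/eqP; ring.
Unshelve. all: by end_near. Qed.

End Estimate.
End SingularAmplitude.

(** * The Klein-Gordon phase *)

Section Phase.
Context {R : realType}.
Notation mu := (@lebesgue_measure R).
Variable c : R.
Hypothesis c0 : 0 < c.
Notation F := (fKG c).

Lemma fKG_arg_gt0 (p : R) : 0 < c ^+ 4 + c ^+ 2 * p ^+ 2.
Proof. by rewrite ltr_pwDl ?exprn_gt0// mulr_ge0 ?sqr_ge0. Qed.

Lemma fKG_sqr (p : R) : F p ^+ 2 = c ^+ 4 + c ^+ 2 * p ^+ 2.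
Proof. by rewrite sqr_sqrtr// ltW// fKG_arg_gt0. Qed.

Lemma fKG_gt0 (p : R) : 0 < F p.
Proof. by rewrite sqrtr_gt0 fKG_arg_gt0. Qed.

Lemma fKG_ge (p : R) : c ^+ 2 <= F p.
Proof.
rewrite -(@ler_pXn2r _ 2)// ?nnegrE ?sqr_ge0 ?(ltW (fKG_gt0 p))//.
by rewrite fKG_sqr -exprM lerDl mulr_ge0 ?sqr_ge0.
Qed.

Lemma fKG_le (p P : R) : `|p| <= P -> F p <= F P.
Proof.
move=> pP; rewrite ler_sqrt ?(ltW (fKG_arg_gt0 _))// lerD2l ler_wpM2l ?sqr_ge0//.
by rewrite -(real_normK (num_real p)) lerXn2r ?nnegrE// (le_trans _ pP).
Qed.

Lemma fKG_derive (p : R) : is_derive p 1 F (c ^+ 2 * p / F p).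
Proof.
have d1 : is_derive p 1 (fun p => c ^+ 4 + c ^+ 2 * p ^+ 2) (c ^+ 2 * (2 * p)).
  have := is_deriveD (is_derive_cst (c ^+ 4) p 1)
    (is_deriveZ (c ^+ 2) (is_derive_pow 2 (is_derive_id p 1))).
  by apply: is_derive_eqr; rewrite add0r /GRing.scale /=; ring.
have := @is_derive1_comp _ Num.sqrt (fun p => c ^+ 4 + c ^+ 2 * p ^+ 2) _ _ _
  (is_derive1_sqrt (fKG_arg_gt0 p)) d1.
apply: is_derive_eqr; rewrite -/(F p).
by field; rewrite gt_eqF// fKG_gt0.
Qed.

Lemma fKG_continuous : continuous F.
Proof.
move=> p; apply: differentiable_continuous; apply/derivable1_diffP.
by case: (fKG_derive p).
Qed.

Definition speed (p : R) : R := c ^+ 2 * p / F p.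

Lemma speed_derive (p : R) : is_derive p 1 speed (c ^+ 6 / F p ^+ 3).
Proof.
have F0 : F p != 0 by rewrite gt_eqF// fKG_gt0.
have := is_deriveM (is_deriveZ (c ^+ 2) (is_derive_id p 1))
  (is_deriveV F0 (fKG_derive p)).
have -> : c ^+ 2 \*: id * (fun y => (F y)^-1) = speed.
  by apply/funext => y; rewrite /speed.
apply: is_derive_eqr; rewrite /GRing.scale /=.
have -> : c ^+ 6 = c ^+ 2 * (F p ^+ 2 - c ^+ 2 * p ^+ 2) by rewrite fKG_sqr; ring.
rewrite -[c ^+ 2 *: p]/(c ^+ 2 * p); by field.
Qed.

Lemma speed_continuous : continuous speed.
Proof.
move=> p; apply: differentiable_continuous; apply/derivable1_diffP.
by case: (speed_derive p).
Qed.

(** The derivative of the group velocity is [c^6 / F^3], and [c^2 <= F]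
    everywhere. *)
Lemma speed_increase (P y z : R) : - P <= y -> y <= z -> z <= P ->
  c ^+ 8 / F P ^+ 4 * (z - y) <= speed z - speed y.
Proof.
move=> Py yz zP.
have [x] := MVT_segment yz (fun x _ => speed_derive x) (continuous_subspaceT speed_continuous).
rewrite in_itv /= => /andP[yx xz] ->; rewrite ler_wpM2r ?subr_ge0//.
have xP : `|x| <= P by rewrite ler_norml; apply/andP; split; lra.
have Fx0 := fKG_gt0 x; have FP0 := fKG_gt0 P.
have -> : c ^+ 6 / F x ^+ 3 = c ^+ 6 * F x / F x ^+ 4.
  by field; rewrite gt_eqF.
apply: ler_pM.
- by rewrite exprn_ge0// ltW.
- by rewrite invr_ge0 exprn_ge0// ltW.
- rewrite (_ : c ^+ 8 = c ^+ 6 * c ^+ 2); last by rewrite -exprD.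
  by rewrite ler_wpM2l ?fKG_ge// exprn_ge0// ltW.
- rewrite lef_pV2 ?posrE ?exprn_gt0//.
  by apply: lerXn2r; [rewrite nnegrE ltW|rewrite nnegrE ltW|exact: fKG_le].
Qed.

(** The exact gap between [c] and the group velocity is [c^5 / (F (F + c |p|))]. *)
Lemma speed_gap (P p : R) : `|p| <= P -> `|speed p| <= c - c ^+ 5 / (2 * F P ^+ 2).
Proof.
move=> pP; have Fp0 := fKG_gt0 p; have FP0 := fKG_gt0 P.
have Fp1 : F p != 0 by rewrite gt_eqF.
have cp : c * `|p| <= F p.
  rewrite -(@ler_pXn2r _ 2)// ?nnegrE ?mulr_ge0 ?(ltW c0) ?(ltW Fp0)//.
  by rewrite fKG_sqr exprMn real_normK ?num_real// lerDr exprn_ge0// ltW.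
have E : `|speed p| = c - c ^+ 5 / (F p * (F p + c * `|p|)).
  have Fcp : F p + c * `|p| != 0 by rewrite gt_eqF// ltr_pwDl// mulr_ge0// ltW.
  have c2F : 0 <= c ^+ 2 / F p by rewrite divr_ge0 ?sqr_ge0// ltW.
  rewrite /speed mulrAC normrM (ger0_norm c2F).
  have -> : c ^+ 5 = c * (F p ^+ 2 - c ^+ 2 * `|p| ^+ 2).
    by rewrite fKG_sqr real_normK ?num_real//; ring.
  by field; rewrite Fcp Fp1.
rewrite E lerD2l lerN2 ler_wpM2l ?exprn_ge0 ?(ltW c0)//.
have pos : 0 < F p * (F p + c * `|p|).
  by rewrite mulr_gt0// ltr_pwDl// mulr_ge0// ltW.
rewrite lef_pV2 ?posrE//; last by rewrite mulr_gt0// exprn_gt0.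
apply: le_trans (_ : 2 * F p ^+ 2 <= _); last first.
  rewrite ler_wpM2l//.
  by apply: lerXn2r; [rewrite nnegrE ltW|rewrite nnegrE ltW|exact: fKG_le].
have -> : 2 * F p ^+ 2 = F p * (F p + F p) by ring.
by rewrite ler_wpM2l ?(ltW Fp0)// lerD2l.
Qed.

(** The sum of the constants of the two regimes below, so that one constant
    serves both. *)
Definition KGconst : R := 10 * (c ^+ 4 + c ^+ 2) / c ^+ 4 + 8 * (c ^+ 4 + c ^+ 2) / c ^+ 5.

Lemma KGconst_ge0 : 0 <= KGconst.
Proof. by rewrite addr_ge0// divr_ge0 ?mulr_ge0 ?addr_ge0 ?exprn_ge0// ltW. Qed.

Lemma fKG_sqr_le (P : R) : F P ^+ 2 <= (c ^+ 4 + c ^+ 2) * (1 + P ^+ 2).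
Proof.
rewrite fKG_sqr -subr_ge0 (_ : _ - _ = c ^+ 4 * P ^+ 2 + c ^+ 2); last by ring.
by rewrite addr_ge0 ?sqr_ge0// mulr_ge0 ?sqr_ge0// exprn_ge0// ltW.
Qed.

Section FixedTime.
Variables (t x s : R).
Hypothesis t0 : 0 < t.

Let theta p := x * p - t * F p.
Let d p := x - t * speed p.

Let dtheta (p : R) : is_derive p 1 theta (d p).
Proof.
have := is_deriveB (is_deriveZ x (is_derive_id p 1)) (is_deriveZ t (fKG_derive p)).
by apply: is_derive_eqr; rewrite /GRing.scale /= mulr1.
Qed.

Let cd : continuous d.
Proof.
move=> p; apply: cvgB; first exact: cvg_cst.
by apply: cvgM; [exact: cvg_cst|exact: speed_continuous].
Qed.

Let ccos : continuous (fun p => cos (theta p + s)).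
Proof.
move=> p; apply: continuous_comp; last exact: continuous_cos.
apply: cvgD; last exact: cvg_cst.
by apply: differentiable_continuous; apply/derivable1_diffP; case: (dtheta p).
Qed.

Let cos1 p : `|cos (theta p + s)| <= 1.
Proof. by rewrite ler_norml cos_geN1 cos_le1. Qed.

Let dnd P (P0 : 0 <= P) y z : - P <= y -> y <= z -> z <= P -> d z <= d y.
Proof.
move=> Py yz zP; rewrite lerD2l lerN2 ler_wpM2l ?(ltW t0)// -subr_ge0.
apply: le_trans (speed_increase Py yz zP); rewrite mulr_ge0 ?subr_ge0//.
by rewrite divr_ge0// exprn_ge0// ltW// fKG_gt0.
Qed.

(** Second derivative test with [lam] of order [t / F^4] and a window [eta] of
    order [t^(-1/2) F^2], the choice that balances its two terms. *)
Lemma KG_osc_class : osc_class (t `^ (- 2^-1)) KGconst (fun p => cos (x * p - t * F p + s)).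
Proof.
split; [exact: ccos|exact: cos1|] => P a b P0 Pa ab bP.
set q := t `^ _; have q0 : 0 < q by exact: powR_gt0.
have q2 : q ^+ 2 = t^-1.
  rewrite -powR_mulrn ?(ltW q0)// -powRrM -(powR_inv1 (ltW t0)).
  by congr (_ `^ _); field.
have tE : t = (q ^+ 2)^-1 by rewrite q2 invrK.
have FP0 := fKG_gt0 P.
have F2 := fKG_sqr_le P.
pose lam := t * (c ^+ 8 / F P ^+ 4); pose eta := q * F P ^+ 2 / c ^+ 4.
have lam0 : 0 < lam by rewrite mulr_gt0// divr_gt0// exprn_gt0.
have eta0 : 0 < eta by rewrite divr_gt0 ?mulr_gt0// exprn_gt0.
apply: le_trans (second_derivative_test (theta := theta) (d := d) s dtheta cd ab lam0 eta0 _) _.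
  move=> y z ay yz zb.
  have := speed_increase (le_trans Pa ay) yz (le_trans zb bP).
  move=> /(ler_wpM2l (ltW t0)); rewrite mulrA => /le_trans; apply.
  by rewrite /d mulrBr; lra.
have -> : 8 / (lam * eta) + 2 * eta = q * (10 * F P ^+ 2 / c ^+ 4).
  rewrite /lam /eta tE; field; rewrite !gt_eqF//.
rewrite ler_wpM2l ?(ltW q0)//.
rewrite [X in _ <= X](_ : _ = 10 * (c ^+ 4 + c ^+ 2) / c ^+ 4 * (1 + P ^+ 2) +
  8 * (c ^+ 4 + c ^+ 2) / c ^+ 5 * (1 + P ^+ 2)); last by rewrite /KGconst; ring.
apply: le_trans (_ : 10 * (c ^+ 4 + c ^+ 2) / c ^+ 4 * (1 + P ^+ 2) <= _).
  rewrite [X in _ <= X]mulrAC ler_pM2r ?invr_gt0 ?exprn_gt0// -[X in _ <= X]mulrA.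
  by rewrite ler_wpM2l.
rewrite lerDl mulr_ge0 ?addr_ge0 ?sqr_ge0// divr_ge0 ?mulr_ge0 ?addr_ge0 ?exprn_ge0//; exact: ltW.
Qed.

(** Outside the cone the phase has no stationary point: on [-P, P] its
    derivative is at least [t] times the gap of [speed_gap], and the first
    derivative test gains [t^-1]. *)
Lemma KG_osc_class_outside : c * t <= `|x| ->
  osc_class t^-1 KGconst (fun p => cos (x * p - t * F p + s)).
Proof.
move=> xct; split; [exact: ccos|exact: cos1|] => P a b P0 Pa ab bP.
have FP0 := fKG_gt0 P.
have F2 := fKG_sqr_le P.
pose lam := t * (c ^+ 5 / (2 * F P ^+ 2)).
have lam0 : 0 < lam by rewrite mulr_gt0// divr_gt0// ?mulr_gt0// exprn_gt0.
have gap p : `|p| <= P -> `|t * speed p| <= c * t - lam.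
  move=> /speed_gap /(ler_wpM2l (ltW t0)).
  by rewrite (normrM t) (gtr0_norm t0) mulrBr (mulrC t c).
have aP : `|a| <= P by rewrite ler_norml Pa (le_trans ab).
have bP' : `|b| <= P by rewrite ler_norml bP (le_trans Pa).
apply: le_trans (first_derivative_test (theta := theta) (d := d) s dtheta cd ab lam0 _ _) _.
- by move=> y z ay yz zb; apply: (dnd P0) => //; [exact: le_trans ay|exact: le_trans bP].
- apply/orP; have [x0|x0] := leP 0 x.
    left; rewrite ger0_norm// in xct; have := gap b bP'.
    by rewrite /d ler_norml => /andP[? ?]; lra.
  right; rewrite ltr0_norm// in xct; have := gap a aP.
  by rewrite /d ler_norml => /andP[? ?]; lra.
have -> : 4 / lam = t^-1 * (8 * F P ^+ 2 / c ^+ 5).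
  by rewrite /lam; field; rewrite !gt_eqF.
rewrite ler_wpM2l ?invr_ge0 ?(ltW t0)//.
rewrite [X in _ <= X](_ : _ = 10 * (c ^+ 4 + c ^+ 2) / c ^+ 4 * (1 + P ^+ 2) +
  8 * (c ^+ 4 + c ^+ 2) / c ^+ 5 * (1 + P ^+ 2)); last by rewrite /KGconst; ring.
apply: le_trans (_ : 8 * (c ^+ 4 + c ^+ 2) / c ^+ 5 * (1 + P ^+ 2) <= _).
  rewrite [X in _ <= X]mulrAC ler_pM2r ?invr_gt0 ?exprn_gt0// -[X in _ <= X]mulrA.
  by rewrite ler_wpM2l.
rewrite lerDr mulr_ge0 ?addr_ge0 ?sqr_ge0// divr_ge0 ?mulr_ge0 ?addr_ge0 ?exprn_ge0//; exact: ltW.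
Qed.

End FixedTime.
End Phase.

Section AmplitudeDecay.
Context {R : realType}.
Notation mu := (@lebesgue_measure R).

(** Finitely many exceptions are absorbed by the constant. *)
Lemma eventually_bounded_le (V w : nat -> R) (N : nat) (K : R) :
  (forall n, 0 < w n) -> (forall n, 0 <= V n) -> 0 <= K ->
  (forall n, (N <= n)%N -> V n <= K * w n) ->
  exists2 D, K <= D & forall n, V n <= D * w n.
Proof.
move=> w0 V0 K0 VK; exists (K + \sum_(i < N) V i / w i).
  by rewrite lerDl sumr_ge0// => i _; rewrite divr_ge0// ltW.
move=> n; have S0 : 0 <= \sum_(i < N) V i / w i.
  by apply: sumr_ge0 => i _; rewrite divr_ge0// ltW.
have [Nn|nN] := leqP N n.
  by apply: le_trans (VK n Nn) _; rewrite ler_wpM2r ?(ltW (w0 n))// lerDl.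
rewrite (bigD1 (Ordinal nN))//= -ler_pdivrMr// addrCA lerDl addr_ge0//.
by apply: sumr_ge0 => i _; rewrite divr_ge0// ltW.
Qed.

(** Condition (C3) controls the cells far from the origin; the variation on the
    finitely many others is finite because the derivative is locally
    integrable. The variation is majorised with [le_integral_derivative]. *)
Lemma amplitude_of_decay (A dA h : R -> R) (alpha r M M' : R) :
  0 <= alpha -> 0 <= M -> 0 <= M' ->
  (forall x : R, is_derive x 1 A (dA x)) -> (forall x, `|dA x| <= h x) ->
  (forall a b, mu.-integrable `[a, b] (EFin \o h)) ->
  (forall p, `|A p| <= M * (1 + p ^+ 2) `^ (- (alpha / 2))) ->
  (forall n : int, n != 0 -> r <= `|n%:~R| ->
     \int[mu]_(p in `[n%:~R, (n + 1)%:~R]) h p <= M' * `|n%:~R| `^ (- alpha)) ->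
  exists D, amplitude A D alpha /\ amplitude (fun p => A (- p)) D alpha.
Proof.
move=> al0 M0 M'0 dAx Ah ih AM hM'.
pose w n : R := n.+1%:R `^ (- alpha).
have w0 n : 0 < w n by rewrite powR_gt0// ltr0n.
pose V (n : nat) : R := \int[mu]_(p in `[n%:R, n.+1%:R]) h p +
                \int[mu]_(p in `[- n.+1%:R, - n%:R]) h p.
have h0 x : 0 <= h x := le_trans (normr_ge0 _) (Ah x).
have I0 a b : 0 <= \int[mu]_(p in `[a, b]) h p by exact: Rintegral_ge0.
have V0 n : 0 <= V n by rewrite addr_ge0.
(* from N on, both cells at distance n of the origin are at distance at least r *)
pose N := (Num.truncn `|r|).+2.
have K0 : 0 <= M' * (2 `^ alpha + 1) by rewrite mulr_ge0// addr_ge0// powR_ge0.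
have VK n : (N <= n)%N -> V n <= M' * (2 `^ alpha + 1) * w n.
  move=> Nn; have rn : r <= n%:R.
    apply: le_trans (ler_norm _) _.
    have /andP[_ /ltW h1] := truncn_itv (normr_ge0 r).
    by apply: le_trans h1 _; rewrite ler_nat (leq_trans _ Nn).
  have n0 : (0 < n)%N by apply: leq_trans Nn.
  have n0' : 0 < n%:R :> R by rewrite ltr0n.
  rewrite mulrDr mulr1 mulrDl; apply: lerD.
    have := hM' (Posz n); rewrite -!pmulrn eqz_nat -lt0n n0 ger0_norm ?ler0n// => /(_ isT rn).
    rewrite addn1.
    move/le_trans; apply; rewrite -mulrA ler_wpM2l// /w.
    rewrite !powRN -(invrK (2 `^ alpha)) -invfM lef_pV2 ?posrE ?powR_gt0 ?mulr_gt0 ?invr_gt0 ?powR_gt0 ?ltr0n//.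
    rewrite mulrC ler_pdivrMr ?powR_gt0// -powRM ?ler0n//.
    apply: ge0_ler_powR => //; rewrite ?nnegrE ?mulr_ge0 ?ler0n//.
    by rewrite -natrM ler_nat; lia.
  have := hM' (- Posz n.+1); rewrite oppr_eq0 => /(_ isT).
  rewrite mulrNz normrN -!pmulrn ger0_norm ?ler0n//.
  have rn1 : r <= n.+1%:R by apply: le_trans rn _; rewrite ler_nat.
  move=> /(_ rn1).
  by rewrite (_ : (- Posz n.+1 + 1)%:~R = - n%:R :> R)// intrD mulrNz -!pmulrn -natr1; ring.
have [D1 KD1 hD1] := eventually_bounded_le w0 V0 K0 VK.
pose D := D1 + M * 2 `^ (alpha / 2).
have D10 : 0 <= D1 := le_trans K0 KD1.
have D20 : 0 <= M * 2 `^ (alpha / 2) by rewrite mulr_ge0// powR_ge0.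
have VD n : V n <= D * w n.
  by apply: le_trans (hD1 n) _; rewrite ler_wpM2r ?(ltW (w0 n))// lerDl.
have AD (n : nat) p : n%:R <= p <= n.+1%:R -> forall q, q ^+ 2 = p ^+ 2 -> `|A q| <= D * w n.
  move=> /andP[np pn] q qp; apply: le_trans (AM q) _; rewrite qp.
  apply: le_trans (_ : M * 2 `^ (alpha / 2) * w n <= _); last first.
    by rewrite ler_wpM2r ?(ltW (w0 n))// lerDr.
  have p2 : 0 < 1 + p ^+ 2 by rewrite ltr_pwDl// sqr_ge0.
  have n10 : 0 < n.+1%:R :> R by rewrite ltr0n.
  rewrite -mulrA ler_wpM2l// /w.
  have -> : n.+1%:R `^ (- alpha) = (n.+1%:R ^+ 2) `^ (- (alpha / 2)) :> R.
    by rewrite -powR_mulrn ?ler0n// -powRrM; congr (_ `^ _); field.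
  rewrite !powRN -(invrK (2 `^ (alpha / 2))) -invfM.
  rewrite lef_pV2 ?posrE ?powR_gt0 ?mulr_gt0 ?invr_gt0 ?powR_gt0 ?exprn_gt0//.
  rewrite mulrC ler_pdivrMr ?powR_gt0// -powRM ?(ltW p2)//.
  apply: ge0_ler_powR; rewrite ?nnegrE ?mulr_ge0 ?divr_ge0 ?sqr_ge0 ?(ltW p2)//.
  have n0 : 0 <= n%:R :> R by rewrite ler0n.
  have : (n%:R : R) ^+ 2 <= p ^+ 2 by apply: lerXn2r; rewrite ?nnegrE// (le_trans n0).
  by have := sqr_ge0 ((n%:R : R) - 1); rewrite -natr1; nra.
have dif a b : a <= b -> `|A b - A a| <= \int[mu]_(p in `[a, b]) h p.
  by move=> ab; apply: (le_integral_derivative (df := dA)).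
have cA : continuous A.
  by move=> x; apply: differentiable_continuous; apply/derivable1_diffP; case: (dAx x).
exists D; split.
  split => // n; split; first by move=> p pn; exact: AD pn _ erefl.
  have nn : n%:R <= n.+1%:R :> R by rewrite ler_nat.
  exists (fun x => \int[mu]_(p in `[n%:R, x]) h p).
    move=> x y nx xy yn; apply: le_trans (dif x y xy) _.
    by rewrite (Rintegral_split nx xy (ih _ _)) addrC addKr.
  rewrite set_itv1 Rintegral_set1 subr0; apply: le_trans (VD n).
  by rewrite lerDl.
split.
  by move=> x; apply: continuous_comp; [exact: opp_continuous|exact: cA].
move=> n; split; first by move=> p pn; apply: AD pn _ _; rewrite sqrrN.
have nn : n%:R <= n.+1%:R :> R by rewrite ler_nat.
exists (fun x => - \int[mu]_(p in `[- n.+1%:R, - x]) h p).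
  move=> x y nx xy yn; rewrite distrC; apply: le_trans (dif (- y) (- x) _) _; first by rewrite lerN2.
  have e1 : - n.+1%:R <= - y by rewrite lerN2.
  have e2 : - y <= - x by rewrite lerN2.
  by rewrite (Rintegral_split e1 e2 (ih _ _)) opprK addKr.
rewrite set_itv1 Rintegral_set1 oppr0 sub0r opprK; apply: le_trans (VD n).
by rewrite lerDr.
Qed.

End AmplitudeDecay.

(** * Decay of the two waves *)

Section Waves.
Context {R : realType}.
Notation Re := complex.Re.
Notation Im := complex.Im.
Notation mu := (@lebesgue_measure R).

Definition symbol (m : R) (ut : R -> R[i]) (p : R) : R[i] :=
  (`|p| `^ (m - 1))%:C * ut p.

(** On [-1, 1] integrability is read off from the pairing of the distribution
    with a Gaussian, elsewhere from the decay of [ut]. *)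
Lemma symbol_cintegrable (m alpha M : R) (ut : R -> R[i]) (w : functional R) :
  m <= 1 -> 2 <= alpha -> 0 <= M ->
  (forall p, cabs (ut p) <= M * (1 + p ^+ 2) `^ (- (alpha / 2))) ->
  regular w (symbol m ut) -> cintegrable (symbol m ut).
Proof.
move=> m1 al2 M0 utM reg.
have [ig _] := reg _ (gaussian_schwartz (@ltr01 R)).
set g := symbol m ut in ig *.
have E p : g p = (g p * (gaussian 1 p)%:C) * (expR (p ^+ 2))%:C.
  by rewrite -mulrA -rmorphM /gaussian -expRD mul1r addrC subrr expR0 mulr1.
have mg : cmeas g.
  rewrite (_ : g = fun p => (g p * (gaussian 1 p)%:C) * (expR (p ^+ 2))%:C); last first.
    by apply/funext => p; exact: E.
  apply: cmeasM; first exact: cmeas_integrable.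
  apply: cmeas_real; apply: continuous_measurable_fun => x.
  apply: (@continuous_comp _ _ _ (fun x : R => x ^+ 2) expR); last exact: continuous_expR.
  exact: exprn_continuous.
have iG := integrable_cabs ig.
apply: (cintegrable_le (g := fun p => expR 1 * cabs (g p * (gaussian 1 p)%:C) +
    M * (1 + p ^+ 2)^-1)) => //.
  have i1 : mu.-integrable setT (EFin \o (fun p => expR 1 * cabs (g p * (gaussian 1 p)%:C))).
    by under [_ \o _]eq_fun do rewrite /= EFinM; exact: integrableZl.
  have := integrableD measurableT i1 (integrable_inv_oneDsqr M).
  by apply: eq_integrable.
move=> p; have P0 : 0 <= M * (1 + p ^+ 2)^-1.
  by rewrite mulr_ge0// invr_ge0 addr_ge0// sqr_ge0.
have [p1|p1] := leP `|p| 1.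
  apply: le_trans (_ : expR 1 * cabs (g p * (gaussian 1 p)%:C) <= _); last by rewrite lerDl.
  rewrite cabsM cabs_real gtr0_norm ?gaussian_gt0// mulrCA -[X in X <= _]mulr1.
  rewrite ler_wpM2l ?cabs_ge0// /gaussian -expRD -[X in X <= _]expR0 ler_expR mul1r subr_ge0.
  by rewrite -(real_normK (num_real p)) exprn_ile1.
apply: le_trans (_ : M * (1 + p ^+ 2)^-1 <= _); last first.
  by rewrite lerDr mulr_ge0 ?expR_ge0 ?cabs_ge0.
rewrite /g /symbol cabsM cabs_real ger0_norm ?powR_ge0//.
have h1 : `|p| `^ (m - 1) <= 1.
  by have := powR_antitone m1 ltr01 (ltW p1); rewrite powR1.
apply: le_trans (ler_pM (powR_ge0 _ _) (cabs_ge0 _) h1 (utM p)) _.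
rewrite mul1r ler_wpM2l// -(@powR_inv1 R (1 + p ^+ 2)) ?addr_ge0 ?sqr_ge0//.
by apply: ler_powR; [rewrite lerDl sqr_ge0|lra].
Qed.

Lemma clocally_integrable_segment (f : R -> R[i]) (a b : R) : clocally_integrable f ->
  mu.-integrable `[a, b] (EFin \o (fun p => cabs (f p))).
Proof.
move=> [[m1 _ l1] [m2 _ l2]].
have mf : cmeas f by split.
have s1 : `[a, b]%classic `<=` setT by [].
have L1 := l1 _ s1 (@segment_compact R a b).
have L2 := l2 _ s1 (@segment_compact R a b).
have i1 : mu.-integrable `[a, b] (EFin \o (fun p => Re (f p))).
  apply/integrableP; split; last exact: L1.
  by apply/measurable_EFinP; exact: measurable_funTS.
have i2 : mu.-integrable `[a, b] (EFin \o (fun p => Im (f p))).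
  apply/integrableP; split; last exact: L2.
  by apply/measurable_EFinP; exact: measurable_funTS.
have i3 : mu.-integrable `[a, b]
    (fun x => ((`|Re (f x)|)%:E + (`|Im (f x)|)%:E)%E).
  by apply: integrableD => //; [exact: (integrable_norm i1)|exact: (integrable_norm i2)].
apply: le_integrable i3 => //.
  by apply/measurable_EFinP; apply: measurable_funTS; exact: cmeas_cabs.
move=> x _; rewrite /= lee_fin (ger0_norm (cabs_ge0 _)) ger0_norm ?addr_ge0//.
exact: cabs_le_ReIm.
Qed.

(** Real and imaginary parts of the amplitude times cosine and sine of the
    phase; the sine is a shifted cosine, which is why the oscillation is
    required for all shifts. For [kappa > 1] the trivial bound is enough. *)
Lemma phase_integral_le (m alpha r C0 : R) (ut : R -> R[i]) (M M' : R) :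
  0 < m -> m <= 1 -> 3 < alpha -> 0 <= C0 -> 0 <= M -> 0 <= M' ->
  cderivable ut ->
  (forall p, cabs (ut p) <= M * (1 + p ^+ 2) `^ (- (alpha / 2))) ->
  clocally_integrable (cderive ut) ->
  (forall n : int, n != 0 -> r <= `|n%:~R| ->
     (\int[mu]_(p in `[n%:~R, (n + 1)%:~R]) (cabs (cderive ut p))%:E
       <= (M' * `|n%:~R| `^ (- alpha))%:E)%E) ->
  cintegrable (symbol m ut) ->
  exists2 C : R, 0 <= C & forall kappa (phi : R -> R), 0 < kappa ->
    measurable_fun setT phi ->
    (forall s, osc_class kappa C0 (fun p => cos (phi p + s))) ->
    cabs (cintegral (fun p => symbol m ut p * expi (phi p))) <=
      C * (kappa `^ m + kappa).
Proof.
move=> m0 m1 al3 C00 M0 M'0 dut utM li hM' ig.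
have [C Cge0 hC] := osc_estimate m0 m1 al3 C00.
pose h p := cabs (cderive ut p).
have ih a b : mu.-integrable `[a, b] (EFin \o h) by exact: clocally_integrable_segment.
have hM n : n != 0 -> r <= `|n%:~R| ->
    \int[mu]_(p in `[n%:~R, (n + 1)%:~R]) h p <= M' * `|n%:~R| `^ (- alpha).
  move=> n0 rn; have := hM' n n0 rn; rewrite -lee_fin; apply: le_trans.
  by rewrite /Rintegral fineK//; exact: integrable_fin_num.
have al0 : 0 <= alpha by apply: ltW; apply: lt_trans al3.
have dutx := cderivable_is_derive dut.
have [D1 [a1 a1n]] := @amplitude_of_decay R (fun p => Re (ut p))
  (fun p => Re (cderive ut p)) h alpha r M M' al0 M0 M'0 (fun x => (dutx x).1)
  (fun x => Re_le_cabs _) ih (fun p => le_trans (Re_le_cabs _) (utM p)) hM.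
have [D2 [a2 a2n]] := @amplitude_of_decay R (fun p => Im (ut p))
  (fun p => Im (cderive ut p)) h alpha r M M' al0 M0 M'0 (fun x => (dutx x).2)
  (fun x => Im_le_cabs _) ih (fun p => le_trans (Im_le_cabs _) (utM p)) hM.
have iR : mu.-integrable setT (EFin \o (fun p => `|p| `^ (m - 1) * Re (ut p))).
  have := ig.1; apply: eq_integrable => // p _.
  by rewrite /= /symbol cReM /= mul0r subr0.
have iI : mu.-integrable setT (EFin \o (fun p => `|p| `^ (m - 1) * Im (ut p))).
  have := ig.2; apply: eq_integrable => // p _.
  by rewrite /= /symbol cImM /= mul0r addr0.
pose L := 2 * \int[mu]_p cabs (symbol m ut p).
have L0 : 0 <= L by rewrite mulr_ge0// Rintegral_ge0// => p _; exact: cabs_ge0.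
exists (2 * (C * `|D1| + C * `|D2|) + L).
  by rewrite addr_ge0// !mulr_ge0// addr_ge0// mulr_ge0.
move=> kappa phi k0 mphi osc.
have km0 : 0 <= kappa `^ m by exact: powR_ge0.
have kk0 : 0 <= kappa `^ m + kappa by rewrite addr_ge0// ltW.
have [k1|k1] := leP kappa 1; last first.
  apply: le_trans (_ : L <= _).
    apply: cabs_cintegral_le.
    - apply: (cintegrableM_bounded (M := 1) ig); first exact: cmeas_expi.
      by move=> x; rewrite cabs_expi.
    - exact: integrable_cabs.
    - by move=> x; rewrite cabsM cabs_expi mulr1.
  rewrite -[X in X <= _]mulr1; apply: ler_pM => //.
    by rewrite lerDr !mulr_ge0// addr_ge0// mulr_ge0.
  by apply: le_trans (ltW k1) _; rewrite lerDr.
have bnd A D s : amplitude A D alpha -> amplitude (fun p => A (- p)) D alpha ->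
    mu.-integrable setT (EFin \o (fun p => `|p| `^ (m - 1) * A p)) ->
    mu.-integrable setT (EFin \o (fun p => `|p| `^ (m - 1) * A p * cos (phi p + s))) /\
    `|\int[mu]_p (`|p| `^ (m - 1) * A p * cos (phi p + s))| <=
      C * `|D| * (kappa `^ m + kappa).
  move=> aA aAn iA; split.
    apply: (le_integrable _ _ _ iA) => //=.
      apply/measurable_EFinP; apply: measurable_funM.
        by case/integrableP: iA => /measurable_EFinP.
      by have [co _ _] := osc s; exact: continuous_measurable_fun.
    move=> x _; rewrite lee_fin normrM -[X in _ <= X]mulr1 ler_wpM2l//.
    by rewrite ler_norml cos_geN1 cos_le1.
  apply: le_trans (hC _ _ _ _ aA aAn (osc s) k0 k1 iA) _.
  by rewrite ler_wpM2r// ler_wpM2l// ler_norm.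
have [i1 b1] := bnd _ _ 0 a1 a1n iR; have [i2 b2] := bnd _ _ 0 a2 a2n iI.
have [i3 b3] := bnd _ _ (- (pi / 2)) a1 a1n iR.
have [i4 b4] := bnd _ _ (- (pi / 2)) a2 a2n iI.
have sinE z : sin z = cos (z - pi / 2) :> R.
  by rewrite cosB cos_pihalf sin_pihalf mulr0 add0r mulr1.
have RE : Re (cintegral (fun p => symbol m ut p * expi (phi p))) =
    \int[mu]_p (`|p| `^ (m - 1) * Re (ut p) * cos (phi p + 0)) -
    \int[mu]_p (`|p| `^ (m - 1) * Im (ut p) * cos (phi p - pi / 2)).
  rewrite -RintegralB// /cintegral /=; apply: eq_Rintegral => p _.
  by rewrite /symbol !(cReM, cImM) /= -sinE addr0; ring.
have IE : Im (cintegral (fun p => symbol m ut p * expi (phi p))) =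
    \int[mu]_p (`|p| `^ (m - 1) * Re (ut p) * cos (phi p - pi / 2)) +
    \int[mu]_p (`|p| `^ (m - 1) * Im (ut p) * cos (phi p + 0)).
  rewrite -RintegralD// /cintegral /=; apply: eq_Rintegral => p _.
  by rewrite /symbol !(cReM, cImM) /= -sinE addr0; ring.
apply: le_trans (cabs_le_ReIm _) _; rewrite RE IE.
apply: le_trans (lerD (ler_normB _ _) (ler_normD _ _)) _.
apply: le_trans (lerD (lerD b1 b4) (lerD b3 b2)) _.
rewrite -subr_ge0 (_ : _ - _ = L * (kappa `^ m + kappa)); last by ring.
by rewrite mulr_ge0.
Qed.

Section KleinGordonWaves.
Variable c : R.
Hypothesis c0 : 0 < c.

(** Changing the sign of the phase of the second wave turns it into the phase of
    the first one at the point [- x], which is on the same side of the cone. *)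
Lemma wave_osc (kappa t x : R) :
  (forall y s, `|y| = `|x| ->
     osc_class kappa (KGconst c) (fun p => cos (y * p - t * fKG c p + s))) ->
  (forall s, osc_class kappa (KGconst c) (fun p => cos (x * p - t * fKG c p + s))) /\
  (forall s, osc_class kappa (KGconst c) (fun p => cos (x * p + t * fKG c p + s))).
Proof.
move=> h; split=> s; first exact: h.
rewrite (_ : (fun p => _) = (fun p => cos ((- x) * p - t * fKG c p + - s))).
  by apply: h; rewrite normrN.
by apply/funext => p; rewrite -[LHS]cosN; congr cos; ring.
Qed.

(** [phase_integral_le] for both waves, with [kappa = t^(-1/2)] everywhere and
    [kappa = t^-1] outside the cone. *)
Lemma uKG_le (m alpha r : R) (utp utm : R -> R[i]) (Mp Mm Mp' Mm' : R) :
  0 < m -> m <= 1 -> 3 < alpha -> 0 <= Mp -> 0 <= Mp' -> 0 <= Mm -> 0 <= Mm' ->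
  cderivable utp -> cderivable utm ->
  (forall p, cabs (utp p) <= Mp * (1 + p ^+ 2) `^ (- (alpha / 2))) ->
  (forall p, cabs (utm p) <= Mm * (1 + p ^+ 2) `^ (- (alpha / 2))) ->
  clocally_integrable (cderive utp) -> clocally_integrable (cderive utm) ->
  (forall n : int, n != 0 -> r <= `|n%:~R| ->
     (\int[mu]_(p in `[n%:~R, (n + 1)%:~R]) (cabs (cderive utp p))%:E
       <= (Mp' * `|n%:~R| `^ (- alpha))%:E)%E) ->
  (forall n : int, n != 0 -> r <= `|n%:~R| ->
     (\int[mu]_(p in `[n%:~R, (n + 1)%:~R]) (cabs (cderive utm p))%:E
       <= (Mm' * `|n%:~R| `^ (- alpha))%:E)%E) ->
  cintegrable (symbol m utp) -> cintegrable (symbol m utm) ->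
  exists C : R, forall t x, 0 < t ->
    (cabs (uKG c (symbol m utp) (symbol m utm) t x) <=
       C * t `^ (- (m / 2)) + C * t `^ (- 2^-1)) /\
    (c * t <= `|x| -> cabs (uKG c (symbol m utp) (symbol m utm) t x) <=
       C * t `^ (- m) + C * t^-1).
Proof.
move=> m0 m1 al3 Mp0 Mp0' Mm0 Mm0' dp dm bp bm lp lm vp vm ip im.
have [Cp Cp0 hp] := phase_integral_le m0 m1 al3 (KGconst_ge0 c0) Mp0 Mp0' dp bp lp vp ip.
have [Cm Cm0 hm] := phase_integral_le m0 m1 al3 (KGconst_ge0 c0) Mm0 Mm0' dm bm lm vm im.
exists ((2 * pi)^-1 * (Cp + Cm)) => t x t0.
have pi0 : 0 <= (2 * pi)^-1 :> R by rewrite invr_ge0 mulr_ge0// pi_ge0.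
have mF : measurable_fun setT (fKG c).
  by apply: continuous_measurable_fun; exact: fKG_continuous.
have m1' : measurable_fun setT (fun p => x * p - t * fKG c p).
  by apply: measurable_funB; apply: measurable_funM => //; exact: measurable_cst.
have m2' : measurable_fun setT (fun p => x * p + t * fKG c p).
  by apply: measurable_funD; apply: measurable_funM => //; exact: measurable_cst.
have key kappa : 0 < kappa ->
    (forall y s, `|y| = `|x| ->
       osc_class kappa (KGconst c) (fun p => cos (y * p - t * fKG c p + s))) ->
    cabs (uKG c (symbol m utp) (symbol m utm) t x) <=
      (2 * pi)^-1 * (Cp + Cm) * (kappa `^ m + kappa).
  move=> k0 /wave_osc[w1 w2].
  rewrite /uKG /fourierV -mulrDr cabsM cabs_real ger0_norm// -mulrA ler_wpM2l//.
  apply: le_trans (cabsD _ _) _; rewrite mulrDl; apply: lerD.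
    apply: le_trans (hp kappa _ k0 m1' w1).
    rewrite le_eqVlt; apply/orP; left; apply/eqP; congr cabs; apply: eq_cintegral => p.
    by rewrite expiD; ring.
  apply: le_trans (hm kappa _ k0 m2' w2).
  rewrite le_eqVlt; apply/orP; left; apply/eqP; congr cabs; apply: eq_cintegral => p.
  by rewrite expiD; ring.
split.
  rewrite -mulrDr (_ : t `^ (- (m / 2)) = (t `^ (- 2^-1)) `^ m); last first.
    by rewrite -powRrM; congr (_ `^ _); ring.
  apply: key; first exact: powR_gt0.
  by move=> y s _; exact: KG_osc_class.
move=> xct; rewrite -mulrDr (_ : t `^ (- m) = (t^-1) `^ m); last first.
  by rewrite -(powR_inv1 (ltW t0)) -powRrM; congr (_ `^ _); ring.
apply: key; first by rewrite invr_gt0.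
by move=> y s yx; apply: KG_osc_class_outside => //; rewrite yx.
Qed.

End KleinGordonWaves.
End Waves.

(** * Functions with polynomially growing exponential moments *)

Section ExponentialMoments.
Context {R : realType}.
Notation mu := (@lebesgue_measure R).
Implicit Types (f : R -> R) (t T s z C : R).

Lemma series_exp_coeff_le z N : 0 <= z -> series (exp_coeff z) N <= expR z.
Proof.
move=> z0; rewrite /expR; apply: nondecreasing_cvgn_le; last exact: is_cvg_series_exp_coeff.
by apply: nondecreasing_series => n _ _; exact: exp_coeff_ge0.
Qed.

Lemma norm_series_exp_coeff_le z N : `|series (exp_coeff z) N| <= expR `|z|.
Proof.
apply: le_trans (series_exp_coeff_le N (normr_ge0 z)).
rewrite /series /=; apply: le_trans (ler_norm_sum _ _ _) _; apply: ler_sum => i _.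
by rewrite /exp_coeff /= normrM normrX normfV (ger0_norm (ler0n _ _)).
Qed.

Lemma Rintegral_dominated_cvg (a b : R) (F : nat -> R -> R) (G H : R -> R) :
  (forall n, measurable_fun `[a, b] (F n)) -> measurable_fun `[a, b] G ->
  (forall x, a <= x <= b -> F n x @[n --> \oo] --> G x) ->
  mu.-integrable `[a, b] (EFin \o H) ->
  (forall n x, a <= x <= b -> `|F n x| <= H x) ->
  \int[mu]_(x in `[a, b]) F n x @[n --> \oo] --> \int[mu]_(x in `[a, b]) G x.
Proof.
move=> mF mG FG iH FH.
have [] := @dominated_convergence _ _ _ mu `[a, b]%classic (measurable_itv _)
  (fun n x => (F n x)%:E) (fun x => (G x)%:E) (fun x => (H x)%:E).
- by move=> n; apply/measurable_EFinP; exact: mF.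
- by apply/measurable_EFinP; exact: mG.
- apply: aeW => x; rewrite /= in_itv /= => xab.
  by apply: cvg_EFin; [exact: nearW|exact: FG].
- exact: iH.
- by apply: aeW => x n; rewrite /= in_itv /= => xab; rewrite lee_fin; exact: FH.
move=> iG _ h; apply: (fine_cvg (a := \int[mu]_(x in `[a, b]) G x)).
rewrite /Rintegral fineK//.
exact: integrable_fin_num iG.
Qed.

Lemma continuous_sum (g : nat -> R -> R) K : (forall k, continuous (g k)) ->
  continuous (fun s => \sum_(k < K) g k s).
Proof.
move=> cg s; elim: K => [|K IH].
  by under eq_fun do rewrite big_ord0; exact: cvg_cst.
rewrite (_ : (fun s => \sum_(k < K.+1) g k s) = fun s => \sum_(k < K) g k s + g K s).
  by apply: cvgD => //; exact: cg.
by apply/funext => x; rewrite big_ord_recr.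
Qed.

Lemma expR_cube_ge z : 0 <= z -> z ^+ 3 <= 6 * expR z.
Proof.
move=> z0; have := expR_ge1Dxn 2 z0.
have -> : (3`!%:R : R) = 6 by rewrite -[6]/(6%:R).
by move=> h; have := exprn_ge0 3 z0; lra.
Qed.

(** The weight [1 - expR (- expR (n (t - s)))] is a smooth version of the
    indicator of [s < t]. Its expansion in powers of [expR (n (t - s))] is a
    series of exponential moments of [f], each carrying a factor at most
    [expR (- n (T - t))] that beats the quadratic growth of the moments. *)
Lemma exp_moments_kernel f T t C n :
  continuous f -> 0 <= t -> t < T -> 0 <= C -> (0 < n)%N ->
  (forall k : nat, `|\int[mu]_(s in `[0, T]) (expR (k%:R * (T - s)) * f s)| <=
     C * (1 + k%:R) ^+ 2) ->
  `|\int[mu]_(s in `[0, T]) ((1 - expR (- expR (n%:R * (t - s)))) * f s)| <=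
     C * expR 4 * (24 / (T - t) ^+ 3) / n%:R.
Proof.
move=> cf t0 tT C0 n0 mom.
have T0 : 0 <= T := le_trans t0 (ltW tT).
have d0 : 0 < T - t by rewrite subr_gt0.
have n0' : 0 < n%:R :> R by rewrite ltr0n.
pose z s := expR (n%:R * (t - s)).
have cz : continuous z.
  move=> s; apply: (@continuous_comp _ _ _ (fun s => n%:R * (t - s)) expR); last exact: continuous_expR.
  by apply: cvgM; [exact: cvg_cst|apply: cvgB; [exact: cvg_cst|exact: cvg_id]].
have ck k : continuous (fun s => expR (k%:R * (T - s))).
  move=> s; apply: (@continuous_comp _ _ _ (fun s => k%:R * (T - s)) expR); last exact: continuous_expR.
  by apply: cvgM; [exact: cvg_cst|apply: cvgB; [exact: cvg_cst|exact: cvg_id]].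
pose S K s := 1 - series (exp_coeff (- z s)) K.+1.
pose wt (k : nat) : R := - ((-1) ^+ k.+1 / (k.+1)`!%:R) * expR (- ((k.+1)%:R * n%:R * (T - t))).
have SE K s : S K s = \sum_(k < K) wt k * expR ((k.+1 * n)%:R * (T - s)).
  rewrite /S /series /= big_nat_recl//= {1}/exp_coeff /= expr0 fact0 divr1.
  rewrite opprD addrA subrr add0r big_mkord -sumrN; apply: eq_bigr => k _.
  rewrite /exp_coeff /= exprNn /z -expRM_natl /wt -!mulrA -expRD natrM mulNr.
  rewrite (_ : - _ + _ = k.+1%:R * (n%:R * (t - s))); last by ring.
  by rewrite mulrA mulrAC.
have iS k : mu.-integrable `[0, T] (EFin \o (fun s => wt k * (expR ((k.+1 * n)%:R * (T - s)) * f s))).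
  apply: continuous_integrable => s; apply: cvgM; first exact: cvg_cst.
  by apply: cvgM; [exact: ck|exact: cf].
have cS K : continuous (S K).
  rewrite (_ : S K = fun s => \sum_(k < K) wt k * expR ((k.+1 * n)%:R * (T - s))).
    by apply: (@continuous_sum (fun k s => wt k * expR ((k.+1 * n)%:R * (T - s)))) => k s;
      apply: cvgM; [exact: cvg_cst|exact: ck].
  by apply/funext => s; rewrite SE.
have intS K : \int[mu]_(s in `[0, T]) (S K s * f s) =
    \sum_(k < K) wt k * \int[mu]_(s in `[0, T]) (expR ((k.+1 * n)%:R * (T - s)) * f s).
  under eq_Rintegral do rewrite SE mulr_suml.
  elim: K => [|K IH].
    rewrite big_ord0; under eq_Rintegral do rewrite big_ord0.
    by rewrite Rintegral_cst// mul0r.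
  rewrite big_ord_recr /= -IH -RintegralZl//; last first.
    apply: continuous_integrable => s.
    by apply: cvgM; [exact: ck|exact: cf].
  rewrite -RintegralD//.
    by apply: eq_Rintegral => s _; rewrite big_ord_recr /= -mulrA.
  apply: continuous_integrable.
  apply: (@continuous_sum (fun k s => wt k * expR ((k.+1 * n)%:R * (T - s)) * f s)) => k s.
  apply: cvgM; last exact: cf.
  by apply: cvgM; [exact: cvg_cst|exact: ck].
pose e0 := expR (- (n%:R * (T - t))).
have e0_gt0 : 0 < e0 by exact: expR_gt0.
have wtle (k : nat) : `|wt k| * (1 + (k.+1 * n)%:R) ^+ 2 <=
    4 * n%:R ^+ 2 * e0 * exp_coeff 4 k.
  have k1 : (0:R) < (k.+1)`!%:R by rewrite ltr0n fact_gt0.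
  have wk : `|wt k| <= e0 / (k.+1)`!%:R.
    rewrite /wt normrM normrN normrM normrX normrN1 expr1n mul1r normfV (gtr0_norm k1).
    rewrite (gtr0_norm (expR_gt0 _)) mulrC ler_pM2r ?invr_gt0// ler_expR lerN2.
    by rewrite ler_wpM2r ?(ltW d0)// ler_peMl ?ler1n// ler0n.
  have k2 : (1 + (k.+1 * n)%:R : R) <= 2 * n%:R * k.+1%:R.
    have : (1 + k.+1 * n <= 2 * n * k.+1)%N.
      by rewrite -mulnA mul2n -addnn [(n * _)%N]mulnC leq_add2r muln_gt0.
    by rewrite -(ler_nat R) natrD !natrM.
  have k3 : (k.+1%:R ^+ 2 / (k.+1)`!%:R : R) <= exp_coeff 4 k.
    rewrite /exp_coeff /= factS natrM invfM mulrA expr2 mulfK ?pnatr_eq0//.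
    rewrite ler_pM2r ?invr_gt0 ?ltr0n ?fact_gt0//.
    rewrite -[4]/(4%:R) -natrX ler_nat.
    by apply: leq_trans (ltn_expl k (isT : 1 < 4)%N) _.
  apply: (le_trans (y := e0 / (k.+1)`!%:R * (2 * n%:R * k.+1%:R) ^+ 2)).
    apply: ler_pM => //.
    by rewrite ler_pXn2r// nnegrE ?addr_ge0// !mulr_ge0.
  have -> : e0 / (k.+1)`!%:R * (2 * n%:R * k.+1%:R) ^+ 2 =
    4 * n%:R ^+ 2 * e0 * (k.+1%:R ^+ 2 / (k.+1)`!%:R) :> R.
    by field; rewrite lt0r_neq0.
  by rewrite ler_pM2l// mulr_gt0// mulr_gt0// exprn_gt0.
have e0le : 4 * n%:R ^+ 2 * e0 <= 24 / (T - t) ^+ 3 / n%:R.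
  have := @expR_cube_ge (n%:R * (T - t)) (mulr_ge0 (ltW n0') (ltW d0)).
  rewrite exprMn => h.
  rewrite ler_pdivlMr// ler_pdivlMr ?exprn_gt0// /e0 expRN.
  have E1 : 0 < expR (n%:R * (T - t)) := expR_gt0 _.
  rewrite (_ : _ * n%:R * _ = 4 * (n%:R ^+ 3 * (T - t) ^+ 3) / expR (n%:R * (T - t))); last first.
    by field; rewrite lt0r_neq0.
  rewrite ler_pdivrMr//; lra.
have bS K : `|\int[mu]_(s in `[0, T]) (S K s * f s)| <=
    C * expR 4 * (24 / (T - t) ^+ 3) / n%:R.
  rewrite intS; apply: le_trans (ler_norm_sum _ _ _) _.
  apply: (le_trans (y := \sum_(k < K) (C * (4 * n%:R ^+ 2 * e0)) * exp_coeff 4 k)).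
    apply: ler_sum => k _; rewrite normrM.
    apply: le_trans (ler_wpM2l (normr_ge0 _) (mom _)) _.
    by rewrite mulrCA -mulrA ler_wpM2l.
  rewrite -mulr_sumr.
  have h := series_exp_coeff_le K (ler0n R 4); rewrite /series /= big_mkord in h.
  rewrite (_ : C * expR 4 * (24 / (T - t) ^+ 3) / n%:R =
     C * (24 / (T - t) ^+ 3 / n%:R) * expR 4); last by ring.
  apply: ler_pM => //.
  - by rewrite mulr_ge0// mulr_ge0 ?(ltW e0_gt0)// mulr_ge0// exprn_ge0.
  - by apply: sumr_ge0 => i _; exact: exp_coeff_ge0.
  - exact: ler_wpM2l.
pose Z := expR (n%:R * t).
have lim : \int[mu]_(s in `[0, T]) (S K s * f s) @[K --> \oo] -->
    \int[mu]_(s in `[0, T]) ((1 - expR (- z s)) * f s).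
  apply: (@Rintegral_dominated_cvg _ _ _ _ (fun s => (1 + expR Z) * `|f s|)).
  - move=> K; apply: measurable_funTS; apply: continuous_measurable_fun => s.
    by apply: cvgM; [exact: cS|exact: cf].
  - apply: measurable_funTS; apply: continuous_measurable_fun => s.
    apply: cvgM; last exact: cf.
    apply: cvgB; first exact: cvg_cst.
    apply: (@continuous_comp _ _ _ (fun s => - z s) expR); last exact: continuous_expR.
    by apply: cvgN; exact: cz.
  - move=> s _; apply: cvgM; last exact: cvg_cst.
    apply: cvgB; first exact: cvg_cst.
    have := is_cvg_series_exp_coeff (- z s); rewrite -[limn _]/(expR (- z s)) => h.
    by move: (h); rewrite -(cvg_shiftS (series _)).
  - apply: continuous_integrable => s; apply: cvgM; first exact: cvg_cst.
    by apply: cvg_norm; exact: cf.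
  - move=> K s /andP[s0 _]; rewrite normrM ler_wpM2r//.
    apply: le_trans (ler_normB _ _) _; rewrite normr1 lerD2l.
    apply: le_trans (norm_series_exp_coeff_le _ _) _.
    rewrite normrN (gtr0_norm (expR_gt0 _)) ler_expR /z /Z ler_expR.
    by rewrite ler_wpM2l ?(ltW n0')// gerBl.
have limn := cvg_norm lim.
by apply: (cvgr_to_le (limn _)); apply: nearW => K; exact: bS.
Qed.

Lemma Rintegral_norm_le_integral f g (a b : R) : continuous f -> continuous g ->
  (forall x, a <= x <= b -> `|f x| <= g x) ->
  `|\int[mu]_(x in `[a, b]) f x| <= \int[mu]_(x in `[a, b]) g x.
Proof.
move=> cf cg fg; apply: (le_trans (le_normr_Rintegral _ (continuous_integrable _ _ cf))) => //.
apply: le_Rintegral => //=.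
- by apply: integrable_norm => //; exact: continuous_integrable.
- exact: continuous_integrable.
Qed.

Lemma one_sub_exp_step t s (n : R) : 0 < n ->
  (s <= t -> expR (- expR (n * (t - s))) <= expR (n * (s - t))) /\
  (t <= s -> `|1 - expR (- expR (n * (t - s)))| <= expR (n * (t - s))).
Proof.
move=> n0; split=> st.
  rewrite ler_expR -(opprB t s) mulrN lerN2.
  by apply: le_trans (expR_ge1Dx _); lra.
have h := expR_ge1Dx (- expR (n * (t - s))).
have h2 : expR (- expR (n * (t - s))) <= 1 by rewrite -expR0 ler_expR oppr_le0 expR_ge0.
by rewrite ger0_norm ?subr_ge0//; lra.
Qed.

Lemma integral_exp_linear (n u a b : R) : 0 < n -> a <= b ->
  \int[mu]_(s in `[a, b]) expR (n * (s - u)) = (expR (n * (b - u)) - expR (n * (a - u))) / n.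
Proof.
move=> n0 ab.
have d (x : R) : is_derive (x : R) 1 (fun s : R => expR (n * (s - u)) / n) (expR (n * (x - u))).
  have d0 : is_derive (x : R) 1 (fun s : R => s - u) 1.
    have := is_deriveB (is_derive_id (x : R) 1) (is_derive_cst u (x : R) 1).
    by apply: is_derive_eqr; rewrite subr0.
  have d1 := is_deriveZ n d0.
  have d2 := @is_derive1_comp _ expR (fun s => n * (s - u)) _ _ _ (is_derive_expR _) d1.
  have := is_deriveZ n^-1 d2.
  rewrite (_ : n^-1 \*: _ = fun s => expR (n * (s - u)) / n); last first.
    by apply/funext => y; rewrite /= /GRing.scale /= mulrC.
  by apply: is_derive_eqr; rewrite /GRing.scale /=; field; rewrite gt_eqF.
rewrite (integral_derivative ab d) ?mulrBl//.
move=> s; apply: (@continuous_comp _ _ _ (fun s => n * (s - u)) expR); last exact: continuous_expR.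
by apply: cvgM; [exact: cvg_cst|apply: cvgB; [exact: cvg_id|exact: cvg_cst]].
Qed.

(** As [n] grows the weights of [exp_moments_kernel] tend to the indicator of [s
    < t], with an error at most [expR (- n |t - s|)]. *)
Lemma exp_moments_integral_eq0 f T C :
  continuous f -> 0 <= C ->
  (forall k : nat, `|\int[mu]_(s in `[0, T]) (expR (k%:R * (T - s)) * f s)| <=
     C * (1 + k%:R) ^+ 2) ->
  forall t, 0 <= t -> t < T -> \int[mu]_(s in `[0, t]) f s = 0.
Proof.
move=> cf C0 mom t t0 tT.
have T0 : 0 <= T := le_trans t0 (ltW tT).
have cfn : continuous (fun s => `|f s|) by move=> s; apply: cvg_norm; exact: cf.
have [m _ fB] := @EVT_max _ (fun s => `|f s|) 0 T T0 (continuous_subspaceT cfn).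
set B := `|f m| in fB.
have B0 : 0 <= B by rewrite /B.
pose y (n : nat) s := expR (- expR (n%:R * (t - s))).
have cl (n u : R) : continuous (fun s : R => expR (n * (s - u))).
  move=> s; apply: (@continuous_comp _ _ _ (fun s => n * (s - u)) expR); last exact: continuous_expR.
  by apply: cvgM; [exact: cvg_cst|apply: cvgB; [exact: cvg_id|exact: cvg_cst]].
have cl' (n u : R) : continuous (fun s : R => expR (n * (u - s))).
  move=> s; apply: (@continuous_comp _ _ _ (fun s => n * (u - s)) expR); last exact: continuous_expR.
  by apply: cvgM; [exact: cvg_cst|apply: cvgB; [exact: cvg_cst|exact: cvg_id]].
have cy n : continuous (y n).
  move=> s; apply: (@continuous_comp _ _ _ (fun s => - expR (n%:R * (t - s))) expR); last exact: continuous_expR.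
  by apply: cvgN; exact: cl'.
have cyf n : continuous (fun s => y n s * f s).
  by move=> s; apply: cvgM; [exact: cy|exact: cf].
have c1yf n : continuous (fun s => (1 - y n s) * f s).
  move=> s; apply: cvgM; last exact: cf.
  by apply: cvgB; [exact: cvg_cst|exact: cy].
pose K := C * expR 4 * (24 / (T - t) ^+ 3) + 2 * B.
apply: (@cvg_le_harmonic_eq0 _ (fun=> \int[mu]_(s in `[0, t]) f s) _ K); first exact: cvg_cst.
move=> k; set n := k.+1; have n0 : (0 : R) < n%:R by rewrite ltr0n.
have h1 := @exp_moments_kernel f T t C n cf t0 tT C0 isT mom.
rewrite -/(y n) in h1.
have e1 : \int[mu]_(s in `[0, T]) ((1 - y n s) * f s) =
   \int[mu]_(s in `[0, t]) f s - \int[mu]_(s in `[0, t]) (y n s * f s) +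
   \int[mu]_(s in `[t, T]) ((1 - y n s) * f s).
  rewrite (@Rintegral_split _ (fun s => (1 - y n s) * f s) 0 t T)//; [|exact: ltW|exact: continuous_integrable].
  congr (_ + _); rewrite -RintegralB//; [|exact: continuous_integrable..].
  by apply: eq_Rintegral => s _; rewrite mulrBl mul1r.
have e2 : `|\int[mu]_(s in `[0, t]) (y n s * f s)| <= B / n%:R.
  apply: (le_trans (@Rintegral_norm_le_integral _ (fun s => B * expR (n%:R * (s - t))) _ _ (cyf n) _ _)).
  - by move=> s; apply: cvgM; [exact: cvg_cst|exact: cl].
  - move=> s /andP[s0 st]; rewrite normrM (gtr0_norm (expR_gt0 _)) mulrC.
    apply: ler_pM => //.
      by apply: fB; rewrite in_itv /= s0 (le_trans st)// ltW.
    by have [+ _] := one_sub_exp_step t s n0; apply.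
  rewrite RintegralZl//; last exact: (continuous_integrable _ _ (cl _ _)).
  rewrite integral_exp_linear// ler_wpM2l// subrr mulr0 expR0 ler_pdivrMr// mulVf ?gt_eqF//.
have e3 : `|\int[mu]_(s in `[t, T]) ((1 - y n s) * f s)| <= B / n%:R.
  apply: (le_trans (@Rintegral_norm_le_integral _ (fun s => B * expR (n%:R * (t - s))) _ _ (c1yf n) _ _)).
  - by move=> s; apply: cvgM; [exact: cvg_cst|exact: cl'].
  - move=> s /andP[ts sT]; rewrite normrM mulrC.
    apply: ler_pM => //.
      by apply: fB; rewrite in_itv /= sT (le_trans t0 ts).
    by have [_ +] := one_sub_exp_step t s n0; apply.
  rewrite RintegralZl//; last exact: (continuous_integrable _ _ (cl' _ _)).
  rewrite ler_wpM2l//.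
  have d (x : R) : is_derive (x : R) 1 (fun s : R => - (expR (n%:R * (t - s)) / n%:R)) (expR (n%:R * (t - x))).
    have d0 : is_derive (x : R) 1 (fun s : R => t - s) (-1).
      have := is_deriveB (is_derive_cst t (x : R) 1) (is_derive_id (x : R) 1).
      by apply: is_derive_eqr; rewrite sub0r.
    have d1 := is_deriveZ n%:R d0.
    have d2 := @is_derive1_comp _ expR (fun s => n%:R * (t - s)) _ _ _ (is_derive_expR _) d1.
    have := is_deriveZ (- n%:R^-1) d2.
    rewrite (_ : _ \*: _ = fun s => - (expR (n%:R * (t - s)) / n%:R)); last first.
      by apply/funext => z; rewrite /= /GRing.scale /= mulrC mulrN.
    by apply: is_derive_eqr; rewrite /GRing.scale /=; field; rewrite gt_eqF.
  rewrite (integral_derivative (ltW tT) d (cl' _ _)) subrr mulr0 expR0 opprK mul1r addrC.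
  by rewrite gerBl divr_ge0 ?expR_ge0// ltW.
rewrite e1 in h1.
rewrite (_ : K / n%:R = C * expR 4 * (24 / (T - t) ^+ 3) / n%:R + (B / n%:R + B / n%:R)); last by rewrite /K; ring.
set I := Rintegral _ _ _ in h1 e1 *.
set J1 := Rintegral _ _ _ in h1 e2; set J2 := Rintegral _ _ _ in h1 e3.
have -> : I = (I - J1 + J2) + J1 - J2 by ring.
apply: le_trans (ler_normB _ _) _.
have := ler_normD (I - J1 + J2) J1; lra.
Qed.

End ExponentialMoments.

(** * Uniqueness for the Cauchy problem *)

Section OneSidedDerivative.
Context {R : realType}.
Implicit Types (f : R -> R) (t l : R).

Lemma is_derive_quotient f t l : is_derive t 1 f l <->
  (s - t)^-1 * (f s - f t) @[s --> t^'] --> l.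
Proof.
have E : ((s - t)^-1 * (f s - f t) @[s --> t^'] --> l) <->
  (h^-1 *: ((f \o shift t) (h *: (1 : R)) - f t) @[h --> 0^'] --> l).
  split=> /cvgrPdist_le H; apply/cvgrPdist_le => e e0; have := H e e0;
    rewrite !near_withinE.
    move=> H1; have {}H1 : \forall s \near t, s != t ->
      `|l - (s - t)^-1 * (f s - f t)| <= e by [].
    suff : \forall h \near 0, h != 0 ->
      `|l - h^-1 *: ((f \o shift t) (h *: (1 : R)) - f t)| <= e by [].
    move: H1; rewrite (near_shift 0 t) /= subr0; apply: filterS => h /= ht h0.
    by have := ht _; rewrite addrK -[h%:A]/(h * 1) mulr1; apply; rewrite -subr_eq0 addrK.
  move=> H1; have {}H1 : \forall h \near 0, h != 0 ->
      `|l - h^-1 *: ((f \o shift t) (h *: (1 : R)) - f t)| <= e by [].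
  suff : \forall s \near t, s != t ->
      `|l - (s - t)^-1 * (f s - f t)| <= e by [].
  move: H1; rewrite (near_shift t 0) /= sub0r; apply: filterS => s /= ht h0.
  by have := ht _; rewrite -[(s - t)%:A]/((s - t) * 1) mulr1 subrK; apply; rewrite subr_eq0.
apply: iff_sym; apply: (iff_trans E); split=> [h|[d <-]].
  apply: DeriveDef; first by apply/cvg_ex; exists l.
  exact: (cvg_lim (@Rhausdorff R) h).
exact: d.
Qed.

(** Extending a curve on the closed half-line by zero keeps it differentiable
    when its value and its derivative vanish at the origin, so that two-sided
    calculus applies to it. *)
Definition zero_extension f : R -> R := fun t => if 0 <= t then f t else 0.

Lemma zero_extension_derive f f1 :
  (forall t, 0 <= t ->
    (s - t)^-1 * (f s - f t) @[s --> within [set s | 0 <= s] t^'] --> f1 t) ->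
  f 0 = 0 -> f1 0 = 0 ->
  forall t, is_derive t 1 (zero_extension f) (zero_extension f1 t).
Proof.
move=> df f0 f10 t; apply/is_derive_quotient; rewrite /zero_extension.
case: (ltP t 0) => t0.
  apply/cvgrPdist_le => e e0; rewrite near_withinE.
  have : \forall s \near t, s < 0 by exact: lt_nbhsl.
  by apply: filterS => s s0 _; rewrite (lt_geF s0) subrr mulr0 subrr normr0 ltW.
apply/cvgrPdist_le => e e0; have /cvgrPdist_le/(_ e e0) := df t t0.
rewrite !near_withinE => H.
move: t0; rewrite le_eqVlt => /predU1P[t0|t0].
  subst t; apply: filterS H => s H s0; have := H s0.
  rewrite f0 f10 !subr0 !sub0r; case: (leP 0 s) => s1 h; first exact: h.
  by rewrite mulr0 oppr0 normr0 ltW.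
have : \forall s \near t, 0 < s by exact: lt_nbhsr.
by move=> H1; apply: filterS2 H1 H => s s1 H st; have := H st; rewrite (ltW s1) /=; apply; exact: ltW.
Qed.

End OneSidedDerivative.

Section RealUniqueness.
Context {R : realType}.
Notation mu := (@lebesgue_measure R).

(** Variation of constants run backwards: with
    [H t = expR (- y t) (a1 t + y a t)] the equation [a'' = y^2 a - w] gives
    [H' = - expR (- y t) w], so the exponential moments of [w'] grow only
    polynomially in [y]. *)
Lemma resolvent_family_eq0 (w w1 : R -> R) (a a1 : nat -> R -> R) :
  (forall t : R, is_derive t 1 w (w1 t)) -> continuous w1 ->
  (forall n (t : R), is_derive t 1 (a n) (a1 n t)) ->
  (forall n (t : R), is_derive t 1 (a1 n) (n%:R ^+ 2 * a n t - w t)) ->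
  w 0 = 0 -> (forall n, a n 0 = 0) -> (forall n, a1 n 0 = 0) ->
  (forall t, 0 <= t -> exists M, forall n, `|a n t| <= M) ->
  (forall t, 0 <= t -> exists M, forall n, `|a1 n t| <= M) ->
  forall t, 0 <= t -> w t = 0.
Proof.
move=> dw cw1 da da1 w0 a0 a10 ba ba1 t t0.
pose T := t + 1; have T0 : 0 <= T by rewrite addr_ge0.
have [Ma hMa] := ba T T0; have [Mb hMb] := ba1 T T0.
have Ma0 := le_trans (normr_ge0 _) (hMa 0%N); have Mb0 := le_trans (normr_ge0 _) (hMb 0%N).
pose C := Ma + Mb + `|w T|.
have mom (k : nat) : `|\int[mu]_(s in `[0, T]) (expR (k%:R * (T - s)) * w1 s)| <=
     C * (1 + k%:R) ^+ 2.
  pose y : R := k%:R.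
  pose H s := - (expR (y * (T - s)) * (y ^+ 2 * a k s - w s + y * a1 k s)).
  have dH (s : R) : is_derive s 1 H (expR (y * (T - s)) * w1 s).
    have d0 : is_derive s 1 (fun s : R => T - s) (-1).
      have := is_deriveB (is_derive_cst T s 1) (is_derive_id s 1).
      by apply: is_derive_eqr; rewrite sub0r.
    have d2 := @is_derive1_comp _ expR (fun s => y * (T - s)) _ _ _
      (is_derive_expR _) (is_deriveZ y d0).
    have d3 : is_derive s 1 (fun s : R => y ^+ 2 * a k s - w s + y * a1 k s)
        (y ^+ 2 * a1 k s - w1 s + y * (y ^+ 2 * a k s - w s)) :=
      is_deriveD (is_deriveB (is_deriveZ (y ^+ 2) (da k s)) (dw s)) (is_deriveZ y (da1 k s)).
    have := is_deriveN (is_deriveM d2 d3).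
    by apply: is_derive_eqr; rewrite /GRing.scale /=; ring.
  have cH : continuous (fun s => expR (y * (T - s)) * w1 s).
    move=> s; apply: cvgM; last exact: cw1.
    apply: (@continuous_comp _ _ _ (fun s => y * (T - s)) expR); last exact: continuous_expR.
    by apply: cvgM; [exact: cvg_cst|apply: cvgB; [exact: cvg_cst|exact: cvg_id]].
  have -> : \int[mu]_(s in `[0, T]) (expR (k%:R * (T - s)) * w1 s) = - (y ^+ 2 * a k T - w T + y * a1 k T).
    rewrite (integral_derivative T0 dH cH) /H w0 a0 a10.
    by rewrite !(mulr0, subr0, addr0, oppr0, subrr, expR0, mul1r).
  rewrite normrN.
  have y0 : 0 <= y by rewrite ler0n.
  apply: le_trans (ler_normD _ _) _; apply: le_trans (lerD (ler_normB _ _) (lexx _)) _.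
  have -> : `|y ^+ 2 * a k T| = y ^+ 2 * `|a k T|.
    by rewrite normrM; congr (_ * _); rewrite ger0_norm// sqr_ge0.
  have -> : `|y * a1 k T| = y * `|a1 k T| by rewrite normrM (ger0_norm y0).
  apply: (le_trans (lerD (lerD (ler_wpM2l (sqr_ge0 y) (hMa k)) (lexx _)) (ler_wpM2l y0 (hMb k)))).
  rewrite -/y /C.
  have w0' := normr_ge0 (w T).
  have h1 : y ^+ 2 <= (1 + y) ^+ 2 by nra.
  have h2 : 1 <= (1 + y) ^+ 2 by nra.
  have h3 : y <= (1 + y) ^+ 2 by nra.
  rewrite 2!mulrDl [y ^+ 2 * Ma]mulrC [y * Mb]mulrC addrAC.
  by rewrite !lerD ?ler_wpM2l// ler_peMr.
have C0 : 0 <= C by rewrite !addr_ge0.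
have h := exp_moments_integral_eq0 cw1 C0 mom t0.
have := h _; rewrite (integral_derivative t0 dw cw1) w0 subr0; apply.
by rewrite ltrDl.
Qed.

End RealUniqueness.

(** * The Klein-Gordon flow on the Fourier side *)

Section KGUniqueness.
Context {R : realType}.
Variables (c : R).
Hypothesis c0 : 0 < c.
Implicit Types (psi phi : R -> R[i]).

(** The Fourier multiplier of [- c^2 d^2/dx^2 + c^4]. *)
Definition KG_multiplier psi : R -> R[i] := fun x => (fKG c x ^+ 2)%:C * psi x.

Lemma KG_multiplier_schwartz psi : schwartz psi -> schwartz (KG_multiplier psi).
Proof.
move=> sp; rewrite (_ : KG_multiplier psi = fun x =>
  (c ^+ 4)%:C * psi x + (c ^+ 2)%:C * ((x ^+ 2)%:C * psi x)); last first.
  by apply/funext => x; rewrite /KG_multiplier fKG_sqr// rmorphD rmorphM /=; ring.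
by apply: schwartzD; [exact: schwartzZ|apply: schwartzZ; exact: schwartzX].
Qed.

(** [fKG] is written as its square times its inverse, because the inverse is a
    bounded multiplier whose derivative is of the form handled by [sfamM]. *)
Lemma sfam_fKG_mul (I : Type) (phi : I -> R -> R[i]) : sfam phi ->
  sfam (fun i p => (fKG c p)%:C * phi i p).
Proof.
move=> sp.
have s1 : sfam (fun i x => ((fKG c x)^-1)%:C * phi i x).
  apply: (sfamM (H := (c ^+ 2)^-1) (kappa := - c ^+ 2) (m := 3) _ _ sp) => _ x.
    rewrite gtr0_norm ?invr_gt0 ?fKG_gt0// lef_pV2 ?posrE ?exprn_gt0 ?fKG_gt0//.
    exact: fKG_ge.
  have F0 : fKG c x != 0 by rewrite gt_eqF// fKG_gt0.
  have := is_deriveV F0 (fKG_derive c0 x).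
  by apply: is_derive_eqr; rewrite /GRing.scale /=; field.
have := sfamD (sfamZ (c ^+ 4)%:C s1) (sfamZ (c ^+ 2)%:C (sfamX 2 s1)).
congr sfam; apply/funext => i; apply/funext => x.
have -> : (fKG c x)%:C = ((c ^+ 4)%:C + (c ^+ 2)%:C * (x ^+ 2)%:C) * ((fKG c x)^-1)%:C :> R[i].
  rewrite -!rmorphM -rmorphD -rmorphM -fKG_sqr//=; congr (_%:C).
  by rewrite expr2 mulfK// gt_eqF// fKG_gt0.
by ring.
Qed.

Lemma fKG_mul_schwartz psi : schwartz psi -> schwartz (fun x => (fKG c x)%:C * psi x).
Proof. by move=> /schwartz_sfam sp; apply/schwartz_sfam; exact: sfam_fKG_mul sp. Qed.

Definition resolvent (y x : R) : R := (fKG c x ^+ 2 + y ^+ 2)^-1.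

Lemma resolvent_gt0 y x : 0 < fKG c x ^+ 2 + y ^+ 2.
Proof. by rewrite ltr_pwDl ?sqr_ge0// exprn_gt0// fKG_gt0. Qed.

Lemma resolvent_sfam psi : schwartz psi ->
  sfam (fun (n : nat) x => (resolvent n%:R x)%:C * psi x).
Proof.
move=> sp; have sp' : sfam (fun _ : nat => psi).
  by move: sp => [d b]; split=> // k n; have [M hM] := b k n; exists M => _.
apply: (sfamM (H := (c ^+ 4)^-1) (kappa := - (2 * c ^+ 2)) (m := 2) _ _ sp') => n x.
  rewrite gtr0_norm ?invr_gt0 ?resolvent_gt0// lef_pV2 ?posrE ?exprn_gt0 ?resolvent_gt0//.
  by rewrite fKG_sqr// -addrA lerDl addr_ge0 ?sqr_ge0// mulr_ge0 ?sqr_ge0.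
pose q (x : R) := fKG c x ^+ 2 + n%:R ^+ 2.
have p0 : q x != 0 by rewrite gt_eqF// resolvent_gt0.
have d1 : is_derive x 1 q (2 * c ^+ 2 * x).
  have := is_deriveD (is_derive_pow 2 (fKG_derive c0 x)) (is_derive_cst (n%:R ^+ 2 : R) x 1).
  have F0 : fKG c x != 0 by rewrite gt_eqF// fKG_gt0.
  by apply: is_derive_eqr; rewrite /GRing.scale /=; field.
have := is_deriveV p0 d1.
by apply: is_derive_eqr; rewrite /GRing.scale /= /resolvent -/(q x); field.
Qed.

(** The resolvent inverts [fKG^2 + y^2]. *)
Lemma resolventK (y : R) psi :
  psi = fun x => (y ^+ 2)%:C * ((resolvent y x)%:C * psi x) +
                 KG_multiplier (fun x => (resolvent y x)%:C * psi x) x.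
Proof.
apply/funext => x; rewrite /KG_multiplier !mulrA -!rmorphM -mulrDl -rmorphD /=.
rewrite -mulrDl addrC [_ + y ^+ 2]addrC [y ^+ 2 + _]addrC mulfV ?gt_eqF ?resolvent_gt0//.
by rewrite mul1r.
Qed.

Definition flow_linear (W : R -> functional R) : Prop :=
  forall t, 0 <= t -> forall z phi psi, schwartz phi -> schwartz psi ->
    W t (fun x => z * phi x + psi x) = z * W t phi + W t psi.

Definition flow_bounded (W : R -> functional R) : Prop :=
  forall t, 0 <= t -> forall phi : nat -> R -> R[i], sfam phi ->
    exists M, forall n, cabs (W t (phi n)) <= M.

(** Applying the flow to the resolvents of [psi] gives the family required by
    [resolvent_family_eq0], since [W'' = - W \o KG_multiplier]. The real
    functional [P] stands for the real or the imaginary part. *)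
Lemma KG_flow_part_eq0 (P : R[i] -> R) (W W1 : R -> functional R) :
  (forall (r : R) z, P (r%:C * z) = r * P z) -> (forall z z', P (z + z') = P z + P z') ->
  (forall z, `|P z| <= cabs z) ->
  (forall V V1, dist_curve_derive V V1 -> forall psi, schwartz psi -> forall t, 0 <= t ->
    (s - t)^-1 * (P (V s psi) - P (V t psi)) @[s --> within [set s : R | 0 <= s] t^']
      --> P (V1 t psi)) ->
  flow_linear W -> flow_bounded W -> flow_bounded W1 ->
  dist_curve_derive W W1 ->
  dist_curve_derive W1 (fun t psi => - W t (KG_multiplier psi)) ->
  (forall psi, schwartz psi -> W 0 psi = 0) ->
  (forall psi, schwartz psi -> W1 0 psi = 0) ->
  forall t, 0 <= t -> forall psi, schwartz psi -> P (W t psi) = 0.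
Proof.
move=> PZ PD Pc Pd Wl Wb W1b dW dW1 W0 W10 t t0 psi sp.
have P0 : P 0 = 0 by rewrite -(mul0r 0) -[0 in LHS]/(0%:C) PZ mul0r.
have PN z : P (- z) = - P z by apply/eqP; rewrite -subr_eq0 opprK -PD addNr P0.
have dz phi : schwartz phi -> forall t : R, is_derive t 1
    (zero_extension (fun t => P (W t phi))) (zero_extension (fun t => P (W1 t phi)) t).
  move=> sphi; apply: zero_extension_derive; first exact: Pd.
  - by rewrite W0.
  - by rewrite W10.
have dz1 phi : schwartz phi -> forall t : R, is_derive t 1
    (zero_extension (fun t => P (W1 t phi)))
    (zero_extension (fun t => P (- W t (KG_multiplier phi))) t).
  move=> sphi; apply: (zero_extension_derive (f1 := fun t => P (- W t (KG_multiplier phi)))).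
  - exact: (Pd _ _ dW1).
  - by rewrite W10.
  - by rewrite W0 ?oppr0//; exact: KG_multiplier_schwartz.
pose psin (n : nat) x := (resolvent n%:R x)%:C * psi x.
have sn n : schwartz (psin n) := sfam_schwartz (resolvent_sfam sp) n.
have h := @resolvent_family_eq0 R
  (zero_extension (fun t => P (W t psi))) (zero_extension (fun t => P (W1 t psi)))
  (fun n => zero_extension (fun t => P (W t (psin n))))
  (fun n => zero_extension (fun t => P (W1 t (psin n)))) (dz _ sp).
have := h _ _ _ _ _ _ _ _ t t0; rewrite /zero_extension t0 /= lexx; apply.
- move=> x; apply: differentiable_continuous; apply/derivable1_diffP.
  by case: (dz1 _ sp x).
- by move=> n; exact: dz.
- move=> n s; have := dz1 _ (sn n) s; apply: is_derive_eqr.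
  rewrite /zero_extension; case: ifPn => s0; last by rewrite mulr0 subr0.
  rewrite [X in _ - P (W s X)](resolventK n%:R psi).
  rewrite (Wl s s0 _ _ _ (sn n) (KG_multiplier_schwartz (sn n))).
  by rewrite PD PZ PN; ring.
- by rewrite W0.
- by move=> n; rewrite W0.
- by move=> n; rewrite W10.
- move=> s s0; rewrite s0; have [M hM] := Wb s s0 _ (resolvent_sfam sp).
  by exists M => n; exact: le_trans (Pc _) (hM n).
- move=> s s0; rewrite s0; have [M hM] := W1b s s0 _ (resolvent_sfam sp).
  by exists M => n; exact: le_trans (Pc _) (hM n).
Qed.

Lemma KG_flow_eq0 (W W1 : R -> functional R) :
  flow_linear W -> flow_bounded W -> flow_bounded W1 ->
  dist_curve_derive W W1 ->
  dist_curve_derive W1 (fun t psi => - W t (KG_multiplier psi)) ->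
  (forall psi, schwartz psi -> W 0 psi = 0) ->
  (forall psi, schwartz psi -> W1 0 psi = 0) ->
  forall t, 0 <= t -> forall psi, schwartz psi -> W t psi = 0.
Proof.
move=> Wl Wb W1b dW dW1 W0 W10 t t0 psi sp; apply: complex_ext.
  apply: (@KG_flow_part_eq0 (@complex.Re R) W W1) => //.
  - by move=> r [a b] /=; rewrite mul0r subr0.
  - by move=> [a b] [a' b'].
  - exact: Re_le_cabs.
  - move=> V V1 dV phi sphi s s0; have [+ _] := dV phi sphi s s0.
  rewrite [X in (X @ _ --> _) -> _](_ : _ = fun y => (y - s)^-1 * (complex.Re (V y phi) - complex.Re (V s phi)))//.
  by apply/funext => y; case: (V y phi) => a b; case: (V s phi) => a' b' /=; rewrite mul0r subr0.
apply: (@KG_flow_part_eq0 (@complex.Im R) W W1) => //.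
- by move=> r [a b] /=; rewrite mul0r addr0.
- by move=> [a b] [a' b'].
- exact: Im_le_cabs.
- move=> V V1 dV phi sphi s s0; have [_ +] := dV phi sphi s s0.
  rewrite [X in (X @ _ --> _) -> _](_ : _ = fun y => (y - s)^-1 * (complex.Im (V y phi) - complex.Im (V s phi)))//.
  by apply/funext => y; case: (V y phi) => a b; case: (V s phi) => a' b' /=; rewrite mul0r addr0.
Qed.

End KGUniqueness.

Section KGRepresentation.
Context {R : realType}.
Variables (c : R).
Hypothesis c0 : 0 < c.
Notation mu := (@lebesgue_measure R).
Implicit Types (psi phi a : R -> R[i]) (s t : R).

Lemma fourierD z phi psi : schwartz phi -> schwartz psi ->
  fourier (fun x => z * phi x + psi x) = fun p => z * fourier phi p + fourier psi p.
Proof.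
move=> /schwartz_cintegrable i1 /schwartz_cintegrable i2; apply/funext => p.
rewrite !fourierE /ft -cintegralZ; last exact: cintegrable_kernel.
rewrite -cintegralD; [|exact: cintegrableZ (cintegrable_kernel _ _ i1)|exact: cintegrable_kernel].
by apply: eq_cintegral => x; ring.
Qed.

Lemma fourier_derive2 psi : schwartz psi ->
  cderive (cderive (fourier psi)) = fourier (fun x => - 1 * ((x ^+ 2)%:C * psi x)).
Proof.
move=> sp; have E phi : fourier phi = ft (- 1) phi by apply/funext => p; exact: fourierE.
have D phi : schwartz phi ->
    cderive (ft (- 1) phi) = ft (- 1) (fun x => 'i%C * (- 1)%:C * (x%:C * phi x)).
  by move=> sphi; have [] := cis_deriveE (fun p => ft_derivative (-1) p sphi).
rewrite !E D// D; last by apply: schwartzZ; exact: (schwartzX 1).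
congr (ft (- 1)); apply/funext => x.
have i2 : 'i%C * 'i%C = -1 :> R[i] by rewrite -expr2 sqr_i.
by rewrite rmorphN rmorph1 rmorphXn /=; ring: i2.
Qed.

Lemma fourier_KG_multiplier psi : schwartz psi ->
  fourier (KG_multiplier c psi) = fun p =>
    (c ^+ 4)%:C * fourier psi p + - (c ^+ 2)%:C * cderive (cderive (fourier psi)) p.
Proof.
move=> sp; rewrite fourier_derive2//.
have s2 := schwartzX 2 sp; have s4 : schwartz (fun x => (c ^+ 2)%:C * ((x ^+ 2)%:C * psi x)).
  exact: schwartzZ.
rewrite (_ : KG_multiplier c psi = fun x =>
  (c ^+ 4)%:C * psi x + (c ^+ 2)%:C * ((x ^+ 2)%:C * psi x)); last first.
  by apply/funext => x; rewrite /KG_multiplier fKG_sqr// rmorphD rmorphM /=; ring.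
rewrite fourierD//; apply/funext => p; congr (_ + _).
rewrite !fourierE /ft -!cintegralZ; last first.
  by apply: cintegrable_kernel; apply: schwartz_cintegrable; exact: schwartzZ.
by apply: eq_cintegral => x; ring.
Qed.

Lemma cis_derive_quotient (f : R -> R[i]) t l : cis_derive f t l ->
  ccvg (within [set s : R | 0 <= s] t^') (fun s => ((s - t)^-1)%:C * (f s - f t)) l.
Proof.
move=> [/is_derive_quotient d1 /is_derive_quotient d2]; split; apply: cvg_within_filter.
  rewrite (_ : (fun x => _) = fun s => (s - t)^-1 * (complex.Re (f s) - complex.Re (f t)))//.
  by apply/funext => s; case: (f s) => p q; case: (f t) => p' q' /=; rewrite mul0r subr0.
rewrite (_ : (fun x => _) = fun s => (s - t)^-1 * (complex.Im (f s) - complex.Im (f t)))//.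
by apply/funext => s; case: (f s) => p q; case: (f t) => p' q' /=; rewrite mul0r addr0.
Qed.

Lemma dist_curve_deriveB (V V1 W W1 : R -> functional R) :
  dist_curve_derive V V1 -> dist_curve_derive W W1 ->
  dist_curve_derive (fun t phi => V t phi - W t phi) (fun t phi => V1 t phi - W1 t phi).
Proof.
move=> dV dW phi sphi t t0; have [v1 v2] := dV phi sphi t t0.
have [w1 w2] := dW phi sphi t t0; split.
  rewrite cReD cReN; rewrite [X in X @ _ --> _](_ : _ = fun s =>
     complex.Re (((s - t)^-1)%:C * (V s phi - V t phi)) -
     complex.Re (((s - t)^-1)%:C * (W s phi - W t phi))); first exact: cvgB.
  by apply/funext => s; rewrite -cReN -cReD; congr complex.Re; ring.
rewrite cImD cImN; rewrite [X in X @ _ --> _](_ : _ = fun s =>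
   complex.Im (((s - t)^-1)%:C * (V s phi - V t phi)) -
   complex.Im (((s - t)^-1)%:C * (W s phi - W t phi))); first exact: cvgB.
by apply/funext => s; rewrite -cImN -cImD; congr complex.Im; ring.
Qed.

Definition half_wave s a t : functional R := fun psi =>
  cintegral (fun p => a p * psi p * expi (t * (s * fKG c p))).

Section HalfWave.
Variables (s : R) (a : R -> R[i]).
Hypothesis ia : cintegrable a.

Let cmeas_phase t : cmeas (fun p => expi (t * (s * fKG c p))).
Proof.
apply: cmeas_expi; apply: measurable_funM; first exact: measurable_cst.
apply: measurable_funM; first exact: measurable_cst.
exact: continuous_measurable_fun (fKG_continuous c0).
Qed.

Lemma cintegrable_mul_schwartz psi : schwartz psi -> cintegrable (fun p => a p * psi p).
Proof.
move=> sp; have [_ b] := sp; have [M hM] := b 0%N 0%N.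
apply: (cintegrableM_bounded (M := M) ia); first exact: cmeas_integrable (schwartz_cintegrable sp).
by move=> x; have := hM x; rewrite expr0 mul1r.
Qed.

Lemma cintegrable_half_wave t psi : schwartz psi ->
  cintegrable (fun p => a p * psi p * expi (t * (s * fKG c p))).
Proof.
move=> sp; apply: (cintegrableM_bounded (M := 1) (cintegrable_mul_schwartz sp)) => // x.
by rewrite cabs_expi.
Qed.

Lemma half_waveD t z phi psi : schwartz phi -> schwartz psi ->
  half_wave s a t (fun x => z * phi x + psi x) = z * half_wave s a t phi + half_wave s a t psi.
Proof.
move=> s1 s2; rewrite /half_wave -cintegralZ; last exact: cintegrable_half_wave.
rewrite -cintegralD; [|exact: cintegrableZ (cintegrable_half_wave _ s1)|exact: cintegrable_half_wave].
by apply: eq_cintegral => x; ring.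
Qed.

Lemma half_wave0 psi : half_wave s a 0 psi = cintegral (fun p => a p * psi p).
Proof. by apply: eq_cintegral => p; rewrite mul0r expi0 mulr1. Qed.

Lemma half_wave_bounded t (phi : nat -> R -> R[i]) : sfam phi ->
  exists M, forall n, cabs (half_wave s a t (phi n)) <= M.
Proof.
move=> sp; have [M hM] := (sfam_rapid sp) 0%N.
have iM : mu.-integrable setT (EFin \o (fun x => M * cabs (a x))).
  by under [_ \o _]eq_fun do rewrite /= EFinM; apply: integrableZl => //; exact: integrable_cabs.
exists (2 * \int[mu]_x (M * cabs (a x))) => n.
apply: cabs_cintegral_le => //.
  by apply: cintegrable_half_wave; exact: (sfam_schwartz sp).
move=> x; rewrite !cabsM cabs_expi mulr1 mulrC ler_wpM2r ?cabs_ge0//.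
by have := hM n x; rewrite expr0 mul1r.
Qed.

Lemma half_wave_derive psi t : schwartz psi ->
  cis_derive (fun t => half_wave s a t psi) t
    (half_wave s a t (fun p => 'i%C * s%:C * ((fKG c p)%:C * psi p))).
Proof.
move=> sp; have sf := fKG_mul_schwartz c0 sp.
have h := @cis_derive_oscillatory R (fun p => a p * psi p) (fun p => s * fKG c p) _ _ _ t.
apply: cis_derive_eq (h _ _ _).
- by apply: eq_cintegral => p; rewrite rmorphM /=; ring.
- apply: measurable_funM; first exact: measurable_cst.
  exact: continuous_measurable_fun (fKG_continuous c0).
- exact: cintegrable_mul_schwartz.
- have := cintegrable_mul_schwartz (schwartzZ s%:C sf).
  by congr cintegrable; apply/funext => p; rewrite rmorphM /=; ring.
Qed.

End HalfWave.

Definition KG_flow (ap am : R -> R[i]) t : functional R := fun psi =>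
  half_wave (-1) ap t psi + half_wave 1 am t psi.

Definition KG_flow_derivative (ap am : R -> R[i]) t : functional R := fun psi =>
  half_wave (-1) ap t (fun p => 'i%C * (-1)%:C * ((fKG c p)%:C * psi p)) +
  half_wave 1 am t (fun p => 'i%C * 1%:C * ((fKG c p)%:C * psi p)).

Lemma tempered_lin (w : functional R) z z' phi psi : tempered w ->
  schwartz phi -> schwartz psi ->
  w (fun x => z * phi x + z' * psi x) = z * w phi + z' * w psi.
Proof.
move=> [wl _] s1 s2; rewrite wl//; last exact: schwartzZ.
congr (_ + _); rewrite (_ : (fun x => z' * psi x) = fun x => (z' - 1) * psi x + psi x).
  by rewrite wl//; ring.
by apply/funext => x; ring.
Qed.

(** On the Fourier side the Klein-Gordon equation is the family of oscillators
    [y'' = - (fKG p)^2 y], and the two phases solve it with the data encoded in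
    [a_plus] and [a_minus]; uniqueness identifies the solution with them. *)
Lemma KG_solution_flow (u0 v0 : functional R) (u : R -> functional R) (ap am : R -> R[i]) :
  tempered v0 ->
  regular (a_plus c u0 v0) ap -> cintegrable ap ->
  regular (a_minus c u0 v0) am -> cintegrable am ->
  KG_solution c u0 v0 u ->
  forall t, 0 <= t -> forall psi, schwartz psi ->
    u t (fourier psi) = KG_flow ap am t psi.
Proof.
move=> tv0 rp ip rm im [du [ddu [[tu tdu tddu] [[d1 d2 _] [pde ini]]]]] t t0 psi sp.
pose U s phi := u s (fourier phi); pose U1 s phi := du s (fourier phi).
apply/eqP; rewrite -subr_eq0; apply/eqP.
apply: (@KG_flow_eq0 R c c0 (fun s phi => U s phi - KG_flow ap am s phi)
  (fun s phi => U1 s phi - KG_flow_derivative ap am s phi)) => //.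
- move=> s s0 z phi phi' s1 s2.
  rewrite /U fourierD// (tu s s0).1 ?fourier_schwartz//; try exact: fourier_schwartz.
  by rewrite /KG_flow !half_waveD//; ring.
- move=> s s0 phi sphi.
  have [M1 h1] := tempered_sfam_bounded (tu s s0) (fourier_sfam sphi).
  have [M2 h2] := half_wave_bounded (-1) ip s sphi.
  have [M3 h3] := half_wave_bounded 1 im s sphi.
  exists (M1 + (M2 + M3)) => n; apply: le_trans (cabsD _ _) _; apply: lerD; first exact: h1.
  by rewrite cabsN; apply: le_trans (cabsD _ _) _; exact: lerD.
- move=> s s0 phi sphi.
  have [M1 h1] := tempered_sfam_bounded (tdu s s0) (fourier_sfam sphi).
  have [M2 h2] := half_wave_bounded (-1) ip s (sfamZ ('i%C * (-1)%:C) (sfam_fKG_mul c0 sphi)).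
  have [M3 h3] := half_wave_bounded 1 im s (sfamZ ('i%C * 1%:C) (sfam_fKG_mul c0 sphi)).
  exists (M1 + (M2 + M3)) => n; apply: le_trans (cabsD _ _) _; apply: lerD; first exact: h1.
  by rewrite cabsN; apply: le_trans (cabsD _ _) _; exact: lerD.
- apply: dist_curve_deriveB => phi sphi s s0.
    exact: d1 (fourier_schwartz sphi) _ s0.
  apply: (@cis_derive_quotient (fun s => KG_flow ap am s phi)).
  by apply: cis_deriveD; exact: half_wave_derive.
- have E s phi : 0 <= s -> schwartz phi ->
     - (U s (KG_multiplier c phi) - KG_flow ap am s (KG_multiplier c phi)) =
     ddu s (fourier phi) - (half_wave (-1) ap s (fun p => 'i%C * (-1)%:C * ((fKG c p)%:C *
         ('i%C * (-1)%:C * ((fKG c p)%:C * phi p)))) +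
       half_wave 1 am s (fun p => 'i%C * 1%:C * ((fKG c p)%:C *
         ('i%C * 1%:C * ((fKG c p)%:C * phi p))))).
    move=> s0 sphi; have sf := fourier_schwartz sphi.
    have sm := KG_multiplier_schwartz c0 sphi.
    have i2 : 'i%C * 'i%C = -1 :> R[i] by rewrite -expr2 sqr_i.
    have EN sg b : sg ^+ 2 = 1 -> cintegrable b -> half_wave sg b s (fun p => 'i%C * sg%:C * ((fKG c p)%:C *
         ('i%C * sg%:C * ((fKG c p)%:C * phi p)))) = - half_wave sg b s (KG_multiplier c phi).
      move=> sg1 ib; rewrite -mulN1r /half_wave -cintegralZ; last exact: cintegrable_half_wave.
      apply: eq_cintegral => p; rewrite /KG_multiplier rmorphXn /=.
      have sg2 : (sg%:C) ^+ 2 = 1 :> R[i] by rewrite -rmorphXn sg1.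
      by ring: i2 sg2.
    have := pde s s0 _ sf; rewrite /dderive opprK => pdes.
    rewrite !EN ?sqrrN ?expr1n// /KG_flow /U fourier_KG_multiplier//.
    rewrite (tempered_lin _ _ (tu s s0))//; last by do 2 apply: schwartz_derive.
    have -> : ddu s (fourier phi) = (c ^+ 2)%:C * u s (cderive (cderive (fourier phi))) - (c ^+ 4)%:C * u s (fourier phi).
      by apply/eqP; rewrite -subr_eq0 -pdes; apply/eqP; ring.
    by ring.
  move=> phi sphi s s0.
  have := @dist_curve_deriveB U1 (fun s phi => ddu s (fourier phi)) (KG_flow_derivative ap am)
   (fun s phi => half_wave (-1) ap s (fun p => 'i%C * (-1)%:C * ((fKG c p)%:C *
         ('i%C * (-1)%:C * ((fKG c p)%:C * phi p)))) +
       half_wave 1 am s (fun p => 'i%C * 1%:C * ((fKG c p)%:C *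
         ('i%C * 1%:C * ((fKG c p)%:C * phi p))))) _ _ phi sphi s s0.
  rewrite -E//; apply.
    by move=> f sf r r0; exact: d2 (fourier_schwartz sf) _ r0.
  move=> f sf r r0; apply: (@cis_derive_quotient (fun s => KG_flow_derivative ap am s f)).
  by apply: cis_deriveD; apply: half_wave_derive => //; apply: schwartzZ; exact: fKG_mul_schwartz.
- move=> phi sphi; rewrite /U /KG_flow !half_wave0 (ini _ (fourier_schwartz sphi)).1.
  have [_ <-] := rp _ sphi; have [_ <-] := rm _ sphi.
  rewrite /a_plus /a_minus /dfourier; set B := dmul _ _ _; by field.
- move=> phi sphi; rewrite /U1 /KG_flow_derivative !half_wave0 (ini _ (fourier_schwartz sphi)).2.
  pose chi p := 'i%C * ((fKG c p)%:C * phi p).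
  have schi : schwartz chi by apply: schwartzZ; exact: fKG_mul_schwartz.
  have [i1 e1] := rp _ schi; have [i2 e2] := rm _ schi.
  rewrite (_ : cintegral (fun p => ap p * _) = - a_plus c u0 v0 chi); last first.
    rewrite e1 -[RHS]mulN1r -cintegralZ//; apply: eq_cintegral => p.
    by rewrite /chi rmorphN rmorph1; ring.
  rewrite (_ : cintegral (fun p => am p * _) = a_minus c u0 v0 chi); last first.
    by rewrite e2; apply: eq_cintegral => p; rewrite /chi rmorph1; ring.
  (* i^2 = -1 turns the division by fKG of a_plus and a_minus into v0 *)
  have -> : v0 (fourier phi) = - dmul (fun p => 'i%C / (fKG c p)%:C) (dfourier v0) chi.
    rewrite /dmul /dfourier.
    rewrite (_ : (fun x => _) = fun x => -2 * phi x + phi x); last first.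
      apply/funext => p; rewrite /chi.
      have F0 : (fKG c p)%:C != 0 :> R[i] by rewrite fmorph_eq0 gt_eqF// fKG_gt0.
      have i2' : 'i%C * 'i%C = -1 :> R[i] by rewrite -expr2 sqr_i.
      rewrite (_ : _ * _ = 'i%C * 'i%C * phi p); last by field.
      by rewrite i2'; ring.
    rewrite fourierD// tv0.1; try exact: fourier_schwartz.
    by ring.
  by rewrite /a_plus /a_minus; set B := dmul _ _ _; field.
Qed.

(** The solution tested with [phi] is the flow tested with the inverse transform
    of [phi], and the flow consists of integrable functions; transposing the
    inverse transform gives [uKG]. *)
Lemma KG_solution_regular (u0 v0 : functional R) (u : R -> functional R) (ap am : R -> R[i]) :
  tempered v0 ->
  regular (a_plus c u0 v0) ap -> cintegrable ap ->
  regular (a_minus c u0 v0) am -> cintegrable am ->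
  KG_solution c u0 v0 u ->
  forall t, 0 <= t -> regular (u t) (uKG c ap am t).
Proof.
move=> tv0 rp ip rm im sol t t0 phi sphi.
have iph s a : cintegrable a -> cintegrable (fun p => expi (t * (s * fKG c p)) * a p).
  move=> ia; have := @cintegrableM_bounded R a (fun p => expi (t * (s * fKG c p))) 1 ia.
  under [X in _ -> _ -> cintegrable X]eq_fun do rewrite mulrC; apply.
    apply: cmeas_expi; apply: measurable_funM; first exact: measurable_cst.
    apply: measurable_funM; first exact: measurable_cst.
    exact: continuous_measurable_fun (fKG_continuous c0).
  by move=> x; rewrite cabs_expi.
have [i1 e1] := fourierV_adjoint (iph (-1) _ ip) sphi.
have [i2 e2] := fourierV_adjoint (iph 1 _ im) sphi.
have E x : uKG c ap am t x * phi x =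
    fourierV (fun p => expi (t * (-1 * fKG c p)) * ap p) x * phi x +
    fourierV (fun p => expi (t * (1 * fKG c p)) * am p) x * phi x.
  rewrite -mulrDl; congr (_ * _); rewrite /uKG.
  rewrite (_ : (fun p => expi (- _) * ap p) = fun p => expi (t * (-1 * fKG c p)) * ap p); last first.
    by apply/funext => p; rewrite mulN1r mulrN.
  rewrite (_ : (fun p => expi _ * am p) = fun p => expi (t * (1 * fKG c p)) * am p)//.
  by apply/funext => p; rewrite mul1r.
split; first by under eq_fun do rewrite E; exact: cintegrableD.
rewrite (eq_cintegral E) cintegralD// e1 e2.
have sV := fourierV_schwartz sphi.
rewrite -{1}(fourierK sphi) (KG_solution_flow tv0 rp ip rm im sol)//.
by congr (_ + _); apply: eq_cintegral => p; ring.
Qed.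

End KGRepresentation.

(** * The exponent is determined by the distribution *)

Section Exponent.
Context {R : realType}.
Notation mu := (@lebesgue_measure R).

Lemma Rintegral_subset_le (F : R -> R) (a b : R) : (forall x, 0 <= F x) ->
  mu.-integrable setT (EFin \o F) ->
  \int[mu]_(x in `[a, b]) F x <= \int[mu]_x F x.
Proof.
move=> F0 iF; have iab : mu.-integrable `[a, b] (EFin \o F) by apply: integrableS iF.
rewrite /Rintegral fine_le//.
- exact: integrable_fin_num iab.
- exact: integrable_fin_num iF.
apply: ge0_subset_integral => //.
- by have /integrableP[] := iF.
- by move=> p _; rewrite lee_fin.
Qed.

(** Testing with [p^2 expR (- k^2 p^2)] as [k] grows isolates the behaviour of
    [h] near the origin: the part [|p| < eta] contributes at least a multiple of
    [k^-3], the rest is exponentially small. *)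
Lemma gaussian_test_absurd (h : R -> R) (e eta : R) : 0 < e -> 0 < eta ->
  (forall n : R, 0 < n ->
    mu.-integrable setT (EFin \o (fun p => h p * (p ^+ 2 * gaussian n p))) /\
    \int[mu]_p (h p * (p ^+ 2 * gaussian n p)) = 0) ->
  (forall p, 0 < `|p| -> `|p| < eta -> e <= h p) -> False.
Proof.
move=> e0 eta0 hn he.
have [i1 _] := hn 1 ltr01.
pose J := \int[mu]_p `|h p * (p ^+ 2 * gaussian 1 p)|.
have J0 : 0 <= J by apply: Rintegral_ge0 => x _.
have lower k : 0 < k -> k^-1 < eta -> 1 <= k ->
    e * expR (-1) / 8 <= J * expR (eta ^+ 2) * (2 / eta ^+ 4) / k.
  move=> k0 keta k1.
  have k20 : 0 < k ^+ 2 by rewrite exprn_gt0.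
  have k21 : 1 <= k ^+ 2 by rewrite expr_ge1// ltW.
  have [i2 e2] := hn _ k20.
  pose q := expR (- ((k ^+ 2 - 1) * eta ^+ 2)).
  have q0 : 0 < q by exact: expR_gt0.
  pose F p := h p * (p ^+ 2 * gaussian (k ^+ 2) p) + q * `|h p * (p ^+ 2 * gaussian 1 p)|.
  have iq : mu.-integrable setT (EFin \o (fun p => q * `|h p * (p ^+ 2 * gaussian 1 p)|)).
    by under [_ \o _]eq_fun do rewrite /= EFinM; apply: integrableZl => //; exact: integrable_norm i1.
  have iF : mu.-integrable setT (EFin \o F).
    by rewrite /F; under [_ \o _]eq_fun do rewrite /= EFinD; exact: integrableD.
  have eF : \int[mu]_p F p = q * J.
    by rewrite RintegralD// e2 add0r RintegralZl//; exact: integrable_norm.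
  have G0 (n p : R) : 0 <= p ^+ 2 * gaussian n p by rewrite mulr_ge0 ?sqr_ge0// ltW// gaussian_gt0.
  have F0 p : 0 <= F p.
    rewrite /F; case: (ltP `|p| eta) => pe.
      apply: addr_ge0; last by rewrite mulr_ge0// ltW.
      have [->|pn0] := eqVneq p 0; first by rewrite expr0n /= mul0r mulr0.
      have hp : 0 <= h p by apply: le_trans (ltW e0) (he _ _ pe); rewrite normr_gt0.
      exact: mulr_ge0 hp (G0 _ _).
    have E : gaussian (k ^+ 2) p <= q * gaussian 1 p.
      rewrite /gaussian /q -expRD ler_expR.
      have : eta ^+ 2 <= p ^+ 2.
        by rewrite -[leRHS]real_normK ?num_real// ler_pXn2r// nnegrE ltW.
      move=> pe2; rewrite (_ : - (k ^+ 2 * p ^+ 2) = - ((k ^+ 2 - 1) * p ^+ 2) - 1 * p ^+ 2); last by ring.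
      by rewrite lerD2r lerN2 ler_wpM2l// subr_ge0.
    have h1 : `|h p * (p ^+ 2 * gaussian (k ^+ 2) p)| <= q * `|h p * (p ^+ 2 * gaussian 1 p)|.
      rewrite (normrM (h p)) (ger0_norm (G0 _ _)) (normrM (h p)) (ger0_norm (G0 _ _)).
      by rewrite [leRHS]mulrCA; apply: ler_wpM2l => //; rewrite [leRHS]mulrCA; apply: ler_wpM2l => //; exact: sqr_ge0.
    by have := lerNnormlW h1; lra.
  pose x := k^-1; have x0 : 0 < x by rewrite invr_gt0.
  have sub : \int[mu]_(p in `[x / 2, x]) F p <= \int[mu]_p F p.
    exact: (Rintegral_subset_le _ _ F0 iF).
  have low : e * (x ^+ 2 / 4 * expR (-1)) * (x - x / 2) <= \int[mu]_(p in `[x / 2, x]) F p.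
    rewrite -Rintegral_cst_itv; last by lra.
    apply: le_Rintegral => //.
    - by apply: continuous_integrable => y; exact: cvg_cst.
    - by apply: integrableS iF.
    move=> p; rewrite /= in_itv /= => /andP[p1 p2].
    have p0 : 0 < p by lra.
    rewrite /F -[leLHS]addr0 lerD ?mulr_ge0 ?(ltW q0)//.
    apply: ler_pM; rewrite ?(ltW e0)//.
    - by rewrite mulr_ge0 ?expR_ge0// divr_ge0 ?sqr_ge0.
    - by apply: he; rewrite gtr0_norm// (le_lt_trans p2).
    have hx : x ^+ 2 / 4 <= p ^+ 2 by nra.
    have hg : expR (-1) <= gaussian (k ^+ 2) p.
      have kp : k * p <= 1 by rewrite mulrC -ler_pdivlMr// div1r.
      have kp0 : 0 <= k * p by rewrite mulr_ge0// ltW.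
      by rewrite /gaussian ler_expR lerN2 -exprMn exprn_ile1.
    apply: ler_pM hx hg; last exact: expR_ge0.
    exact: divr_ge0 (sqr_ge0 x) (ler0n _ 4).
  have := le_trans low sub; rewrite eF => main.
  have qle : q <= expR (eta ^+ 2) * (2 / eta ^+ 4) / k ^+ 4.
    rewrite /q (_ : - ((k ^+ 2 - 1) * eta ^+ 2) = eta ^+ 2 + - (k * eta) ^+ 2); last by ring.
    rewrite expRD -!mulrA ler_wpM2l ?expR_ge0// expRN.
    have z0 : 0 < (k * eta) ^+ 2 by rewrite exprn_gt0// mulr_gt0.
    have := expR_ge1Dxn 1 (ltW z0).
    rewrite (_ : (2`!%:R : R) = 2)// => z1.
    have -> : 2 * (eta ^- 4 * k ^- 4) = (((k * eta) ^+ 2) ^+ 2 / 2)^-1.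
      by field; rewrite !gt_eqF.
    have z2 : 0 < ((k * eta) ^+ 2) ^+ 2 / 2 by apply: divr_gt0 => //; exact: exprn_gt0.
    by rewrite lef_pV2 ?posrE ?expR_gt0//; lra.
  have m2 := le_trans main (ler_wpM2r J0 qle).
  have -> : e * expR (-1) / 8 = (e * (x ^+ 2 / 4 * expR (-1)) * (x - x / 2)) * k ^+ 3.
    by rewrite /x; field; rewrite gt_eqF.
  apply: le_trans (ler_wpM2r (exprn_ge0 3 (ltW k0)) m2) _.
  rewrite le_eqVlt; apply/orP; left; apply/eqP; field.
  by rewrite !gt_eqF.
pose A := J * expR (eta ^+ 2) * (2 / eta ^+ 4).
have A0 : 0 <= A.
  apply: mulr_ge0; first by apply: mulr_ge0 => //; exact: expR_ge0.
  by apply: divr_ge0 => //; exact: exprn_ge0 (ltW eta0).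
pose B := e * expR (-1) / 8.
have B0 : 0 < B by rewrite divr_gt0// mulr_gt0// expR_gt0.
pose k := 1 + eta^-1 + A / B + 1.
have ei0 : 0 < eta^-1 by rewrite invr_gt0.
have AB0 : 0 <= A / B := divr_ge0 A0 (ltW B0).
have k0 : 0 < k by rewrite /k; lra.
have ke : k^-1 < eta by rewrite -[ltRHS]invrK ltf_pV2 ?posrE//; rewrite /k; lra.
have k1 : 1 <= k by rewrite /k; lra.
have := lower k k0 ke k1; rewrite -/A -/B.
rewrite ler_pdivlMr// mulrC -ler_pdivlMr// /k; lra.
Qed.

End Exponent.

Section ExponentUnique.
Context {R : realType}.
Implicit Types (m : R) (ut : R -> R[i]) (w : functional R).

Lemma powR_small (a d B : R) : 0 < a -> 0 < d -> 0 <= B ->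
  exists2 eta, 0 < eta & forall p, 0 <= p -> p < eta -> p `^ a * B <= d.
Proof.
move=> a0 d0 B0; have B1 : 0 < B + 1 by rewrite ltr_wpDl.
have q0 : 0 < d / (B + 1) by rewrite divr_gt0.
exists ((d / (B + 1)) `^ a^-1); first by rewrite powR_gt0.
move=> p p0 peta.
have : p `^ a <= ((d / (B + 1)) `^ a^-1) `^ a.
  apply: ge0_ler_powR; rewrite ?nnegrE ?powR_ge0//; exact: ltW.
rewrite -powRrM mulVf ?gt_eqF// powRr1 ?(ltW q0)// => h.
apply: le_trans (ler_wpM2r B0 h) _.
rewrite -mulrAC ler_pdivrMr// ler_pM2l//; lra.
Qed.

(** The quotient [|p|^(m' - m)] of the two powers tends to 0 at the origin, so the
    term with the smaller exponent keeps its sign there. *)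
Lemma symbol_dominates m m' (g g' : R -> R) (B : R) :
  m < m' -> m' <= 1 -> {for 0, continuous g} -> 0 < g 0 -> (forall p, `|g' p| <= B) ->
  exists2 eta, 0 < eta & forall p, 0 < `|p| -> `|p| < eta ->
    g 0 / 4 <= `|p| `^ (m - 1) * g p - `|p| `^ (m' - 1) * g' p.
Proof.
move=> mm m'1 cg g0 g'B.
have B0 : 0 <= B := le_trans (normr_ge0 _) (g'B 0).
have a0 : 0 < m' - m by rewrite subr_gt0.
have g4 : 0 < g 0 / 4 by rewrite divr_gt0.
have [eta1 eta10 h1] := powR_small a0 g4 B0.
have /cvgrPdist_le/(_ _ g4) := cg; move=> /nbhs_ballP[eta2 /= eta20 h2].
exists (Num.min 1 (Num.min eta1 eta2)); first by rewrite !lt_min ltr01 eta10.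
move=> p p0; rewrite !lt_min => /and3P[p1 pe1 pe2].
have := h2 p; rewrite /ball /= sub0r normrN => /(_ pe2) hg.
have hp := h1 `|p| (normr_ge0 p) pe1.
have -> : `|p| `^ (m' - 1) = `|p| `^ (m - 1) * `|p| `^ (m' - m).
  by rewrite -powRD ?(gt_eqF p0) ?implybT//; congr (_ `^ _); ring.
rewrite -mulrA -mulrBr.
have hp' : `|p| `^ (m' - m) * g' p <= g 0 / 4.
  apply: le_trans hp; rewrite ler_wpM2l ?powR_ge0//.
  exact: le_trans (ler_norm _) (g'B p).
have hx : g 0 / 4 <= g p - `|p| `^ (m' - m) * g' p.
  by have := ler_norm (g 0 - g p); lra.
have hpow : 1 <= `|p| `^ (m - 1).
  rewrite -[leLHS](powRr0 `|p|); apply: ger_powR; first by rewrite p0 ltW.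
  by rewrite subr_le0 ltW// (lt_le_trans mm).
apply: (le_trans hx); rewrite ler_peMl//.
exact: le_trans (ltW g4) hx.
Qed.

(** Two symbols that define the same distribution have a difference that
    integrates to zero against every test function; [symbol_dominates] and
    [gaussian_test_absurd] exclude this unless the profile with the smaller
    exponent vanishes at the origin. *)
Lemma regular_symbol_part m m' ut ut' (B : R) w (P : R[i] -> R) :
  m < m' -> m' <= 1 -> (forall p, cabs (ut' p) <= B) ->
  regular w (symbol m ut) -> regular w (symbol m' ut') ->
  (forall (r : R) z, P (r%:C * z) = r * P z) -> (forall z, `|P z| <= cabs z) ->
  (forall f, cintegrable f ->
     (@lebesgue_measure R).-integrable setT (EFin \o (fun p => P (f p))) /\
     \int[@lebesgue_measure R]_p P (f p) = P (cintegral f)) ->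
  continuous (fun p : R => P (ut p)) -> P (ut 0) = 0.
Proof.
move=> mm m'1 utB reg reg' PZ Pc Pint cut; apply: contrapT => /eqP Pn0.
pose s := Num.sg (P (ut 0)).
have s1 : `|s| = 1 by rewrite normr_sg Pn0.
pose g p := s * P (ut p); pose g' p := s * P (ut' p).
have g0 : 0 < g 0 by rewrite /g /s -normrEsg normr_gt0.
have [eta eta0 he] : exists2 eta, 0 < eta & forall p, 0 < `|p| -> `|p| < eta ->
    g 0 / 4 <= `|p| `^ (m - 1) * g p - `|p| `^ (m' - 1) * g' p.
  apply: (@symbol_dominates m m' g g' B) => //.
    by move: cut => /(_ 0) cut; apply: cvgM => //; exact: cvg_cst.
  by move=> p; rewrite normrM s1 mul1r; exact: le_trans (Pc _) (utB p).
apply: (@gaussian_test_absurd R _ (g 0 / 4) eta _ eta0 _ he); first by rewrite divr_gt0.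
move=> n n0.
pose phi p := (p ^+ 2)%:C * (gaussian n p)%:C : R[i].
have sphi : schwartz phi by apply: schwartzX; exact: gaussian_schwartz.
have [i1 e1] := reg _ sphi; have [i2 e2] := reg' _ sphi.
have [j1 f1] := Pint _ i1; have [j2 f2] := Pint _ i2.
have E k (v : R -> R[i]) p : P (symbol k v p * phi p) =
    `|p| `^ (k - 1) * P (v p) * (p ^+ 2 * gaussian n p).
  rewrite /symbol /phi (_ : _ * _ = (`|p| `^ (k - 1) * (p ^+ 2 * gaussian n p))%:C * v p).
    by rewrite PZ mulrAC.
  by rewrite !rmorphM /=; ring.
have hE : (fun p => (`|p| `^ (m - 1) * g p - `|p| `^ (m' - 1) * g' p) * (p ^+ 2 * gaussian n p)) =
  (fun p => s * (P (symbol m ut p * phi p) - P (symbol m' ut' p * phi p))).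
  by apply/funext => p; rewrite !E /g /g'; ring.
have jB : (@lebesgue_measure R).-integrable setT (EFin \o (fun p =>
    P (symbol m ut p * phi p) - P (symbol m' ut' p * phi p))).
  by under [_ \o _]eq_fun do rewrite /= EFinB; exact: integrableB.
rewrite hE; split.
  by under [_ \o _]eq_fun do rewrite /= EFinM; exact: integrableZl.
by rewrite RintegralZl// RintegralB// f1 f2 -e1 -e2 subrr mulr0.
Qed.

Lemma regular_symbol_exponent m m' ut ut' (B : R) w :
  m < m' -> m' <= 1 -> cderivable ut -> (forall p, cabs (ut' p) <= B) ->
  regular w (symbol m ut) -> regular w (symbol m' ut') -> ut 0 = 0.
Proof.
move=> mm m'1 /cderivable_continuous[cR cI] utB reg reg'.
apply: complex_ext.
  apply: (regular_symbol_part mm m'1 utB reg reg' (P := @complex.Re R)) => //.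
  - by move=> r [a b] /=; rewrite mul0r subr0.
  - exact: Re_le_cabs.
  - by move=> f [].
apply: (regular_symbol_part mm m'1 utB reg reg' (P := @complex.Im R)) => //.
- by move=> r [a b] /=; rewrite mul0r addr0.
- exact: Im_le_cabs.
- by move=> f [].
Qed.

(** Condition (C3) fixes [mu]: a smaller exponent would force the profile to
    vanish at the origin, which the condition excludes. *)
Lemma condC3_exponent m m' alpha alpha' r r' w : m <= 1 -> m' <= 1 ->
  condC3 m alpha r w -> condC3 m' alpha' r' w -> m = m'.
Proof.
move=> m1 m'1 [ut [[dut [B utB] ut0 reg] _]] [ut' [[dut' [B' utB'] ut0' reg']] _].
case: (ltgtP m m') => // mm; exfalso.
  have := ut0 _; rewrite (regular_symbol_exponent mm m'1 dut utB' reg reg') eqxx.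
  by move=> /(_ (negbT (lt_eqF (lt_le_trans mm m'1)))).
have := ut0' _; rewrite (regular_symbol_exponent mm m1 dut' utB reg' reg) eqxx.
by move=> /(_ (negbT (lt_eqF (lt_le_trans mm m1)))).
Qed.

Lemma regular_dfourierVK (w : functional R) (g : R -> R[i]) :
  regular (dfourier (dfourierV w)) g -> regular w g.
Proof.
move=> reg phi sphi; have [i e] := reg phi sphi; split=> //.
by rewrite -e /dfourier /dfourierV fourierVK.
Qed.

End ExponentUnique.

Theorem corollary5p5 (R : realType) (c : R) (u0 v0 : functional R) :
  0 < c -> tempered u0 -> tempered v0 ->
  exists c1 c2 cc1 cc2 : R,
  forall mu alpha r : R,
    0 < mu -> mu <= 1 -> 3 < alpha - mu -> 0 <= r -> r <= c ->
    condC3 mu alpha r (dfourierV (a_plus c u0 v0)) ->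
    condC3 mu alpha r (dfourierV (a_minus c u0 v0)) ->
  forall u : R -> functional R, KG_solution c u0 v0 u ->
  exists ap am : R -> R[i],
    [/\ regular (a_plus c u0 v0) ap, cintegrable ap,
        regular (a_minus c u0 v0) am & cintegrable am] /\
    (forall t : R, 0 <= t -> regular (u t) (uKG c ap am t)) /\
    (forall t x : R, KG_cone c (t, x) ->
       cabs (uKG c ap am t x)
         <= c1 * t `^ (- (mu / 2)) + c2 * t `^ (- 2^-1)) /\
    (forall t x : R, KG_cone_compl c (t, x) ->
       cabs (uKG c ap am t x) <= cc1 * t `^ (- mu) + cc2 * t^-1).

Proof.
move=> c0 tu0 tv0.
pose admissible (mu alpha r : R) := [/\ 0 < mu, mu <= 1, 3 < alpha - mu, 0 <= r & r <= c] /\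
  (condC3 mu alpha r (dfourierV (a_plus c u0 v0)) /\
   condC3 mu alpha r (dfourierV (a_minus c u0 v0))).
have [[mu0 [alpha0 [r0 [[m0 m1 am _ _] [Cp Cm]]]]]|none] :=
    pselect (exists mu alpha r, admissible mu alpha r); last first.
  exists 0, 0, 0, 0 => mu alpha r h1 h2 h3 h4 h5 h6 h7.
  by exfalso; apply: none; exists mu, alpha, r.
have al3 : 3 < alpha0 by lra.
have al2 : 2 <= alpha0 by lra.
have [utp [[dp _ _ rp] [[Mp Mp0 bp] [lp [Mp' Mp0' vp]]]]] := Cp.
have [utm [[dm _ _ rm] [[Mm Mm0 bm] [lm [Mm' Mm0' vm]]]]] := Cm.
have {}rp := regular_dfourierVK rp; have {}rm := regular_dfourierVK rm.
have ip := symbol_cintegrable m1 al2 Mp0 bp rp.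
have im := symbol_cintegrable m1 al2 Mm0 bm rm.
have [C hC] := uKG_le c0 m0 m1 al3 Mp0 Mp0' Mm0 Mm0' dp dm bp bm lp lm vp vm ip im.
exists C, C, C, C => mu alpha r mu_gt0 mu_le1 _ _ _ Cp' _ u sol.
(* the constants and the amplitudes come from one admissible triple; any other
   triple has the same exponent *)
have <- : mu0 = mu := condC3_exponent m1 mu_le1 Cp Cp'.
exists (symbol mu0 utp), (symbol mu0 utm); split; first by [].
split; first by move=> t t0; exact: (KG_solution_regular c0 tv0 rp ip rm im sol t0).
split=> t x.
  by move=> [/= t0 _]; have [] := hC t x t0.
move=> [/= t0 out]; have [_] := hC t x t0; apply.
rewrite leNgt; apply/negP => xt; apply: out; split=> //=.
by rewrite ltr_pdivlMr// ltr_pdivrMr// mulNr -ltr_norml.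
Qed.
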